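(* Let $K$ be a field, let $X$ be the $3\times 6$ matrix of variables of the polynomial ring $K[X_{3\times 6}]$, let $\mathcal{M}_3$ be the set of $3$-minors of $X$, and let $G(3,6)=K[\mathcal{M}_3]$ be the $K$-subalgebra of $K[X_{3\times 6}]$ generated by $\mathcal{M}_3$. Let $$F=[1,2,3][4,5,6]-[1,2,4][3,5,6]$$ and let $$O_F=\bigl\{[a,b,c][d,e,f]-[a,b,d][c,e,f] : \{a,b,c,d,e,f\}=\{1,\dots,6\}\bigr\}\mod \pm1$$ be its orbit, up to sign, under the action of $S_6$ permuting the columns of $X$. Then the set $\mathcal{M}_3\cup O_F$ is a universal Sagbi basis of $G(3,6)$. More precisely, for every monomial order on $K[X_{3\times 6}]$, a Sagbi basis of $G(3,6)$ is obtained by adding at most one element of $O_F$ to $\mathcal{M}_3$.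
   Context: For column indices $a,b,c$, $[a,b,c]$ denotes the determinant of the $3\times 3$ matrix formed by the columns $a,b,c$ of $X$ in this order. ''Mod $\pm1$'' means that polynomials differing only by sign are identified (one representative is chosen for each pair $\pm H$). Given a polynomial ring $R$ over $K$ with a monomial order and a $K$-subalgebra $A\subset R$, the initial algebra $\operatorname{in}(A)$ is the $K$-subalgebra of $R$ which, as a $K$-vector space, is spanned by the initial monomials of the nonzero elements of $A$. A subset $\mathcal{F}\subset A$ is a Sagbi basis of $A$ with respect to the given order if the initial monomials $\operatorname{in}(f)$, $f\in\mathcal{F}$, generate $\operatorname{in}(A)$ as a $K$-algebra. A universal Sagbi basis of $A$ is a subset of $A$ that is a Sagbi basis of $A$ with respect to every monomial order on $R$. *)

(* Defs.v *)
From HB Require Import structures.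
From mathcomp Require Import all_boot all_order all_fingroup all_algebra.
From mathcomp Require Export mpoly.

Set Implicit Arguments.
Unset Strict Implicit.
Unset Printing Implicit Defensive.

Import GRing.Theory.
Local Open Scope ring_scope.

(* Sets of polynomials are Prop-valued predicates. *)

Inductive subalg_gen (K : fieldType) (A : algType K) (S : A -> Prop) :
    A -> Prop :=
| subalg_gen_const c : subalg_gen S c%:A
| subalg_gen_mem x : S x -> subalg_gen S x
| subalg_gen_add x y : subalg_gen S x -> subalg_gen S y -> subalg_gen S (x + y)
| subalg_gen_mul x y : subalg_gen S x -> subalg_gen S y -> subalg_gen S (x * y).

Inductive lin_span (K : fieldType) (V : lmodType K) (S : V -> Prop) :
    V -> Prop :=
| lin_span_zero : lin_span S 0
| lin_span_cons c x y : S x -> lin_span S y -> lin_span S (c *: x + y).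

Record monomial_order (n : nat) (le : rel 'X_{1..n}) : Prop := MonomialOrder {
  monomial_order_refl : reflexive le;
  monomial_order_anti : antisymmetric le;
  monomial_order_trans : transitive le;
  monomial_order_total : total le;
  monomial_order_min : forall m, le 0%MM m;
  monomial_order_add : forall m m1 m2, le m1 m2 -> le (m + m1)%MM (m + m2)%MM
}.

Section Sagbi.
Variables (K : fieldType) (n : nat).
Implicit Types (le : rel 'X_{1..n}) (A S : {mpoly K[n]} -> Prop).

(* Unsatisfiable when f = 0, so the sets of initial monomials below only
   take the nonzero elements into account. *)
Definition is_initial_monomial le (f : {mpoly K[n]}) (m : 'X_{1..n}) : Prop :=
  m \in msupp f /\ forall m', m' \in msupp f -> le m' m.

Definition initial_monomials le S : {mpoly K[n]} -> Prop :=
  fun p => exists f m, [/\ S f, is_initial_monomial le f m & p = 'X_[m]].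

Definition initial_algebra le A : {mpoly K[n]} -> Prop :=
  lin_span (initial_monomials le A).

Definition sagbi_basis le A S : Prop :=
  (forall f, S f -> A f) /\
  (forall p, subalg_gen (initial_monomials le S) p <-> initial_algebra le A p).

Definition universal_sagbi_basis A S : Prop :=
  forall le, monomial_order le -> sagbi_basis le A S.

End Sagbi.

Section Grassmannian36.
Variable K : fieldType.
Local Notation R := {mpoly K[3 * 6]}.
Implicit Types (a b c d e f : 'I_6).

Definition genX : 'M[R]_(3, 6) := \matrix_(i, j) 'X_(mxvec_index i j).

Definition bracket a b c : R := \det (colsub (tnth [tuple a; b; c]) genX).

Definition minors3 : R -> Prop :=
  fun p => exists a b c : 'I_6, (a < b < c)%N /\ p = bracket a b c.

Definition G36 : R -> Prop := subalg_gen minors3.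

Definition exchange a b c d e f : R :=
  bracket a b c * bracket d e f - bracket a b d * bracket c e f.

(* [1,2,3][4,5,6] - [1,2,4][3,5,6], with columns numbered from 0. *)
Definition polyF : R :=
  exchange (inord 0) (inord 1) (inord 2) (inord 3) (inord 4) (inord 5).

(* All elements, before the identification of H and - H. *)
Definition orbitF : R -> Prop :=
  fun H => exists a b c d e f : 'I_6,
    [set a; b; c; d; e; f] = [set: 'I_6] /\ H = exchange a b c d e f.

(* T consists of one representative for each pair {H, - H} with H in S;
   in characteristic 2 such a pair has a single element. *)
Definition representatives_mod_sign (S T : R -> Prop) : Prop :=
  (forall H, T H -> S H) /\
  (forall H, S H -> exists! H', T H' /\ (H' = H \/ H' = - H)).

(* The K-algebra endomorphism X_(i, j) |-> X_(i, s j). *)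
Definition column_action (s : 'S_6) (p : R) : R :=
  p \mPo [tuple mxvec (col_perm s genX) 0 k | k < 3 * 6].

Lemma column_action_bracket s a b c :
  column_action s (bracket a b c) = bracket (s a) (s b) (s c).
Proof.
rewrite /column_action /bracket -det_map_mx; congr (\det _).
apply/matrixP=> i k; rewrite !mxE /= comp_mpolyXU -tnth_nth tnth_mktuple.
rewrite mxvecE !mxE.
by case: k => [[|[|[|k]]] Hk].
Qed.

Lemma column_action_exchange s a b c d e f :
  column_action s (exchange a b c d e f) =
  exchange (s a) (s b) (s c) (s d) (s e) (s f).
Proof.
have E x y z := column_action_bracket s x y z.
by rewrite /exchange -!E /column_action rmorphB !rmorphM.
Qed.

Lemma orbitFP H : orbitF H <-> exists s : 'S_6, H = column_action s polyF.
Proof.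
pose v a b c d e f (i : 'I_6) := tnth [tuple a; b; c; d; e; f] i.
have vE a b c d e f : [/\ v a b c d e f (inord 0) = a,
    v a b c d e f (inord 1) = b, v a b c d e f (inord 2) = c
  & [/\ v a b c d e f (inord 3) = d, v a b c d e f (inord 4) = e
      & v a b c d e f (inord 5) = f]].
  by rewrite /v !(tnth_nth a) !inordK.
split=> [[a [b [c [d [e [f [Eset ->]]]]]]]|[s ->]].
  have inj : injective (v a b c d e f).
    apply/injectiveP/card_uniqP; rewrite size_codom.
    apply: eq_card => x; rewrite [RHS]inE; apply/codomP.
    have: x \in [set a; b; c; d; e; f] by rewrite Eset inE.
    have [E0 E1 E2 [E3 E4 E5]] := vE a b c d e f.
    rewrite !inE -!orbA; move=> /or4P[|||/or3P[||]] /eqP ->;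
      by eexists; symmetry; eassumption.
  exists (perm inj); rewrite column_action_exchange !permE.
  by have [-> -> -> [-> -> ->]] := vE a b c d e f.
rewrite column_action_exchange; do 6 eexists; split; last by [].
apply/setP=> x; rewrite inE; have [y ->] : exists y, x = s y.
  by exists ((s^-1)%g x); rewrite permKV.
rewrite !inE !(inj_eq perm_inj) -!val_eqE /= !inordK //.
by case: y => [[|[|[|[|[|[|y]]]]]] Hy].
Qed.

End Grassmannian36.

(* Main.v *)
Require Import Defs.
From mathcomp Require Import all_boot all_order all_fingroup all_algebra.
From mathcomp Require Import zify ring.

(** The initial monomials of the 20 minors satisfy, for every three-term Pluecker
    relation, that the two larger products agree and the third is smaller. As for
    the tropical Grassmannian of (3,6), only 1005 outcomes are possible, and they
    form seven orbits under S_6. In each orbit the resulting binomial relations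
    leave a space of dimension 10, which is also the rank of the initial
    monomials, so that these relations determine which products of minors have
    equal initial monomials. A regular unimodular triangulation then singles out
    standard words: the other words are rewritten into them in G(3,6), and
    functionals vanishing on the facets show that distinct standard words have
    distinct initial monomials, which is the Sagbi property. In the orbit of size
    15 a further generator from O_F is needed; its initial monomial takes one of
    two values, and either one admits such a triangulation. *)

(** A monomial order is not handed over as a weight vector, so no point of a tropical variety is
    available. The exponent vectors of the initial monomials, compared by [le], take the place of
    tropical coordinates, and impossible outcomes are refuted by adding inequalities. The number 10
    = 3 * (6 - 3) + 1 is the Krull dimension of G(3,6). That the relations leave at most ten
    dimensions is checked once per orbit, by propagation from ten base minors. That the exponent
    vectors span at least ten must hold uniformly in the order; it is proved apart from the
    classification, by comparing triples that differ in one column. Once both agree, every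
    functional compatible with the relations is a linear function of the exponents, whatever the
    order is. Equality of initial monomials then becomes a finite condition that a certificate can
    settle. The field does not matter: the minors have coefficients 1 and -1, so that their initial
    monomials can be studied over the rationals, and the rewriting rules are identities over the
    integers. *)

Set Implicit Arguments.
Unset Strict Implicit.
Unset Printing Implicit Defensive.

Import GRing.Theory.
Local Open Scope ring_scope.

(** * Spans and generated subalgebras *)

Section Spans.
Variables (K : fieldType) (V : lmodType K).
Implicit Types S : V -> Prop.

Lemma lin_span_mem S x : S x -> lin_span S x.
Proof.
move=> Sx; rewrite -[x]addr0 -[x]scale1r; exact: lin_span_cons Sx (lin_span_zero _).
Qed.

Lemma lin_span_add S x y : lin_span S x -> lin_span S y -> lin_span S (x + y).
Proof.
move=> hx hy; elim: hx => [|c u v Su _ IH]; first by rewrite add0r.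
by rewrite -addrA; apply: lin_span_cons.
Qed.

Lemma lin_span_scale S c x : lin_span S x -> lin_span S (c *: x).
Proof.
elim=> [|d u v Su _ IH]; first by rewrite scaler0; apply: lin_span_zero.
by rewrite scalerDr scalerA; apply: lin_span_cons.
Qed.

Lemma lin_span_bind S S' x :
  lin_span S x -> (forall y, S y -> lin_span S' y) -> lin_span S' x.
Proof.
move=> hx h; elim: hx => [|c u v Su _ IH]; first exact: lin_span_zero.
by apply: lin_span_add => //; apply/lin_span_scale/h.
Qed.

End Spans.

Section SpansAlg.
Variables (K : fieldType) (A : algType K).
Implicit Types S : A -> Prop.

Lemma lin_span_mulr S S' x y : lin_span S x -> lin_span S' y ->
  lin_span (fun z => exists u v, [/\ S u, S' v & z = u * v]) (x * y).
Proof.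
move=> hx hy; elim: hx => [|c u v Su _ IH]; first by rewrite mul0r; apply: lin_span_zero.
rewrite mulrDl; apply: lin_span_add => //; rewrite -scalerAl; apply: lin_span_scale.
elim: hy => [|d w z Sw _ IH']; first by rewrite mulr0; apply: lin_span_zero.
rewrite mulrDr; apply: lin_span_add => //; rewrite -scalerAr; apply: lin_span_scale.
by apply: lin_span_mem; exists u, w.
Qed.

Lemma subalg_gen_scale S c x : subalg_gen S x -> subalg_gen S (c *: x).
Proof. by move=> h; rewrite -mulr_algl; apply: subalg_gen_mul => //; apply: subalg_gen_const. Qed.

Lemma subalg_gen_opp S x : subalg_gen S x -> subalg_gen S (- x).
Proof. by rewrite -scaleN1r; apply: subalg_gen_scale. Qed.

Lemma subalg_gen_sub S x y : subalg_gen S x -> subalg_gen S y -> subalg_gen S (x - y).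
Proof. by move=> hx hy; apply: subalg_gen_add => //; apply: subalg_gen_opp. Qed.

Lemma subalg_gen_zero S : subalg_gen S 0.
Proof. by rewrite -(scale0r 1); apply: subalg_gen_const. Qed.

Lemma subalg_gen_one S : subalg_gen S 1.
Proof. by rewrite -(scale1r 1); apply: subalg_gen_const. Qed.

Lemma subalg_gen_prod S (I : eqType) (r : seq I) (F : I -> A) :
  {in r, forall i, subalg_gen S (F i)} -> subalg_gen S (\prod_(i <- r) F i).
Proof.
elim: r => [|i r IH] h; first by rewrite big_nil; apply: subalg_gen_one.
rewrite big_cons; apply: subalg_gen_mul; first by apply: h; rewrite mem_head.
by apply: IH => j jr; apply: h; rewrite inE jr orbT.
Qed.

Lemma subalg_gen_lin_span S x : lin_span (subalg_gen S) x -> subalg_gen S x.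
Proof.
elim=> [|c u v Su _ IH]; first exact: subalg_gen_zero.
by apply: subalg_gen_add => //; apply: subalg_gen_scale.
Qed.

Lemma subalg_gen_bind S S' x :
  subalg_gen S x -> (forall y, S y -> subalg_gen S' y) -> subalg_gen S' x.
Proof.
move=> hx h; elim: hx => [c|y|y z _ hy _ hz|y z _ hy _ hz].
- exact: subalg_gen_const.
- exact: h.
- exact: subalg_gen_add.
exact: subalg_gen_mul.
Qed.

End SpansAlg.

(** * Monomial orders and initial monomials *)

Section Order.
Variables (n : nat) (le : rel 'X_{1..n}).
Hypothesis ole : monomial_order le.
Implicit Types m a b c d : 'X_{1..n}.

Definition mlt a b := ~~ le b a.

Let refl := monomial_order_refl ole.
Let trans := monomial_order_trans ole.

Lemma mle_refl m : le m m. Proof. exact: refl. Qed.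

Lemma mle_anti a b : le a b -> le b a -> a = b.
Proof. by move=> h1 h2; apply: (monomial_order_anti ole); rewrite h1. Qed.

Lemma mltW a b : mlt a b -> le a b.
Proof. by rewrite /mlt; case/orP: (monomial_order_total ole a b) => ->. Qed.

Lemma mlt_neqAle a b : mlt a b = (a != b) && le a b.
Proof.
rewrite /mlt; case: eqVneq => [->|ne] /=; first by rewrite refl.
apply/idP/idP => [/mltW //|ab]; apply: contra ne => ba.
by apply/eqP/mle_anti.
Qed.

Lemma mltNge a b : ~~ mlt a b -> le b a.
Proof. by rewrite negbK. Qed.

Lemma mle_add2l m a b : le (m + a)%MM (m + b)%MM = le a b.
Proof.
apply/idP/idP => [h|]; last exact: (monomial_order_add ole).
case/orP: (monomial_order_total ole a b) => // ba.
have := mle_anti h (monomial_order_add ole m ba).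
by move/addmI=> ->; apply: refl.
Qed.

Lemma mle_add a b c d : le a b -> le c d -> le (a + c)%MM (b + d)%MM.
Proof.
move=> ab cd; apply: (trans (y := (a + d)%MM)); first by rewrite mle_add2l.
by rewrite addmC [X in le _ X]addmC mle_add2l.
Qed.

Lemma mle_lt_trans b a c : le a b -> mlt b c -> mlt a c.
Proof. by move=> ab; apply: contra => ca; apply: trans ab. Qed.

Lemma mlt_le_trans b a c : mlt a b -> le b c -> mlt a c.
Proof. by move=> ab bc; apply: contra ab => ca; apply: trans ca. Qed.

Lemma mlt_add2l m a b : mlt (m + a)%MM (m + b)%MM = mlt a b.
Proof. by rewrite /mlt mle_add2l. Qed.

Lemma mlt_le_add a b c d : mlt a b -> le c d -> mlt (a + c)%MM (b + d)%MM.
Proof.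
move=> ab cd; apply: (mlt_le_trans (b := (b + c)%MM)); last by rewrite mle_add2l.
by rewrite addmC [X in mlt _ X]addmC mlt_add2l.
Qed.

Lemma mle_lt_add a b c d : le a b -> mlt c d -> mlt (a + c)%MM (b + d)%MM.
Proof. by move=> ab cd; rewrite addmC [X in mlt _ X]addmC; apply: mlt_le_add. Qed.

Definition maxm (s : seq 'X_{1..n}) : 'X_{1..n} :=
  foldr (fun a b => if le a b then b else a) 0%MM s.

Lemma maxm_ge s m : m \in s -> le m (maxm s).
Proof.
elim: s => //= a s IH; rewrite inE; case: ifP => h /orP[/eqP->|/IH] //.
by move=> h'; apply: (trans h'); apply: mltW; rewrite /mlt h.
Qed.

Lemma maxm_mem s : s != [::] -> maxm s \in s.
Proof.
elim: s => //= a s IH _; case: ifP => h; last by rewrite mem_head.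
(* The default [0] is the least monomial, so that a one-element list yields it only when its element
   is [0]. *)
case: s IH h => [_ h|b s /(_ isT) IH _]; last by rewrite inE IH orbT.
rewrite inE; apply/eqP/mle_anti => //; exact: (monomial_order_min ole).
Qed.

(** Antisymmetry makes the maximum depend on the set of entries only; the symmetry of [bracket_init]
    in its columns rests on this. *)
Lemma maxm_eqi s t : s =i t -> maxm s = maxm t.
Proof.
move=> st; have nil2 (s' t' : seq 'X_{1..n}) : s' =i t' -> s' = [::] -> t' = [::].
  by case: t' => // b t' h e; move: (h b); rewrite e mem_head.
case: (eqVneq s [::]) => [s0|s0]; first by rewrite (nil2 _ _ st s0) s0.
have t0 : t != [::].
  by apply: contra s0 => /eqP t0; rewrite (nil2 t s) // => x; rewrite st.
apply: mle_anti; apply: maxm_ge; [rewrite -st|rewrite st]; exact: maxm_mem.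
Qed.

Section Init.
Variable K : fieldType.
Implicit Types f g h : {mpoly K[n]}.
Local Notation init := (@is_initial_monomial K n le).

Lemma initP f m : init f m <-> f@_m != 0 /\ forall m', mlt m m' -> f@_m' = 0.
Proof.
split=> [[mf h]|[h0 h]].
  split; first by rewrite -mcoeff_msupp.
  move=> m' lt; apply: memN_msupp_eq0; apply: contra lt => /h //.
split; first by rewrite mcoeff_msupp.
by move=> m'; rewrite mcoeff_msupp; apply: contraR => /h ->.
Qed.

Lemma init_unique f m m' : init f m -> init f m' -> m = m'.
Proof. by move=> [h1 h2] [h3 h4]; apply: mle_anti; auto. Qed.

Lemma init_exists f : f != 0 -> exists m, init f m.
Proof.
move=> f0; exists (maxm (msupp f)); split; last exact: maxm_ge.
by apply: maxm_mem; rewrite msupp_eq0.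
Qed.

Lemma init_scale (k : K) f m : k != 0 -> init f m -> init (k *: f) m.
Proof.
move=> k0 /initP[h1 h2]; apply/initP; rewrite mcoeffZ mulf_neq0 //; split=> //.
by move=> m' /h2; rewrite mcoeffZ => ->; rewrite mulr0.
Qed.

Lemma init_opp f m : init f m -> init (- f) m.
Proof. by rewrite -scaleN1r; apply: init_scale; rewrite oppr_eq0 oner_eq0. Qed.

(** By strict monotonicity every other pair of support monomials has a different sum. The
    coefficient itself, and not only the initial monomial, is needed to follow signs through the
    three-term relations. *)
Lemma mcoeff_initM f g m m' : init f m -> init g m' ->
  (f * g)@_(m + m')%MM = f@_m * g@_m'.
Proof.
move=> [mf hf] [mg hg]; rewrite mpolyME raddf_sum /= (bigD1_seq (m, m')) /=.
- rewrite mcoeffZ mcoeffX eqxx mulr1 big_seq_cond big1 ?addr0 // => -[a b] /=.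
  case/andP=> /allpairsP[[a' b'] /= [af bg [-> ->]]] ne.
  rewrite mcoeffZ mcoeffX; case: eqP => [e|_]; rewrite ?mulr0 //.
  have [ea|am] := eqVneq a' m.
    by move: ne; rewrite ea xpair_eqE eqxx /=; move: e; rewrite ea => /addmI->; rewrite eqxx.
  have : mlt (a' + b')%MM (m + m')%MM by apply: mlt_le_add (hg _ bg); rewrite mlt_neqAle am hf.
  by rewrite e mlt_neqAle eqxx.
- exact: allpairs_f.
by rewrite allpairs_uniq ?msupp_uniq // => -[a b] [c d].
Qed.

Lemma init_mul f g m m' : init f m -> init g m' -> init (f * g) (m + m')%MM.
Proof.
move=> If Ig; split.
  rewrite mcoeff_msupp mcoeff_initM // mulf_neq0 //.
    by case/initP: If. by case/initP: Ig.
move=> a /msuppM_le/allpairsP[[b c] /= [bf cg ->]].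
by apply: mle_add; [case: If|case: Ig]; auto.
Qed.

Lemma init_one : init 1 0%MM.
Proof.
split; first by rewrite msupp1 inE.
by move=> m'; rewrite msupp1 inE => /eqP->; apply: mle_refl.
Qed.

Lemma init_prod (I : eqType) (r : seq I) (F : I -> {mpoly K[n]}) (mu : I -> 'X_{1..n}) :
  {in r, forall i, init (F i) (mu i)} ->
  init (\prod_(i <- r) F i) (\sum_(i <- r) mu i)%MM.
Proof.
elim: r => [|i r IH] h; first by rewrite !big_nil; apply: init_one.
rewrite !big_cons; apply: init_mul; first by apply: h; rewrite mem_head.
by apply: IH => j jr; apply: h; rewrite inE jr orbT.
Qed.

(** Terms with the same index are merged, so that later no cancellation can hide in a repeated
    index. *)
Lemma lin_span_indexed (I : eqType) (P : I -> Prop) (u : I -> {mpoly K[n]}) f :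
  lin_span (fun g => exists2 i, P i & g = u i) f ->
  exists (r : seq I) (c : I -> K),
    [/\ uniq r, {in r, forall i, P i} & f = \sum_(i <- r) c i *: u i].
Proof.
elim=> [|c _ y [i Pi ->] _ [r [d [ur Pr ->]]]].
  by exists [::], (fun=> 0); split => //; rewrite big_nil.
case: (boolP (i \in r)) => ir.
  exists r, (fun j => if j == i then c + d i else d j); split=> //.
  rewrite !(bigD1_seq i) //= eqxx scalerDl -addrA; congr (_ + (_ + _)).
  by apply: eq_bigr => j /negbTE ->.
exists (i :: r), (fun j => if j == i then c else d j); split=> /=.
- by rewrite ir.
- by move=> j; rewrite inE => /orP[/eqP->|/Pr].
rewrite big_cons eqxx; congr (_ + _); apply: eq_big_seq => j jr.
by case: eqP => // e; rewrite -e jr in ir.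
Qed.

(** Since the initial monomials of the [u i] are distinct, the largest one that occurs with a
    nonzero coefficient cannot be cancelled by the other terms. *)
Lemma init_lin_comb (I : eqType) (P : I -> Prop) (u : I -> {mpoly K[n]})
    (mu : I -> 'X_{1..n}) f m :
  (forall i, P i -> init (u i) (mu i)) ->
  (forall i j, P i -> P j -> mu i = mu j -> i = j) ->
  lin_span (fun g => exists2 i, P i & g = u i) f -> init f m ->
  exists2 i, P i & m = mu i.
Proof.
move=> hu hinj /lin_span_indexed[r0 [c [ur0 Pr0 ->]]].
pose r := [seq i <- r0 | c i != 0].
have ur : uniq r by rewrite filter_uniq.
have Pr : {in r, forall i, P i} by move=> i; rewrite mem_filter => /andP[_ /Pr0].
have cr : {in r, forall i, c i != 0} by move=> i; rewrite mem_filter => /andP[].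
have -> : \sum_(i <- r0) c i *: u i = \sum_(i <- r) c i *: u i.
  rewrite big_filter [LHS](bigID (fun i => c i != 0)) /= [X in _ + X]big1 ?addr0 //.
  by move=> i /negPn/eqP ->; rewrite scale0r.
move=> Im.
have r0' : map mu r != [::].
  case: (r) Im => // -[]; by rewrite big_nil msupp0.
have /mapP[i ir Ei] := maxm_mem r0'.
exists i; first exact: Pr.
apply: init_unique Im _; apply/initP; split.
  rewrite raddf_sum /= (bigD1_seq i) //= big_seq_cond big1 ?addr0.
    rewrite mcoeffZ mulf_neq0 ?cr //; by case/initP: (hu _ (Pr _ ir)).
  move=> j /andP[jr ji]; rewrite mcoeffZ; case/initP: (hu _ (Pr _ jr)) => _ -> //.
    by rewrite mulr0.
  rewrite mlt_neqAle -Ei maxm_ge ?map_f // andbT Ei.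
  by apply: contra ji => /eqP e; apply/eqP/hinj; auto.
move=> m' lt; rewrite raddf_sum /= big_seq big1 // => j jr.
rewrite mcoeffZ; case/initP: (hu _ (Pr _ jr)) => _ -> //; first by rewrite mulr0.
by apply: mle_lt_trans lt; rewrite -Ei maxm_ge ?map_f.
Qed.

Lemma initial_algebra_subalg (S : {mpoly K[n]} -> Prop) p :
  subalg_gen (initial_monomials le (subalg_gen S)) p ->
  initial_algebra le (subalg_gen S) p.
Proof.
elim=> [c|x|x y _ hx _ hy|x y _ hx _ hy].
- apply/lin_span_scale/lin_span_mem; exists 1, 0%MM; split; last by rewrite mpolyX0.
    exact: subalg_gen_one.
  exact: init_one.
- exact: lin_span_mem.
- exact: lin_span_add.
have := lin_span_mulr hx hy; move/lin_span_bind; apply=> z.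
move=> [_ [_ [[f [m [Sf If ->]]] [g [m' [Sg Ig ->]]] ->]]].
apply: lin_span_mem; exists (f * g), (m + m')%MM; split.
- exact: subalg_gen_mul.
- exact: init_mul.
by rewrite mpolyXD.
Qed.

Lemma sagbi_basis_of_initials (S T : {mpoly K[n]} -> Prop) :
  (forall f, T f -> subalg_gen S f) ->
  (forall f m, subalg_gen S f -> init f m ->
     subalg_gen (initial_monomials le T) 'X_[m]) ->
  sagbi_basis le (subalg_gen S) T.
Proof.
move=> TS h; split=> // p; split=> hp.
  apply: initial_algebra_subalg; apply: subalg_gen_bind hp _ => _ [f [m [Tf If ->]]].
  by apply: subalg_gen_mem; exists f, m; split; auto.
apply: subalg_gen_lin_span; apply: lin_span_bind hp _ => _ [f [m [Sf If ->]]].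
by apply: lin_span_mem; apply: h If.
Qed.

End Init.
End Order.

(** * Standard words *)

(* [rels] lists the forbidden pairs (i, j), each with the signed words that
   replace the product of the i-th and the j-th generator. *)
Definition rewriting := seq (nat * nat * seq (bool * seq nat)).

Definition weight (v w : seq nat) : nat := foldr (fun i x => nth 0%N v i + x)%N 0%N w.

Lemma weightE v w : weight v w = (\sum_(i <- w) nth 0 v i)%N.
Proof. by elim: w => [|i w IH]; rewrite ?big_nil // big_cons -IH. Qed.

Lemma weight_cat v w1 w2 : weight v (w1 ++ w2) = (weight v w1 + weight v w2)%N.
Proof. by rewrite !weightE big_cat. Qed.

Lemma weight_perm v w1 w2 : perm_eq w1 w2 -> weight v w1 = weight v w2.
Proof. by rewrite !weightE => pw; apply: perm_big. Qed.

Definition reduced (rels : rewriting) (w : seq nat) : bool :=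
  all (fun r => ~~ ((r.1.1 \in w) && (r.1.2 \in w))) rels.

Definition standard (N : nat) (rels : rewriting) (w : seq nat) : bool :=
  [&& sorted leq w, all (ltn^~ N) w & reduced rels w].

(** The two letters of a rule must differ because [reduced] tests membership: with equal letters a
    single occurrence would already count as their product. *)
Definition rewriting_lowers (N : nat) (W : seq nat) (rels : rewriting) : bool :=
  all (fun r => (r.1.1 != r.1.2) && all (fun t => all (ltn^~ N) t.2 &&
    (weight W t.2 < nth 0%N W r.1.1 + nth 0%N W r.1.2)%N) r.2) rels.

Section StandardWords.
Variables (K : fieldType) (n : nat) (le : rel 'X_{1..n}).
Hypothesis ole : monomial_order le.
Variables (N : nat) (g : nat -> {mpoly K[n]}) (x : nat -> 'X_{1..n}).
Variables (S T : {mpoly K[n]} -> Prop).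
Variables (rels : rewriting) (W : seq nat).

Definition word_prod (w : seq nat) : {mpoly K[n]} := \prod_(i <- w) g i.

Hypothesis init_g : forall i, (i < N)%N -> is_initial_monomial le (g i) (x i).
Hypothesis S_g : forall f, S f -> exists2 i, (i < N)%N & f = g i \/ f = - g i.
Hypothesis T_S : forall f, T f -> subalg_gen S f.
Hypothesis g_T : forall i, (i < N)%N -> exists2 f, T f & f = g i \/ f = - g i.
Hypothesis rels_g : all (fun r : nat * nat * seq (bool * seq nat) =>
  word_prod [:: r.1.1; r.1.2] == \sum_(t <- r.2) (-1) ^+ t.1 * word_prod t.2) rels.
Hypothesis rels_W : rewriting_lowers N W rels.

Lemma words_span f : subalg_gen S f ->
  lin_span (fun y => exists2 w, all (ltn^~ N) w & y = word_prod w) f.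
Proof.
elim=> [c|y Sy|y z _ hy _ hz|y z _ hy _ hz].
- apply/lin_span_scale/lin_span_mem; exists [::] => //.
  by rewrite /word_prod big_nil.
- have [i iN e] := S_g Sy.
  have h : lin_span (fun y => exists2 w, all (ltn^~ N) w & y = word_prod w) (g i).
    by apply: lin_span_mem; exists [:: i]; rewrite /= ?iN ///word_prod big_seq1.
  by case: e => -> //; rewrite -scaleN1r; apply: lin_span_scale.
- exact: lin_span_add.
apply: lin_span_bind (lin_span_mulr hy hz) _ => _ [_ [_ [[u hu ->] [v hv ->] ->]]].
by apply: lin_span_mem; exists (u ++ v); rewrite ?all_cat ?hu // /word_prod big_cat.
Qed.

(** Every rule strictly lowers the [W]-weight of a word, so that rewriting terminates. Confluence
    plays no part, as only spanning is claimed; independence comes later from the initial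
    monomials. *)
Lemma standard_span w : all (ltn^~ N) w ->
  lin_span (fun y => exists2 w, standard N rels w & y = word_prod w) (word_prod w).
Proof.
have [k] := ubnP (weight W w); elim: k w => // k IH w; rewrite ltnS => wk wN.
case: (boolP (reduced rels w)) => [red|].
  apply: lin_span_mem; exists (sort leq w); last first.
    by apply: perm_big; rewrite perm_sym perm_sort.
  apply/and3P; split.
  - by apply: sort_sorted; apply: leq_total.
  - by rewrite all_sort.
  apply: sub_all red => r; by rewrite !mem_sort.
case/allPn=> -[[i j] ts] /= rin /negPn/andP[iw jw].
have /andP[/= ij /allP hts] := allP rels_W _ rin.
have /eqP/= def := allP rels_g _ rin.
have [w' pw] : exists w', perm_eq w (i :: j :: w').
  exists (rem j (rem i w)); rewrite (perm_trans (perm_to_rem iw)) // perm_cons.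
  apply: perm_to_rem; move: jw; rewrite (perm_mem (perm_to_rem iw)) inE.
  by rewrite eq_sym (negbTE ij).
have -> : word_prod w = \sum_(t <- ts) (-1) ^+ t.1 *: word_prod (t.2 ++ w').
  rewrite /word_prod (perm_big _ pw) /= !big_cons mulrA.
  have -> : g i * g j = word_prod [:: i; j] by rewrite /word_prod !big_cons big_nil mulr1.
  rewrite def mulr_suml; apply: eq_bigr => t _; rewrite big_cat /=.
  by case: t.1; rewrite ?expr1 ?expr0 ?scaleN1r ?scale1r ?mulN1r ?mul1r ?mulNr.
have w'N : all (ltn^~ N) w' by move: wN; rewrite (perm_all _ pw) => /and3P[].
have wW : weight W w = (nth 0 W i + nth 0 W j + weight W w')%N.
  by rewrite (weight_perm _ pw) /= addnA.
rewrite big_seq_cond; elim/big_ind: _ => [|a b|t /andP[/hts/andP[tN tW] _]].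
- exact: lin_span_zero.
- exact: lin_span_add.
apply/lin_span_scale/IH; last by rewrite all_cat tN.
by apply: leq_trans wk; rewrite weight_cat wW ltn_add2r.
Qed.

(** Standard words span the algebra, and separation gives them distinct initial monomials. Hence the
    initial monomial of any element is that of a standard word, a product of initial monomials of
    generators. Signs are allowed in [S_g] and [g_T] because relabelled brackets are minors only up
    to sign. *)
Theorem sagbi_of_standard_words :
  (forall w w', standard N rels w -> standard N rels w' ->
     (\sum_(i <- w) x i)%MM = (\sum_(i <- w') x i)%MM -> perm_eq w w') ->
  sagbi_basis le (subalg_gen S) T.
Proof.
move=> sep; apply: sagbi_basis_of_initials => // f m Sf If.
have std_init w : standard N rels w ->
    is_initial_monomial le (word_prod w) (\sum_(i <- w) x i)%MM.
  by case/and3P=> _ /allP wN _; apply: init_prod => // i /wN /init_g.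
have std_inj w w' : standard N rels w -> standard N rels w' ->
    (\sum_(i <- w) x i)%MM = (\sum_(i <- w') x i)%MM -> w = w'.
  move=> sw sw' e; apply: (sorted_eq leq_trans anti_leq); last exact: sep.
    by case/and3P: sw. by case/and3P: sw'.
have span : lin_span (fun y => exists2 w, standard N rels w & y = word_prod w) f.
  by apply: lin_span_bind (words_span Sf) _ => _ [w wN ->]; apply: standard_span.
have [w sw ->] := init_lin_comb ole std_init std_inj span If.
have -> : 'X_[\sum_(i <- w) x i] = \prod_(i <- w) 'X_[x i] :> {mpoly K[n]}.
  by elim: (w) => [|i v IH]; rewrite ?big_nil ?mpolyX0 // !big_cons mpolyXD IH.
apply: subalg_gen_prod => i iw.
have iN : (i < N)%N by case/and3P: sw => _ /allP /(_ _ iw).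
have [h Th e] := g_T iN; apply: subalg_gen_mem; exists h, (x i); split => //.
by case: e => ->; [|apply: init_opp]; apply: init_g.
Qed.

End StandardWords.

(** * Separation of standard words by a unimodular triangulation *)

Definition vanishes (v w : seq nat) : bool := all (fun i => nth 0%N v i == 0%N) w.

(* [facets] are functionals whose zero sets contain the cliques of the graph of
   admissible pairs: the facets of a triangulation. *)
Fixpoint cliques_covered (compat : nat -> nat -> bool) (fuel : nat)
    (facets : seq (seq nat)) (cands : seq nat) : bool :=
  if has (fun v => vanishes v cands) facets then true else
  if fuel is k.+1 then
    if cands is c :: cs then
      if cliques_covered compat k [seq v <- facets | nth 0%N v c == 0%N]
           [seq d <- cs | compat c d]
      then cliques_covered compat k facets cs else false
    else false
  else false.

Definition compatible (rels : rewriting) (i j : nat) : bool :=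
  all (fun r => (r.1 != (i, j)) && (r.1 != (j, i))) rels.

(** For each vertex [i] of a facet there must be a functional that is nonzero at [i] and zero at the
    other vertices: that of the neighbouring facet opposite to [i], or a wall if that side lies on
    the boundary. It reads off the multiplicity of [i] in a word supported on the facet. *)
Definition triangulation_check N rels facets walls : bool :=
  if cliques_covered (compatible rels) N facets (iota 0 N) then
    let functionals := facets ++ walls in
    all (fun v => let Z := [seq i <- iota 0 N | nth 0%N v i == 0%N] in
      all (fun i => has (fun u => if nth 0%N u i == 0%N then false else
             vanishes u [seq j <- Z | j != i]) functionals) Z) facets
  else false.

Lemma weight_vanishes v w : (weight v w == 0%N) = vanishes v w.
Proof. by rewrite weightE sum_nat_seq_eq0 /vanishes; apply: eq_all => i; rewrite implyTb. Qed.

Lemma reduced_compatible rels w i j :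
  reduced rels w -> i \in w -> j \in w -> compatible rels i j.
Proof.
move=> red iw jw; apply: sub_all red => -[[a b] ts] /=; apply: contraR.
by rewrite negb_and !negbK => /orP[] /eqP[-> ->]; rewrite iw jw.
Qed.

(** The recursion branches on whether the first candidate occurs in the word. If it does, only
    facets vanishing there and candidates compatible with it remain relevant; if not, it is
    dropped. *)
Lemma cliques_coveredP compat fuel facets cands w :
  cliques_covered compat fuel facets cands ->
  {in w &, forall i j, compat i j} -> {subset w <= cands} ->
  exists2 v, v \in facets & vanishes v w.
Proof.
elim: fuel facets cands w => [|k IH] facets cands w /=.
  case: ifP => // /hasP[v vF /allP hv] _ _ sw; exists v => //.
  by apply/allP => i /sw /hv.
case: ifP => [/hasP[v vF /allP hv] _ _ sw|_].
  by exists v => //; apply/allP => i /sw /hv.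
case: cands => // c cs; case: ifP => // h1 h2 hw sw.
case: (boolP (c \in w)) => cw; last first.
  apply: IH h2 hw _ => i iw; move: (sw _ iw); rewrite inE => /orP[/eqP e|//].
  by rewrite -e iw in cw.
have [||v] := IH _ _ [seq i <- w | i != c] h1.
- by move=> i j; rewrite !mem_filter => /andP[_ iw] /andP[_ jw]; apply: hw.
- move=> i; rewrite !mem_filter => /andP[ic iw]; rewrite hw //=.
  by move: (sw _ iw); rewrite inE (negbTE ic).
rewrite mem_filter => /andP[vc vF] /allP hv; exists v => //.
apply/allP => i iw; case: (eqVneq i c) => [-> //|ic].
by apply: hv; rewrite mem_filter ic.
Qed.

Section Separation.
Variables (N : nat) (rels : rewriting) (W : seq nat) (facets walls : seq (seq nat)).
Variable same : seq nat -> seq nat -> Prop.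
Hypothesis same_sym : forall w w', same w w' -> same w' w.
Hypothesis check : triangulation_check N rels facets walls.
Hypothesis facet_same : forall v w w', v \in facets ->
  all (ltn^~ N) w -> all (ltn^~ N) w' -> same w w' ->
  (weight v w + weight W w' = weight v w' + weight W w)%N.
Hypothesis wall_same : forall v w w', v \in walls ->
  all (ltn^~ N) w -> all (ltn^~ N) w' -> same w w' -> weight v w = weight v w'.

(** A facet functional is the height of the lifting [W] above a supporting hyperplane. Words with
    the same initial monomial lie over the same point, so the word that is supported on a facet has
    the smallest lift. If the other word lifts no higher, it is supported on the same facet, where
    the multiplicities of the vertices are determined. *)
Lemma standard_words_separated w w' : standard N rels w -> standard N rels w' ->
  same w w' -> perm_eq w w'.
Proof.
wlog le_W : w w' / (weight W w' <= weight W w)%N.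
  move=> H sw sw' ss; case/orP: (leq_total (weight W w) (weight W w')) => h; last exact: H.
  by rewrite perm_sym; apply: H => //; apply: same_sym.
case/and3P=> _ wN red /and3P[_ w'N _] ss.
move: check; rewrite /triangulation_check; case: ifP => // cov /allP hF.
have [v vF v0] : exists2 v, v \in facets & vanishes v w.
  apply: cliques_coveredP cov _ _ => [i j iw jw|i /(allP wN) iN].
    exact: reduced_compatible red iw jw.
  by rewrite mem_iota.
have v0w : weight v w = 0%N by apply/eqP; rewrite weight_vanishes.
(* Now [weight W w' = weight v w' + weight W w], and [le_W] bounds the left side by [weight W w]. *)
have := facet_same vF wN w'N ss; rewrite v0w add0n => eW.
have [v0w' eWW] : weight v w' = 0%N /\ weight W w = weight W w' by lia.
have v0' : vanishes v w' by rewrite -weight_vanishes v0w'.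
apply/allP => i _; apply/eqP.
set Z := [seq i <- iota 0 N | nth 0%N v i == 0%N].
have inZ u j : vanishes v u -> all (ltn^~ N) u -> j \in u -> j \in Z.
  move=> vu uN ju; rewrite mem_filter mem_iota (allP vu) //= add0n.
  exact: (allP uN).
case: (boolP (i \in Z)) => iZ; last first.
  rewrite !(count_memPn _) //; apply: contra iZ; exact: inZ.
have /hasP[u uF] := allP (hF _ vF) _ iZ.
case: eqP => // /eqP; rewrite -lt0n => ui u0.
have cnt s : vanishes v s -> all (ltn^~ N) s -> weight u s = (nth 0 u i * count_mem i s)%N.
  move=> vs sN; rewrite weightE (bigID (pred1 i)) /= [X in (_ + X)%N]big_seq_cond [X in (_ + X)%N]big1.
    rewrite addn0 (eq_bigr (fun=> nth 0%N u i)) => [|j /eqP -> //].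
    by rewrite big_const_seq iter_addn_0.
  move=> j /andP[js ji]; apply/eqP/(allP u0); rewrite mem_filter ji; exact: inZ js.
(* Because the [W]-weights agree, the functional of a neighbouring facet agrees on both words just
   as a wall does. *)
have : weight u w = weight u w'.
  move: uF; rewrite mem_cat => /orP[uF|uW]; last exact: wall_same.
  have := facet_same uF wN w'N ss; lia.
by rewrite !cnt // => /eqP; rewrite eqn_pmul2l // => /eqP.
Qed.

End Separation.

(** * Integer polynomials as lists of signed monomials *)

(* A monomial is the sorted list of its variables; the coefficient is -1 when
   the boolean is true. *)
Definition lpoly := seq (bool * seq nat).

Definition lneg (p : lpoly) : lpoly := [seq (~~ t.1, t.2) | t <- p].

Definition lmul (p q : lpoly) : lpoly :=
  [seq (t.1 (+) u.1, merge leq t.2 u.2) | t <- p, u <- q].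

Fixpoint lexleq (s t : seq nat) : bool :=
  match s, t with
  | [::], _ => true
  | _ :: _, [::] => false
  | a :: s', b :: t' => if a < b then true else if a == b then lexleq s' t' else false
  end%N.

(** Multiplicities in the list encode integer coefficients. Equality of the positive and the
    negative multiset is therefore an identity over the integers, valid in every characteristic. *)
Definition lzero (p : lpoly) : bool :=
  sort lexleq [seq t.2 | t <- p & t.1] == sort lexleq [seq t.2 | t <- p & ~~ t.1].

Definition lword (gens : seq lpoly) (w : seq nat) : lpoly :=
  foldr (fun i p => lmul (nth [::] gens i) p) [:: (false, [::])] w.

Definition rewriting_valid (gens : seq lpoly) (rels : rewriting) : bool :=
  all (fun r : nat * nat * seq (bool * seq nat) =>
    lzero (lmul (nth [::] gens r.1.1) (nth [::] gens r.1.2) ++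
      flatten [seq (if t.1 then lword gens t.2 else lneg (lword gens t.2)) | t <- r.2]))
  rels.

Section Leval.
Variables (R : comNzRingType) (v : nat -> R).

Definition leval (p : lpoly) : R := \sum_(t <- p) (-1) ^+ t.1 * \prod_(k <- t.2) v k.

Lemma leval_cat p q : leval (p ++ q) = leval p + leval q.
Proof. exact: big_cat. Qed.

Lemma leval_flatten ps : leval (flatten ps) = \sum_(p <- ps) leval p.
Proof.
elim: ps => [|p ps IH] /=; first by rewrite /leval !big_nil.
by rewrite leval_cat big_cons IH.
Qed.

Lemma leval_neg p : leval (lneg p) = - leval p.
Proof.
rewrite /leval big_map -sumrN; apply: eq_bigr => -[b m] _ /=.
by rewrite signrN mulNr.
Qed.

Lemma leval_mul p q : leval (lmul p q) = leval p * leval q.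
Proof.
rewrite /leval /lmul big_allpairs_dep mulr_suml; apply: eq_bigr => -[b m] _ /=.
rewrite mulr_sumr; apply: eq_bigr => -[c m'] _ /=.
rewrite signr_addb mulrACA; congr (_ * _).
by rewrite (perm_big (m ++ m')) ?perm_merge // big_cat.
Qed.

Lemma leval_word gens w : leval (lword gens w) = \prod_(i <- w) leval (nth [::] gens i).
Proof.
elim: w => [|i w IH] /=; first by rewrite /leval big_seq1 !big_nil mulr1.
by rewrite leval_mul big_cons IH.
Qed.

Lemma leval_zero p : lzero p -> leval p = 0.
Proof.
move/eqP=> e; rewrite /leval (bigID (fun t : bool * seq nat => t.1)) /=.
have h b : \sum_(t <- p | t.1 == b) (-1) ^+ t.1 * \prod_(k <- t.2) v k
    = (-1) ^+ b * \sum_(m <- [seq t.2 | t <- p & t.1 == b]) \prod_(k <- m) v k.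
  by rewrite big_map big_filter mulr_sumr; apply: eq_bigr => t /eqP ->.
rewrite (eq_bigl (fun t : bool * seq nat => t.1 == true)) => [|t]; last by rewrite eqb_id.
rewrite [X in _ + X](eq_bigl (fun t : bool * seq nat => t.1 == false)) => [|t]; last by rewrite eqbF_neg.
rewrite !h mulN1r mul1r addrC; apply/eqP; rewrite subr_eq0; apply/eqP/perm_big.
have e1 : [seq t.2 | t <- p & t.1 == true] = [seq t.2 | t <- p & t.1].
  by congr map; apply: eq_filter => t; rewrite eqb_id.
have e0 : [seq t.2 | t <- p & t.1 == false] = [seq t.2 | t <- p & ~~ t.1].
  by congr map; apply: eq_filter => t; rewrite eqbF_neg.
by rewrite e1 e0 perm_sym -(perm_sort lexleq) e perm_sort.
Qed.

Lemma rewriting_validP gens rels : rewriting_valid gens rels ->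
  all (fun r : nat * nat * seq (bool * seq nat) =>
    \prod_(i <- [:: r.1.1; r.1.2]) leval (nth [::] gens i) ==
    \sum_(t <- r.2) (-1) ^+ t.1 * \prod_(i <- t.2) leval (nth [::] gens i)) rels.
Proof.
apply: sub_all => r /leval_zero; rewrite leval_cat leval_mul leval_flatten big_map => e.
rewrite !big_cons big_nil mulr1 -subr_eq0 -sumrN -[X in _ == X]e.
apply/eqP; congr (_ + _); apply: eq_bigr => -[[] w] _ /=.
  by rewrite expr1 mulN1r opprK leval_word.
by rewrite expr0 mul1r leval_neg leval_word.
Qed.

End Leval.

(** * Expansion and initial monomials of brackets *)

Definition lbracket (a b c : nat) : lpoly :=
  [:: (false, [:: a; 6 + b; 12 + c]); (true, [:: a; 6 + c; 12 + b]);
      (true, [:: b; 6 + a; 12 + c]); (false, [:: b; 6 + c; 12 + a]);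
      (false, [:: c; 6 + a; 12 + b]); (true, [:: c; 6 + b; 12 + a])]%N.

Section Brackets.
Variable K : fieldType.
Implicit Types a b c : 'I_6.

Definition edge (i : 'I_3) (j : 'I_6) : 'X_{1..3 * 6} := U_(mxvec_index i j)%MM.

Lemma edge_entry i j i' j' :
  edge i j (mxvec_index i' j') = ((i == i') && (j == j'))%N :> nat.
Proof.
rewrite mnm1E; congr (nat_of_bool _).
by rewrite (inj_eq (@cast_ord_inj _ _ _)) (inj_eq enum_rank_inj) xpair_eqE.
Qed.

Lemma det3 (R : comNzRingType) (A : 'M[R]_3) (i0 := ord0 : 'I_3)
    (i1 := lift ord0 ord0 : 'I_3) (i2 := lift ord0 (lift ord0 ord0) : 'I_3) :
  \det A = A i0 i0 * A i1 i1 * A i2 i2 - A i0 i0 * A i1 i2 * A i2 i1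
    - A i0 i1 * A i1 i0 * A i2 i2 + A i0 i1 * A i1 i2 * A i2 i0
    + A i0 i2 * A i1 i0 * A i2 i1 - A i0 i2 * A i1 i1 * A i2 i0.
Proof.
rewrite (expand_det_row _ ord0) !big_ord_recl big_ord0.
rewrite /cofactor !(expand_det_row _ ord0) !big_ord_recl !big_ord0.
rewrite /cofactor !det_mx11 !mxE.
(* The cofactor expansions name the same index by different ordinal terms; passing to natural
   numbers makes equal entries equal atoms for [ring]. *)
pose B (i j : nat) := A (inord i) (inord j).
have AB i j : A i j = B i j by rewrite /B !inord_val.
by rewrite !AB /=; ring.
Qed.

Definition mrow0 : 'I_3 := ord0.
Definition mrow1 : 'I_3 := lift ord0 ord0.
Definition mrow2 : 'I_3 := lift ord0 (lift ord0 ord0).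

Definition matching (p : 'I_6 * 'I_6 * 'I_6) : 'X_{1..3 * 6} :=
  (edge mrow0 p.1.1 + edge mrow1 p.1.2 + edge mrow2 p.2)%MM.

Definition orderings a b c :=
  [:: (false, (a, b, c)); (true, (a, c, b)); (true, (b, a, c));
      (false, (b, c, a)); (false, (c, a, b)); (true, (c, b, a))].

Lemma bracket_expand a b c : bracket K a b c = \sum_(t <- orderings a b c)
  (-1) ^+ t.1 * (genX K mrow0 t.2.1.1 * genX K mrow1 t.2.1.2 * genX K mrow2 t.2.2).
Proof.
rewrite /bracket det3 !mxE.
rewrite !big_cons big_nil /= /mrow0 /mrow1 /mrow2 !expr0 !expr1 !mulN1r !mul1r !mxE.
rewrite !(tnth_nth a) /=; ring.
Qed.

Lemma bracketE a b c :
  bracket K a b c = \sum_(t <- orderings a b c) (-1) ^+ t.1 *: 'X_[matching t.2].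
Proof.
rewrite bracket_expand; apply: eq_bigr => -[b0 p] _ /=.
rewrite !mxE -!mpolyXD; by case: b0; rewrite ?expr0 ?expr1 ?mulN1r ?scaleN1r ?mul1r ?scale1r.
Qed.

(* The variable in row i and column j has number 6 * i + j. *)
Definition entry (s : nat -> 'I_6) (k : nat) : {mpoly K[3 * 6]} :=
  genX K (inord (k %/ 6)) (s (k %% 6)%N).

Lemma leval_bracket s (a b c : nat) : (a < 6)%N -> (b < 6)%N -> (c < 6)%N ->
  leval (entry s) (lbracket a b c) = bracket K (s a) (s b) (s c).
Proof.
move=> ha hb hc; rewrite bracket_expand /leval /lbracket !big_cons !big_nil; cbn [fst snd].
have e0 j : (j < 6)%N -> entry s j = genX K mrow0 (s j).
  move=> hj; rewrite /entry divn_small // modn_small //; congr (genX K _ _).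
  by apply: val_inj; rewrite /= inordK.
have e1 j : (j < 6)%N -> entry s (6 + j) = genX K mrow1 (s j).
  move=> hj; rewrite /entry (_ : (6 + j) %/ 6 = 1)%N; last lia.
  rewrite (_ : (6 + j) %% 6 = j)%N; last lia.
  by congr (genX K _ _); apply: val_inj; rewrite /= inordK.
have e2 j : (j < 6)%N -> entry s (12 + j) = genX K mrow2 (s j).
  move=> hj; rewrite /entry (_ : (12 + j) %/ 6 = 2)%N; last lia.
  rewrite (_ : (12 + j) %% 6 = j)%N; last lia.
  by congr (genX K _ _); apply: val_inj; rewrite /= inordK.
by rewrite !(e2 _ ha) !(e2 _ hb) !(e2 _ hc) !(e1 _ ha) !(e1 _ hb) !(e1 _ hc) !e0 // !mulr1 !mulrA.
Qed.

End Brackets.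

Lemma uniq_map_inj (T1 T2 : eqType) (f : T1 -> T2) (s : seq T1) :
  uniq (map f s) -> {in s &, injective f}.
Proof.
elim: s => //= u s IH /andP[us uq] v w; rewrite !inE => /orP[/eqP->|vs] /orP[/eqP->|ws] //.
- by move=> e; case/negP: us; rewrite e map_f.
- by move=> e; case/negP: us; rewrite -e map_f.
exact: IH.
Qed.

Section BracketInit.
Variable le : rel 'X_{1..3 * 6}.
Hypothesis ole : monomial_order le.
Implicit Types a b c : 'I_6.

(** The field does not enter: all six coefficients of a minor are 1 or -1, so its initial monomial
    is the same in every characteristic. *)
Definition bracket_init a b c : 'X_{1..3 * 6} :=
  maxm le [seq matching t.2 | t <- orderings a b c].

Lemma bracket_init_swap12 a b c : bracket_init a b c = bracket_init b a c.
Proof.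
apply: maxm_eqi => // m; rewrite /orderings /= !inE.
by do 6 (case: eqVneq => _ //=; rewrite ?orbT //).
Qed.

Lemma bracket_init_swap23 a b c : bracket_init a b c = bracket_init a c b.
Proof.
apply: maxm_eqi => // m; rewrite /orderings /= !inE.
by do 6 (case: eqVneq => _ //=; rewrite ?orbT //).
Qed.

Lemma uniq_matchings a b c : uniq [:: a; b; c] ->
  uniq [seq matching t.2 | t <- orderings a b c].
Proof.
move=> u; have [ab ac bc] : [/\ a != b, a != c & b != c].
  by move: u; rewrite /= !inE negb_or => /and3P[/andP[-> ->] ->].
(* Whether rows 0 and 1 use [a], [b] or neither of them already tells the six orderings apart. *)
pose f (m : 'X_{1..3 * 6}) := [:: m (mxvec_index mrow0 a); m (mxvec_index mrow0 b);
  m (mxvec_index mrow1 a); m (mxvec_index mrow1 b)].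
have fE p : f (matching p) =
    [:: nat_of_bool (p.1.1 == a); nat_of_bool (p.1.1 == b);
        nat_of_bool (p.1.2 == a); nat_of_bool (p.1.2 == b)].
  by rewrite /f /matching !mnmDE !edge_entry /= !addn0.
apply: (@map_uniq _ _ f); rewrite /orderings !map_cons !fE /= !eqxx.
by rewrite !(eq_sym b a) !(eq_sym c a) !(eq_sym c b) (negbTE ab) (negbTE ac) (negbTE bc).
Qed.

Lemma bracket_init_mem a b c :
  exists2 t, t \in orderings a b c & bracket_init a b c = matching t.2.
Proof. by have /mapP[t tin e] := maxm_mem ole (s := [seq matching t.2 | t <- orderings a b c]) isT; exists t. Qed.

Lemma bracket_init_ge a b c t : t \in orderings a b c ->
  le (matching t.2) (bracket_init a b c).
Proof. by move=> h; apply: maxm_ge => //; apply: (map_f (fun t : bool * (_ * _ * _) => matching t.2) h). Qed.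

Section Field.
Variable K : fieldType.

Lemma bracket_initP a b c : uniq [:: a; b; c] ->
  is_initial_monomial le (bracket K a b c) (bracket_init a b c) /\
  exists e : bool, (bracket K a b c)@_(bracket_init a b c) = (-1) ^+ e.
Proof.
move=> /uniq_matchings um.
have [t tin e] := bracket_init_mem a b c.
have coef t' : t' \in orderings a b c ->
    (bracket K a b c)@_(matching t'.2) = (-1) ^+ t'.1.
  rewrite bracketE; move: (orderings a b c) um => os um t'in.
  rewrite raddf_sum /= (bigD1_seq t') ?(map_uniq um) //=.
  rewrite mcoeffZ mcoeffX eqxx mulr1 big_seq_cond big1 ?addr0 //.
  move=> t'' /andP[t''in ne]; rewrite mcoeffZ mcoeffX; case: eqP; rewrite ?mulr0 // => e'.
  by case/eqP: ne; apply: (uniq_map_inj um).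
split; last by exists t.1; rewrite e coef.
split; first by rewrite mcoeff_msupp e coef // signr_eq0.
move=> m; rewrite mcoeff_msupp bracketE raddf_sum /= => ne.
have : ~~ all (fun t' => m != matching t'.2) (orderings a b c).
  apply: contra ne => /allP h; rewrite big_seq big1 // => t' /h.
  by rewrite mcoeffZ mcoeffX eq_sym => /negbTE ->; rewrite mulr0.
by case/allPn=> t' t'in /negPn/eqP ->; apply: bracket_init_ge.
Qed.

End Field.
End BracketInit.

(** * Three-term relations *)

Definition three_splits (T : Type) (a : T) (o : seq T) : seq (seq (seq T)) :=
  if o is [:: b; c; d; e] then
    [:: [:: [:: a; b; c]; [:: a; d; e]]; [:: [:: a; b; d]; [:: a; c; e]];
        [:: [:: a; b; e]; [:: a; c; d]]]
  else [::].

Section ThreeTerm.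
Variable le : rel 'X_{1..3 * 6}.
Hypothesis ole : monomial_order le.

(** The tropical Pluecker condition in the max convention, in its generic form: the maximum of the
    three products is attained exactly twice, and [k] is the product left out. *)
Definition low_at (I : Type) (y : I -> 'X_{1..3 * 6}) (ws : seq (seq I)) (k : nat) : Prop :=
  let m i := (\sum_(j <- nth [::] ws i) y j)%MM in
  match k with
  | 0 => mlt le (m 0%N) (m 1%N) /\ m 1%N = m 2%N
  | 1 => mlt le (m 1%N) (m 0%N) /\ m 0%N = m 2%N
  | _ => mlt le (m 2%N) (m 0%N) /\ m 0%N = m 1%N
  end.

(* Only finitely many signs are at stake, so that it is enough to argue in
   characteristic 0, where an odd number of signs cannot cancel. *)
Lemma low_of_sum0 (f1 f2 f3 : {mpoly rat[3 * 6]}) m1 m2 m3 :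
  f1 + f2 + f3 = 0 ->
  is_initial_monomial le f1 m1 -> is_initial_monomial le f2 m2 ->
  is_initial_monomial le f3 m3 ->
  (exists e : bool, f1@_m1 = (-1) ^+ e) -> (exists e : bool, f2@_m2 = (-1) ^+ e) ->
  (exists e : bool, f3@_m3 = (-1) ^+ e) ->
  [\/ mlt le m1 m2 /\ m2 = m3, mlt le m2 m1 /\ m1 = m3 | mlt le m3 m1 /\ m1 = m2].
Proof.
move=> f0 /initP[_ h1] /initP[_ h2] /initP[_ h3] [e1 c1] [e2 c2] [e3 c3].
have sum0 m : f1@_m + f2@_m + f3@_m = 0 by rewrite -!mcoeffD f0 mcoeff0.
have lt_neq a b : mlt le a b -> a <> b by rewrite mlt_neqAle // => /andP[/eqP].
have lt_or a b : [\/ mlt le a b, a = b | mlt le b a].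
  case: (boolP (mlt le a b)) => [|/mltNge]; first by constructor 1.
  by case: (eqVneq a b) => [|ab] h; [constructor 2|constructor 3; rewrite mlt_neqAle // eq_sym ab].
case: (lt_or m1 m2) => [l12|e12|l21].
- case: (lt_or m2 m3) => [l23|e23|l32].
  + have := sum0 m3; rewrite h1 ?h2 ?c3 //; last by apply: (mle_lt_trans ole (mltW ole l12)).
    by case: e3 {c3}.
  + by constructor 1.
  + have := sum0 m2; rewrite h1 ?h3 ?c2 //; by case: e2 {c2}.
- rewrite -e12 in h2 c2 *; case: (lt_or m1 m3) => [l13|e13|l31].
  + have := sum0 m3; rewrite h1 ?h2 ?c3 //; by case: e3 {c3}.
  + have := sum0 m1; rewrite c1 c2 e13 c3; by case: e1 {c1}; case: e2 {c2}; case: e3 {c3}.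
  + by constructor 3.
case: (lt_or m1 m3) => [l13|e13|l31].
+ have := sum0 m3; rewrite h1 ?h2 ?c3 //; last by apply: (mle_lt_trans ole (mltW ole l21)).
  by case: e3 {c3}.
+ by constructor 2.
+ have := sum0 m1; rewrite h2 ?h3 ?c1 //; by case: e1 {c1}.
Qed.

(** The identity is verified on five formal columns and transported along [s], which need not be
    injective. *)
Lemma plucker (K : fieldType) (a b c d e : 'I_6) :
  bracket K a b c * bracket K a d e - bracket K a b d * bracket K a c e
    + bracket K a b e * bracket K a c d = 0.
Proof.
pose s k := nth a [:: a; b; c; d; e] k.
have E i j k : (i < 5)%N -> (j < 5)%N -> (k < 5)%N ->
    bracket K (s i) (s j) (s k) = leval (entry K s) (lbracket i j k).
  by move=> *; rewrite leval_bracket //; lia.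
rewrite -[a]/(s 0%N) -[b]/(s 1%N) -[c]/(s 2%N) -[d]/(s 3%N) -[e]/(s 4%N) !E //.
rewrite -!leval_mul -leval_neg -!leval_cat; apply: leval_zero; by vm_compute.
Qed.

(** As [bracket_init] is independent of the field, the relation may be read over the rationals,
    where three signs never add up to zero. *)
Lemma three_term_low (a b c d e : 'I_6) : uniq [:: a; b; c; d; e] ->
  exists2 k, (k < 3)%N &
    low_at (fun t => let: (i, j, l) := t in bracket_init le i j l)
      [:: [:: (a, b, c); (a, d, e)]; [:: (a, b, d); (a, c, e)]; [:: (a, b, e); (a, c, d)]] k.
Proof.
move=> u.
have init3 i j k : subseq [:: i; j; k] [:: a; b; c; d; e] ->
  is_initial_monomial le (bracket rat i j k) (bracket_init le i j k) /\
  exists e : bool, (bracket rat i j k)@_(bracket_init le i j k) = (-1) ^+ e.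
  by move=> sub; apply: bracket_initP => //; apply: subseq_uniq sub u.
have init6 i j k l p q :
    subseq [:: i; j; k] [:: a; b; c; d; e] -> subseq [:: l; p; q] [:: a; b; c; d; e] ->
  is_initial_monomial le (bracket rat i j k * bracket rat l p q)
     (bracket_init le i j k + bracket_init le l p q)%MM /\
  exists e : bool, (bracket rat i j k * bracket rat l p q)@_
     (bracket_init le i j k + bracket_init le l p q)%MM = (-1) ^+ e.
  move=> /init3[I1 [e1 c1]] /init3[I2 [e2 c2]]; split; first exact: (init_mul ole I1 I2).
  by exists (e1 (+) e2); rewrite (mcoeff_initM ole I1 I2) c1 c2 signr_addb.
have sub (m : bitseq) : subseq (mask m [:: a; b; c; d; e]) [:: a; b; c; d; e] by apply: mask_subseq.
have [I1 C1] := init6 _ _ _ _ _ _ (sub [:: true; true; true]) (sub [:: true; false; false; true; true]).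
have [I2 [e2 C2]] := init6 _ _ _ _ _ _ (sub [:: true; true; false; true]) (sub [:: true; false; true; false; true]).
have [I3 C3] := init6 _ _ _ _ _ _ (sub [:: true; true; false; false; true]) (sub [:: true; false; true; true]).
have := low_of_sum0 (plucker rat a b c d e) I1 (init_opp I2) I3 C1 _ C3.
case=> [|[h1 h2]|[h1 h2]|[h1 h2]].
- by exists (~~ e2); rewrite mcoeffN C2 signrN.
- by exists 0%N; rewrite // /low_at /= !big_cons !big_nil !addm0.
- by exists 1%N; rewrite // /low_at /= !big_cons !big_nil !addm0.
by exists 2%N; rewrite // /low_at /= !big_cons !big_nil !addm0.
Qed.

(** * Trees with five leaves *)

Section Farkas.
Variable y : nat -> 'X_{1..3 * 6}.

Definition relations_of (ws : seq (seq nat)) (k : nat) : seq (seq nat * seq nat * bool) :=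
  let w i := nth [::] ws i in
  let rel o p q := [:: (w p, w q, false); (w q, w p, false); (w o, w p, true); (w o, w q, true)] in
  match k with 0 => rel 0 1 2 | 1 => rel 1 0 2 | _ => rel 2 0 1 end%N.

Definition holds (r : seq nat * seq nat * bool) : Prop :=
  let L := (\sum_(i <- r.1.1) y i)%MM in let R := (\sum_(i <- r.1.2) y i)%MM in
  if r.2 then mlt le L R else le L R.

Lemma relations_ofP ws k r : low_at y ws k -> r \in relations_of ws k -> holds r.
Proof.
by case: k => [|[|k]] [h1 h2]; rewrite /= !inE => /or4P[] /eqP->;
  rewrite /holds /= ?h1 ?h2 ?mle_refl // -?h2.
Qed.

(** A Farkas certificate with unit coefficients: both sides of the sum of the three inequalities
    contain the same letters, while one of the inequalities is strict. *)
Definition contradictory (r1 r2 r3 : seq nat * seq nat * bool) : bool :=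
  if [|| r1.2, r2.2 | r3.2] then
    perm_eq (r1.1.1 ++ r2.1.1 ++ r3.1.1) (r1.1.2 ++ r2.1.2 ++ r3.1.2)
  else false.

Lemma contradictoryP r1 r2 r3 : contradictory r1 r2 r3 ->
  holds r1 -> holds r2 -> holds r3 -> False.
Proof.
rewrite /contradictory; case: ifP => // st pe h1 h2 h3.
have hle r : holds r -> le (\sum_(i <- r.1.1) y i)%MM (\sum_(i <- r.1.2) y i)%MM.
  by rewrite /holds; case: r.2 => // /mltW; apply.
have e : (\sum_(i <- r1.1.1 ++ r2.1.1 ++ r3.1.1) y i)%MM
    = (\sum_(i <- r1.1.2 ++ r2.1.2 ++ r3.1.2) y i)%MM by apply: perm_big.
rewrite !big_cat /= in e.
suff : mlt le (\sum_(i <- r1.1.1) y i + (\sum_(i <- r2.1.1) y i + \sum_(i <- r3.1.1) y i))%MM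
  (\sum_(i <- r1.1.2) y i + (\sum_(i <- r2.1.2) y i + \sum_(i <- r3.1.2) y i))%MM.
  by rewrite e mlt_neqAle // eqxx.
case/or3P: st => s.
- by apply: mlt_le_add => //; [move: h1; rewrite /holds s|apply: mle_add => //; apply: hle].
- apply: mle_lt_add => //; first exact: hle.
  by apply: mlt_le_add => //; [move: h2; rewrite /holds s|apply: hle].
do 2 (apply: mle_lt_add => //; first exact: hle).
by move: h3; rewrite /holds s.
Qed.

End Farkas.

End ThreeTerm.

Definition pairs5 : seq (seq nat) :=
  [:: [:: 0; 1]; [:: 0; 2]; [:: 0; 3]; [:: 0; 4]; [:: 1; 2]; [:: 1; 3]; [:: 1; 4];
      [:: 2; 3]; [:: 2; 4]; [:: 3; 4]]%N.

(** The four-point condition of tree metrics for the leaves other than [k]; letters are positions in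
    [pairs5]. *)
Definition leaf_cell (k : nat) : seq (seq nat) :=
  if [seq i <- iota 0 5 | i != k] is [:: p; q; r; s] then
    let idx i j := index [:: i; j] pairs5 in
    [:: [:: idx p q; idx r s]; [:: idx p r; idx q s]; [:: idx p s; idx q r]]
  else [::].

(* The trivalent trees with five leaves, each given by the splits that it
   induces on the four-element sets of leaves. *)
Definition trees5 : seq (seq nat) :=
  [:: [:: 0; 0; 0; 0; 0]; [:: 0; 0; 0; 1; 1]; [:: 0; 0; 0; 2; 2]; [:: 0; 1; 1; 2; 2];
      [:: 0; 2; 2; 2; 2]; [:: 1; 0; 2; 1; 1]; [:: 1; 1; 0; 0; 0]; [:: 1; 1; 1; 0; 2];
      [:: 1; 1; 2; 0; 1]; [:: 1; 2; 2; 2; 1]; [:: 2; 0; 1; 1; 1]; [:: 2; 1; 1; 1; 2];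
      [:: 2; 2; 0; 0; 0]; [:: 2; 2; 1; 1; 0]; [:: 2; 2; 2; 2; 0]]%N.

Fixpoint ternary_words (n : nat) : seq (seq nat) :=
  if n is k.+1 then [seq i :: w | i <- iota 0 3, w <- ternary_words k] else [:: [::]].

Definition conflict (c : seq (nat * nat)) : bool :=
  if [seq relations_of (leaf_cell p.1) p.2 | p <- c] is [:: R1; R2; R3] then
    has (fun r1 => has (fun r2 => has (contradictory r1 r2) R3) R2) R1
  else false.

Definition conflicts : seq (seq (nat * nat)) :=
  let ks := [seq i :: jk | i <- iota 0 5, jk <- [seq [:: j; k] | j <- iota 0 5, k <- iota 0 5]] in
  [seq c <- [seq zip k os | k <- [seq k <- ks | sorted ltn k], os <- ternary_words 3] | conflict c].

(** Of the 243 combinations of outcomes, each one outside the 15 trees already fails on three of the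
    five four-point conditions, through one inequality from each. *)
Definition five_leaf_check : bool :=
  let cs := conflicts in
  all (fun o => if o \in trees5 then true else
    has (all (fun p => (p.1 < 5)%N && (nth 0%N o p.1 == p.2))) cs)
    (ternary_words 5).

Lemma five_leaf_check_true : five_leaf_check.
Proof. by vm_compute. Qed.

Lemma ternary_wordsP n w : size w = n -> all (ltn^~ 3) w -> w \in ternary_words n.
Proof.
elim: n w => [|n IH] [|i w] // [sw] /andP[i3 w3].
apply/allpairsP; exists (i, w); split => //=; last exact: IH.
by rewrite (mem_iota 0 3).
Qed.

(** This is the description of the tropical Grassmannian of (2,5) by trees, with exponent vectors
    ordered by [le] instead of real coordinates. The refutations only add inequalities, so they
    remain valid there. *)
Lemma five_leaf_trees le (ole : monomial_order le) (y : nat -> 'X_{1..3 * 6}) (o : seq nat) :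
  size o = 5%N -> all (ltn^~ 3) o ->
  (forall k, (k < 5)%N -> low_at le y (leaf_cell k) (nth 0%N o k)) -> o \in trees5.
Proof.
move=> so o3 low; have := allP five_leaf_check_true _ (ternary_wordsP so o3).
case: ifP => // _ /hasP[c]; rewrite mem_filter => /andP[+ _] /allP hc.
have rel p r : p \in c -> r \in relations_of (leaf_cell p.1) p.2 -> holds le y r.
  by move=> /hc/andP[p5 /eqP <-]; apply: relations_ofP => //; apply: low.
rewrite /conflict; case: c {hc} rel => [|p1 [|p2 [|p3 [|? ?]]]] //= rel.
case/hasP=> r1 h1 /hasP[r2 h2 /hasP[r3 h3 /contradictoryP]].
by move=> /(_ le ole y) []; [apply: (rel p1)|apply: (rel p2)|apply: (rel p3)];
  rewrite ?inE ?eqxx ?orbT.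
Qed.

(** * Classification of the outcomes of all three-term relations *)

Definition triples : seq (seq nat) :=
  [seq t <- [seq i :: p | i <- iota 0 6, p <- [seq [:: j; k] | j <- iota 0 6, k <- iota 0 6]]
     | sorted ltn t].

Definition tindex (t : seq nat) : nat := index (sort leq t) triples.

Definition others (m : nat) (t : seq nat) : seq nat := [seq i <- iota 0 m | i \notin t].

(* The three-term relation on row a that avoids the column f. *)
Definition cell (a f : nat) : seq (seq nat) :=
  [seq [seq tindex t | t <- ws] | ws <- three_splits a (others 6 [:: a; f])].

(* Contracting a column, or deleting it, leaves a family indexed by the pairs
   of five leaves; in the second case a pair stands for its complement. *)
Definition row_pair (a p : nat) : nat :=
  tindex (a :: [seq nth 0%N (others 6 [:: a]) i | i <- nth [::] pairs5 p]).

Definition col_pair (f p : nat) : nat :=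
  tindex [seq nth 0%N (others 6 [:: f]) i | i <- others 5 (nth [::] pairs5 p)].

(** A three-term relation is given by its common column and its missing column. Fixing either one
    leaves five relations, which are the four-point conditions on five leaves. The outcomes thus
    form a matrix without diagonal whose rows and columns are all trees. *)
Definition groups_check : bool :=
  all (fun a => all (fun k =>
    let ws phi := [seq [seq phi p | p <- w] | w <- leaf_cell k] in
    let b := nth 0%N (others 6 [:: a]) k in
    all2 perm_eq (cell a b) (ws (row_pair a)) && all2 perm_eq (cell b a) (ws (col_pair a)))
  (iota 0 5)) (iota 0 6).

Lemma groups_check_true : groups_check.
Proof. by vm_compute. Qed.

(** The index of [x] among the six labels other than [skipped]. *)
Definition position (x skipped : nat) : nat := if (x < skipped)%N then x else x.-1.

(** The entry (a, f) of the outcome matrix occurs both in the tree [t] of row [a] and in the tree of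
    column [f], so the two must agree there. Column [a] has no entry in row [a] and is left
    alone. *)
Definition restrict_trees (a : nat) (t : seq nat) (cols : seq (seq (seq nat))) :=
  [seq if p.1 == a then p.2
       else [seq u <- p.2 | nth 3 u (position a p.1) == nth 3 t (position p.1 a)]
     | p <- zip (iota 0 6) cols]%N.

(* Runs through all ways of choosing a tree for each row, while keeping for
   each column the trees that agree with the rows chosen so far. *)
Fixpoint search (trees : seq (seq nat)) (fuel a : nat) (cols cands : seq (seq (seq nat))) : bool :=
  if fuel is k.+1 then
    all (fun t => let cols' := restrict_trees a t cols in
           if has (@nilp _) cols' then true else
           search trees k a.+1 cols' [seq behead c | c <- cands & head [::] c == t]) trees
  else ~~ nilp cands.

(* One tropical point in each orbit of maximal cones. *)
Definition cone_weights : seq (seq nat) :=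
  [:: [:: 0; 0; 1; 1; 0; 0; 0; 1; 1; 0; 0; 1; 1; 0; 0; 0; 1; 1; 0; 0];
      [:: 2; 0; 2; 1; 0; 1; 2; 0; 0; 2; 2; 2; 1; 2; 1; 0; 1; 2; 2; 2];
      [:: 0; 0; 1; 0; 1; 0; 1; 2; 0; 2; 1; 1; 1; 2; 0; 2; 2; 0; 2; 0];
      [:: 1; 0; 1; 1; 1; 1; 0; 1; 1; 1; 2; 0; 1; 2; 2; 1; 2; 0; 1; 2];
      [:: 2; 2; 2; 2; 1; 2; 2; 2; 2; 0; 0; 2; 2; 2; 2; 1; 1; 1; 1; 1];
      [:: 0; 2; 1; 2; 1; 0; 1; 1; 1; 1; 2; 1; 2; 1; 0; 1; 1; 1; 1; 0];
      [:: 0; 1; 1; 1; 1; 1; 1; 0; 1; 1; 1; 1; 1; 1; 0; 1; 1; 1; 0; 1]]%N.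

Definition perms6 : seq (seq nat) := permutations (iota 0 6).

Definition permuted_weight (s W : seq nat) : seq nat :=
  [seq nth 0%N W (tindex [seq nth 0%N s i | i <- t]) | t <- triples].

Definition low_index (W : seq nat) (ws : seq (seq nat)) : nat :=
  let m i := weight W (nth [::] ws i) in
  let m0 := m 0%N in let m1 := m 1%N in let m2 := m 2%N in
  if (m0 < m1)%N then (if m0 < m2 then 0 else 2)%N else (if m1 < m2 then 1 else 2)%N.

Definition cell_rows : seq (seq (seq (seq nat))) :=
  [seq [seq cell a f | f <- others 6 [:: a]] | a <- iota 0 6].

Definition code (cells : seq (seq (seq (seq nat)))) (W : seq nat) : seq (seq nat) :=
  [seq [seq low_index W ws | ws <- row] | row <- cells].

Definition codes : seq (seq (seq nat)) :=
  let cells := cell_rows in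
  flatten [seq [seq code cells (permuted_weight s W) | s <- perms6] | W <- cone_weights].

(** The core of the classification: [cands] keeps the codes that begin with the chosen rows, and for
    every choice that no column rules out at least one code is left. *)
Lemma search_codes : search trees5 6 0 (nseq 6 trees5) codes.
Proof. by vm_compute. Qed.

Lemma restrict_trees_nth a t cols f : size cols = 6%N -> (f < 6)%N ->
  nth [::] (restrict_trees a t cols) f =
  (if f == a then nth [::] cols f
   else [seq u <- nth [::] cols f | nth 3 u (position a f) == nth 3 t (position f a)])%N.
Proof.
move=> sc f6; rewrite (nth_map (0%N, [::])) ?size_zip ?size_iota ?sc ?minnn //.
by rewrite nth_zip ?size_iota // nth_iota.
Qed.

Lemma searchP trees fuel a cols cands rows : search trees fuel a cols cands ->
  size cols = 6%N -> size rows = fuel -> {subset rows <= trees} ->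
  (forall f, (f < 6)%N -> exists2 u, u \in nth [::] cols f &
     forall i, (i < fuel)%N -> a + i != f ->
       nth 3 u (position (a + i) f) = nth 3 (nth [::] rows i) (position f (a + i)))%N ->
  exists2 c, c \in cands & forall i, (i < fuel)%N -> nth [::] c i = nth [::] rows i.
Proof.
elim: fuel a cols cands rows => [|k IH] a cols cands rows /=.
  by case: cands => // c cs _ _ _ _ _; exists c; rewrite ?mem_head.
case: rows => // t rows /allP hs sc [sr] htr hcols.
have scol : size (restrict_trees a t cols) = 6%N by rewrite size_map size_zip size_iota sc.
have col f : (f < 6)%N -> exists2 u, u \in nth [::] (restrict_trees a t cols) f &
     (forall i, (i < k)%N -> a.+1 + i != f ->
       nth 3 u (position (a.+1 + i) f) = nth 3 (nth [::] rows i) (position f (a.+1 + i)))%N.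
  move=> f6; have [u uin hu] := hcols f f6; exists u; last first.
    by move=> i ik; rewrite addSnnS => ne; rewrite (hu i.+1).
  rewrite restrict_trees_nth //; case: eqP => // /eqP fa; rewrite mem_filter uin andbT.
  by have := hu 0%N isT; rewrite addn0 eq_sym => ->.
have := hs t (htr _ (mem_head _ _)); case: ifP => [/hasP[s /(nthP [::])[f]]|_].
  rewrite scol => f6 <- /nilP e; have [u] := col f f6; by rewrite e.
move=> /IH /(_ scol sr) [x xr|f f6|c]; last 1 first.
- case/mapP=> c'; rewrite mem_filter => /andP[/eqP hd c'in] -> hc; exists c' => //.
  case=> [|i] ik; first by rewrite -hd; case: (c').
  by rewrite -nth_behead hc.
- by apply: htr; rewrite inE xr orbT.
exact: col.
Qed.

Section Classification.
Variables (le : rel 'X_{1..3 * 6}) (y : nat -> 'X_{1..3 * 6}).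
Hypothesis ole : monomial_order le.
Hypothesis low_y : forall a f, (a < 6)%N -> (f < 6)%N -> a != f ->
  exists2 k, (k < 3)%N & low_at le y (cell a f) k.

Lemma low_at_relabel (phi : nat -> nat) ws ws' k : (k < 3)%N -> size ws = 3%N ->
  all2 perm_eq ws' [seq [seq phi p | p <- w] | w <- ws] ->
  low_at le y ws' k -> low_at le (y \o phi) ws k.
Proof.
case: ws => [|w0 [|w1 [|w2 [|? ?]]]] //= k3 _; case: ws' => [|v0 [|v1 [|v2 [|? ?]]]] //=;
  rewrite ?andbF // => /and4P[p0 p1 p2 _].
have E v w : perm_eq v (map phi w) ->
  (\sum_(j <- v) y j)%MM = (\sum_(j <- w) (y \o phi) j)%MM.
  by move=> pv; rewrite (perm_big _ pv) big_map.
by move: k k3 => [|[|[|k]]] //= _; rewrite /low_at /= (E _ _ p0) (E _ _ p1) (E _ _ p2).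
Qed.

Lemma outcome_exists : exists o : nat -> nat -> nat, forall a f, (a < 6)%N -> (f < 6)%N -> a != f ->
  (o a f < 3)%N /\ low_at le y (cell a f) (o a f).
Proof.
pose m a f i := (\sum_(j <- nth [::] (cell a f) i) y j)%MM.
(* Exactly two of the three products are equal, so that equality tests find the low one; this yields
   a function without any choice principle. *)
exists (fun a f => if m a f 1 == m a f 2 then 0 else if m a f 0 == m a f 2 then 1 else 2)%N.
move=> a f a6 f6 af; have [k k3 h] := low_y a6 f6 af.
have ne u v : mlt le u v -> (u == v) = false /\ (v == u) = false.
  by rewrite mlt_neqAle // [v == u]eq_sym => /andP[/negbTE].
suff -> : (if m a f 1 == m a f 2 then 0 else if m a f 0 == m a f 2 then 1 else 2)%N = k by [].
move: k k3 h => [|[|[|k]]] //= _ []; rewrite -/(m a f 0) -/(m a f 1) -/(m a f 2)%N => /ne[n1 n2] e.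
- by rewrite e eqxx.
- by rewrite -e n1 eqxx.
by rewrite -e !n2.
Qed.

(** The trees of the six contractions form the rows, those of the six deletions the columns. The
    search then finds a code equal to this matrix, and its permutation and weight are the
    witnesses. *)
Theorem classification : exists s W, [/\ s \in perms6, W \in cone_weights &
  forall a f, (a < 6)%N -> (f < 6)%N -> a != f ->
    low_at le y (cell a f) (low_index (permuted_weight s W) (cell a f))].
Proof.
have [o ho] := outcome_exists.
have others6 a k : (a < 6)%N -> (k < 5)%N ->
    [/\ nth 0%N (others 6 [:: a]) k < 6, a != nth 0%N (others 6 [:: a]) k &
        size (others 6 [:: a]) = 5]%N.
  by case: a => [|[|[|[|[|[|a]]]]]] // _; case: k => [|[|[|[|[|k]]]]].
have othersE a f : (a < 6)%N -> (f < 6)%N -> a != f ->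
    (position f a < 5)%N /\ nth 0%N (others 6 [:: a]) (position f a) = f.
  by case: a => [|[|[|[|[|[|a]]]]]] // _; case: f => [|[|[|[|[|[|f]]]]]].
have inO a f : f \in others 6 [:: a] -> (f < 6)%N /\ a != f.
  by rewrite mem_filter mem_iota inE eq_sym => /andP[].
pose row a := [seq o a f | f <- others 6 [:: a]].
pose col f := [seq o a f | a <- others 6 [:: f]].
have gc a k : (a < 6)%N -> (k < 5)%N -> let b := nth 0%N (others 6 [:: a]) k in
    let ws phi := [seq [seq phi p | p <- w] | w <- leaf_cell k] : seq (seq nat) in
    all2 perm_eq (cell a b) (ws (row_pair a)) /\ all2 perm_eq (cell b a) (ws (col_pair a)).
  move=> a6 k5; apply/andP; have := groups_check_true; rewrite /groups_check.
  move/allP=> /(_ a); rewrite mem_iota => /(_ a6) /allP /(_ k); rewrite mem_iota; exact.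
have sleaf k : (k < 5)%N -> size (leaf_cell k) = 3%N by case: k => [|[|[|[|[|k]]]]].
have rowT a : (a < 6)%N -> row a \in trees5.
  move=> a6; apply: (@five_leaf_trees le ole (y \o row_pair a)).
  - by rewrite size_map; case: (others6 a 0%N a6 isT).
  - by apply/allP => _ /mapP[f /inO[f6 af] ->]; apply: (ho a f a6 f6 af).1.
  move=> k k5; have [b6 ab so] := others6 a k a6 k5; have [h1 _] := gc a k a6 k5.
  rewrite (nth_map 0%N) ?so //; have [k3 hl] := ho _ _ a6 b6 ab.
  by apply: low_at_relabel h1 hl => //; apply: sleaf.
have colT f : (f < 6)%N -> col f \in trees5.
  move=> f6; apply: (@five_leaf_trees le ole (y \o col_pair f)).
  - by rewrite size_map; case: (others6 f 0%N f6 isT).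
  - apply/allP => _ /mapP[a /inO[a6 af] ->]; rewrite eq_sym in af; exact: (ho a f a6 f6 af).1.
  move=> k k5; have [a6 fa so] := others6 f k f6 k5; have [_ h1] := gc f k f6 k5.
  rewrite eq_sym in fa.
  rewrite (nth_map 0%N) ?so //; have [k3 hl] := ho _ _ a6 f6 fa.
  by apply: low_at_relabel h1 hl => //; apply: sleaf.
have nth_row a f : (a < 6)%N -> (f < 6)%N -> a != f -> nth 3 (row a) (position f a) = o a f.
  move=> a6 f6 af; have [p5 e] := othersE a f a6 f6 af.
  by rewrite (nth_map 0%N) ?e //; case: (others6 a 0%N a6 isT) => _ _ ->.
have nth_col a f : (a < 6)%N -> (f < 6)%N -> a != f -> nth 3 (col f) (position a f) = o a f.
  move=> a6 f6 af; rewrite eq_sym in af; have [p5 e] := othersE f a f6 a6 af.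
  by rewrite (nth_map 0%N) ?e //; case: (others6 f 0%N f6 isT) => _ _ ->.
have [||||c] := searchP (rows := [seq row a | a <- iota 0 6]) search_codes.
- by [].
- by [].
- by move=> _ /mapP[a + ->]; rewrite mem_iota => /rowT.
- move=> f f6; exists (col f); first by rewrite nth_nseq f6; apply: colT.
  move=> i i6; rewrite add0n => ne; rewrite nth_col //.
  by rewrite (nth_map 0%N) ?size_iota // nth_iota // nth_row.
case/flattenP=> _ /mapP[W Win ->] /mapP[s sin ->] hc; exists s, W; split=> // a f a6 f6 af.
have := hc a a6; rewrite [RHS](nth_map 0%N) ?size_iota // nth_iota // add0n => /(congr1 (nth 3 ^~ (position f a))).
rewrite nth_row // => e; have [_] := ho a f a6 f6 af; rewrite -e.
have [p5 ef] := othersE a f a6 f6 af; have [_ _ so] := others6 a 0%N a6 isT.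
rewrite /code (nth_map [::]) ?size_map ?size_iota // (nth_map 0%N) ?size_iota // nth_iota // add0n.
rewrite (nth_map [::]) ?size_map ?so // (nth_map 0%N) ?so //.
by rewrite ef.
Qed.

End Classification.

(** * Functionals determined by the binomial relations *)

(** Unit propagation: in a relation where a single occurrence of a letter remains unknown and all
    else vanishes, that letter vanishes too. If propagation from [base] reaches all letters, a
    solution is determined by its values on [base]. *)
Definition determine (E : seq (seq nat * seq nat)) (known : seq nat) : seq nat :=
  foldl (fun known e =>
    if [seq i <- e.1 ++ e.2 | i \notin known] is [:: i] then i :: known else known) known E.

Definition relations_determine (N : nat) (E : seq (seq nat * seq nat)) (base : seq nat) : bool :=
  let known := iter 5 (determine E) base in
  all (fun i => i \in known) (iota 0 N)
  && all (fun e => all (ltn^~ N) (e.1 ++ e.2)) E && all (ltn^~ N) base.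

(** The functional [v - c W] satisfies the relations, written without subtraction. *)
Definition respects (E : seq (seq nat * seq nat)) (v : seq nat) (c : nat) (W : seq nat) : bool :=
  all (fun e => weight v e.1 + c * weight W e.2 == weight v e.2 + c * weight W e.1)%N E.

Lemma determineP (R : zmodType) (u : nat -> R) E known :
  (forall e, e \in E -> \sum_(i <- e.1) u i = \sum_(i <- e.2) u i) ->
  (forall i, i \in known -> u i = 0) -> forall i, i \in determine E known -> u i = 0.
Proof.
elim: E known => [|e E IH] known hE hk //=; apply: IH => [e' e'E|i].
  by apply: hE; rewrite inE e'E orbT.
have sumE w : \sum_(j <- w) u j = \sum_(j <- [seq j <- w | j \notin known]) u j.
  rewrite big_filter [LHS](bigID (fun j => j \notin known)) /= [X in _ + X]big1 ?addr0 //.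
  by move=> j /negPn /hk.
have := hE e (mem_head _ _); rewrite sumE [RHS]sumE filter_cat.
case: [seq j <- e.1 | _] => [|j [|j' s]]; case: [seq j <- e.2 | _] => [|k [|k' s']] //=;
  rewrite ?big_seq1 ?big_nil ?inE; try by move=> _ /hk.
- by move=> e0 /orP[/eqP ->|/hk //]; rewrite -e0.
by move=> e0 /orP[/eqP ->|/hk //].
Qed.

Section Separate.
Variables (N n : nat) (z : nat -> 'X_{1..n}).
Variables (E : seq (seq nat * seq nat)) (base : seq nat).
Hypothesis z_E : forall e, e \in E -> (\sum_(i <- e.1) z i)%MM = (\sum_(i <- e.2) z i)%MM.
Hypothesis det_E : relations_determine N E base.

Definition mnm_row (m : 'X_{1..n}) : 'rV[rat]_n := \row_k (m k)%:R.

Lemma mnm_row_add m m' : mnm_row (m + m')%MM = mnm_row m + mnm_row m'.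
Proof. by apply/rowP => k; rewrite !mxE mnmDE natrD. Qed.

Lemma mnm_row0 : mnm_row 0%MM = 0.
Proof. by apply/rowP => k; rewrite !mxE mnm0E. Qed.

Definition exponent_mx : 'M[rat]_(N, n) := \matrix_(i < N) mnm_row (z i).

Hypothesis rank_z : (size base <= \rank exponent_mx)%N.

Definition word_row (w : seq nat) : 'rV[rat]_N := \row_i (count_mem (i : nat) w)%:R.

Lemma word_rowE m (F : nat -> 'rV[rat]_m) w : all (ltn^~ N) w ->
  word_row w *m (\matrix_(i < N) F i) = \sum_(i <- w) F i.
Proof.
elim: w => [_|i w IH /= /andP[iN wN]].
  rewrite big_nil; have -> : word_row [::] = 0 by apply/rowP => i; rewrite !mxE.
  by rewrite mul0mx.
rewrite big_cons -IH //; have -> : word_row (i :: w) = delta_mx 0 (Ordinal iN) + word_row w.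
  apply/rowP => j; rewrite !mxE /= natrD; congr (_%:R + _).
  by rewrite -val_eqE /= eq_sym.
by rewrite mulmxDl -rowE rowK.
Qed.

Definition functional_col (v : seq nat) (c : nat) (W : seq nat) : 'cV[rat]_N :=
  \matrix_(i < N) ((nth 0%N v i)%:R - (c * nth 0%N W i)%:R)%:M.

Lemma word_functional v c W w : all (ltn^~ N) w ->
  word_row w *m functional_col v c W = ((weight v w)%:R - (c * weight W w)%:R)%:M.
Proof.
move=> wN; rewrite /functional_col (word_rowE (fun i => ((nth 0%N v i)%:R - (c * nth 0%N W i)%:R)%:M)) //.
rewrite -raddf_sum /= sumrB -!natr_sum !weightE big_distrr /=.
by [].
Qed.

(** The solution space of the relations contains the columns of the exponent matrix. It has
    dimension at most [size base], which the rank of that matrix reaches, so the two spaces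
    coincide. Hence [v - c W] is a linear function of the exponents and agrees on words with equal
    exponents. *)
Theorem functional_of_relations v c W w w' : respects E v c W ->
  all (ltn^~ N) w -> all (ltn^~ N) w' ->
  (\sum_(i <- w) z i)%MM = (\sum_(i <- w') z i)%MM ->
  (weight v w + c * weight W w' = weight v w' + c * weight W w)%N.
Proof.
move=> resp wN w'N ew.
have [/andP[/allP hknown /allP EN] /allP bN] : (all (fun i => i \in iter 5 (determine E) base) (iota 0 N)
    && all (fun e => all (ltn^~ N) (e.1 ++ e.2)) E) /\ all (ltn^~ N) base by apply/andP.
pose D : 'M[rat]_(size E, N) :=
  \matrix_(k < size E) (word_row (nth ([::], [::]) E k).1 - word_row (nth ([::], [::]) E k).2).
have DE m (A : 'M[rat]_(N, m)) : (forall e, e \in E -> word_row e.1 *m A = word_row e.2 *m A) ->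
    D *m A = 0.
  move=> h; apply/row_matrixP => k; rewrite row_mul rowK row0 mulmxBl h ?subrr //.
  exact: mem_nth.
have EN' e : e \in E -> all (ltn^~ N) e.1 /\ all (ltn^~ N) e.2.
  by move=> /EN; rewrite all_cat => /andP.
have sumz w0 : all (ltn^~ N) w0 -> word_row w0 *m exponent_mx = mnm_row (\sum_(i <- w0) z i)%MM.
  move=> w0N; rewrite (word_rowE (fun i => mnm_row (z i))) //.
  by elim: (w0) => [|i s IH]; rewrite ?big_nil ?mnm_row0 // !big_cons mnm_row_add IH.
pose S := kermx D^T.
have subS m (A : 'M[rat]_(N, m)) : D *m A = 0 -> (A^T <= S)%MS.
  by move=> DA; apply/sub_kermxP; rewrite -trmx_mul DA trmx0.
have XS : (exponent_mx^T <= S)%MS.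
  apply/subS/DE => e eE; have [h1 h2] := EN' e eE; by rewrite !sumz // z_E.
have hS : ((functional_col v c W)^T <= S)%MS.
  apply/subS/DE => e eE; have [h1 h2] := EN' e eE; rewrite !word_functional //.
  congr (_%:M); apply/eqP; rewrite subr_eq addrAC eq_sym subr_eq -!natrD Num.Theory.eqr_nat eq_sym.
  by rewrite (eqP (allP resp _ eE)).
(* Multiplication by [B] restricts a functional to the letters in [base]; propagation makes this
   injective on the solution space [S]. *)
pose B : 'M[rat]_(N, size base) := \matrix_(i, k) ((i : nat) == nth 0%N base k)%:R.
have rankS : (\rank S <= size base)%N.
  have <- : \rank (S *m B) = \rank S.
    apply/mxrank_injP/rowV0P => u.
    rewrite sub_capmx => /andP[/sub_kermxP uD /sub_kermxP uB].
    pose f (i : nat) : rat := if insub i is Some j then u 0 (j : 'I_N) else 0.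
    have fE (j : 'I_N) : f j = u 0 j by rewrite /f valK.
    have fsum w0 : all (ltn^~ N) w0 -> (word_row w0 *m u^T) 0 0 = \sum_(i <- w0) f i.
      move=> w0N; have -> : u^T = \matrix_(i < N) (f i)%:M.
        by apply/matrixP => i j; rewrite !mxE fE (ord1 j) eqxx mulr1n.
      by rewrite (word_rowE (fun i => (f i)%:M)) // -raddf_sum /= mxE eqxx mulr1n.
    have fEq e : e \in E -> \sum_(i <- e.1) f i = \sum_(i <- e.2) f i.
      move=> eE; have [h1 h2] := EN' e eE; rewrite -!fsum //.
      have kE : (index e E < size E)%N by rewrite index_mem.
      have : row (Ordinal kE) (D *m u^T) = 0 by rewrite -[D]trmxK -trmx_mul uD trmx0 row0.
      rewrite row_mul rowK /= nth_index // mulmxBl => /eqP; rewrite subr_eq0 => /eqP -> //.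
    have fbase i : i \in base -> f i = 0.
      move=> ib; have iN := bN _ ib; have kb : (index i base < size base)%N by rewrite index_mem.
      rewrite -[i]/(val (Ordinal iN)) fE.
      have := congr1 (fun A : 'rV[rat]__ => A 0 (Ordinal kb)) uB; rewrite !mxE => <-.
      rewrite (bigD1 (Ordinal iN)) //= mxE /= nth_index // eqxx mulr1 big1 ?addr0 // => j ji.
      move: ji; rewrite -val_eqE /= => /negbTE ji; by rewrite mxE nth_index // ji mulr0.
    apply/rowP => j; rewrite mxE -fE.
    have : (j : nat) \in iter 5 (determine E) base by apply: hknown; rewrite mem_iota add0n ltn_ord.
    elim: 5%N (j : nat) => [|k IH] i; first exact: fbase.
    rewrite iterS; exact: determineP fEq IH i.
  exact: rank_leq_col.
(* The inclusion [XS] is an equality for reasons of dimension. *)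
have SX : (S <= exponent_mx^T)%MS.
  have [_ <-] := mxrank_leqif_sup XS; rewrite eqn_leq mxrankS //=.
  by rewrite mxrank_tr (leq_trans rankS).
have /submxP[A hA] := submx_trans hS SX.
have : word_row w *m functional_col v c W = word_row w' *m functional_col v c W.
  have -> : functional_col v c W = exponent_mx *m A^T.
    by apply: trmx_inj; rewrite hA trmx_mul trmxK.
  by rewrite !mulmxA !sumz // ew.
rewrite !word_functional // => /matrixP/(_ 0 0); rewrite !mxE !mulr1n => /eqP.
rewrite subr_eq addrAC eq_sym subr_eq -!natrD Num.Theory.eqr_nat => /eqP <- //.
Qed.

End Separate.

(** * The initial monomials of the brackets have rank at least 10 *)

Definition local_orderings (t : nat) : seq (seq nat) :=
  if others 4 [:: t] is [:: a; b; c] then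
    [:: [:: a; b; c]; [:: a; c; b]; [:: b; a; c]; [:: b; c; a]; [:: c; a; b]; [:: c; b; a]]
  else [::].

Definition local_matching (t k : nat) : seq (nat * nat) :=
  zip (iota 0 3) (nth [::] (local_orderings t) k).

Definition choices4 : seq (seq nat) :=
  [seq i :: w | i <- iota 0 6, w <- [seq i :: w | i <- iota 0 6, w <-
    [seq [:: i; j] | i <- iota 0 6, j <- iota 0 6]]].

Definition choice_matching (c : seq nat) (t : nat) : seq (nat * nat) :=
  local_matching t (nth 0%N c t).

Definition choice_edges (c : seq nat) : seq (nat * nat) :=
  choice_matching c 0 ++ choice_matching c 1 ++ choice_matching c 2 ++ choice_matching c 3.

(* If the matchings of the first three columns and of the columns 0, 1, 3 use
   the columns a and b in row i, then two of the four matchings differ exactly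
   by the replacement of the entry (i, a) by (i, b). *)
Definition linked (c : seq nat) : bool :=
  all (fun i =>
    let a := nth 0%N (unzip2 (choice_matching c 3)) i in
    let b := nth 0%N (unzip2 (choice_matching c 2)) i in
    if a == b then true else
    has (fun t => has (fun u =>
      perm_eq ((i, b) :: choice_matching c t) ((i, a) :: choice_matching c u))
      (iota 0 4)) (iota 0 4)) (iota 0 3).

Definition same_key (q p : seq nat * seq nat) : bool :=
  if q.1 == p.1 then q.2 != p.2 else false.

(** On a list sorted by keys, choices with the same key are adjacent, so a look at both neighbours
    decides whether a key is shared; [prev] holds the preceding entry. Only unshared choices have to
    be linked. *)
Fixpoint isolated_linked (prev s : seq (seq nat * seq nat)) : bool :=
  if s is p :: s' then
    if has (same_key^~ p) prev then isolated_linked [:: p] s' else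
    if has (same_key^~ p) (take 1 s') then isolated_linked [:: p] s' else
    if linked p.2 then isolated_linked [:: p] s' else false
  else true.

Definition keyed_choices : seq (seq nat * seq nat) :=
  [seq (sort leq [seq 4 * e.1 + e.2 | e <- choice_edges c], c) | c <- choices4]%N.

Definition four_columns_check : bool :=
  isolated_linked [::] (sort (fun p q => lexleq p.1 q.1) keyed_choices).

Lemma four_columns_check_true : four_columns_check.
Proof. by vm_compute. Qed.

Lemma isolated_linkedP prev s p : isolated_linked prev s -> p \in s ->
  linked p.2 \/ exists2 q, q \in prev ++ s & same_key q p.
Proof.
elim: s prev => // q s IH prev /=; rewrite inE => h /orP[/eqP->|ps].
  move: h; case: ifP => [/hasP[r rp rq] _|_].
    by right; exists r; rewrite // mem_cat rp.
  case: ifP => [/hasP[r rp rq] _|_].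
    by right; exists r; rewrite // mem_cat inE (mem_take rp) !orbT.
  by case: ifP => // lq _; left.
have h' : isolated_linked [:: q] s by move: h; do 3 case: ifP => //.
case: (IH _ h' ps) => [|[r rin rp]]; first by left.
by right; exists r; rewrite // mem_cat rin orbT.
Qed.

Section Rank.
Variable le : rel 'X_{1..3 * 6}.
Hypothesis ole : monomial_order le.
Section FourColumns.
Variable cm : nat -> 'I_6.
Hypothesis cm_uniq : uniq [:: cm 0%N; cm 1%N; cm 2%N; cm 3%N].

Let phi (e : nat * nat) := edge (inord e.1) (cm e.2).

Let init (t : nat) : 'X_{1..3 * 6} :=
  if others 4 [:: t] is [:: a; b; c] then bracket_init le (cm a) (cm b) (cm c) else 0%MM.

Lemma local_matching_ordering t k : (t < 4)%N -> (k < 6)%N ->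
  if others 4 [:: t] is [:: a; b; c] then
  (\sum_(e <- local_matching t k) phi e)%MM
    = nth 0%MM [seq matching t.2 | t <- orderings (cm a) (cm b) (cm c)] k else False.
Proof.
have i0 : inord 0 = mrow0 by apply: val_inj; rewrite /= inordK.
have i1 : inord 1 = mrow1 by apply: val_inj; rewrite /= inordK.
have i2 : inord 2 = mrow2 by apply: val_inj; rewrite /= inordK.
by case: t => [|[|[|[|t]]]] // _; case: k => [|[|[|[|[|[|k]]]]]] // _;
  rewrite /local_matching /= !big_cons big_nil addm0 /phi /= i0 i1 i2 addmA.
Qed.

Lemma local_uniq t : (t < 4)%N ->
  if others 4 [:: t] is [:: a; b; c] then uniq [:: cm a; cm b; cm c] else False.
Proof.
move=> t4; have h (mk : bitseq) : uniq (mask mk [:: cm 0%N; cm 1%N; cm 2%N; cm 3%N]).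
  exact: (mask_uniq cm_uniq).
case: t t4 => [|[|[|[|t]]]] // _.
- exact: (h [:: false; true; true; true]).
- exact: (h [:: true; false; true; true]).
- exact: (h [:: true; true; false; true]).
exact: (h [:: true; true; true; false]).
Qed.

Lemma local_matching_le t k : (t < 4)%N -> (k < 6)%N ->
  le (\sum_(e <- local_matching t k) phi e)%MM (init t).
Proof.
move=> t4 k6; have := local_matching_ordering t4 k6; rewrite /init.
case: (others _ _) => [|a [|b [|c [|? ?]]]] // ->.
by apply: (maxm_ge ole); apply: mem_nth.
Qed.

Lemma local_matching_inj t k k' : (t < 4)%N -> (k < 6)%N -> (k' < 6)%N ->
  (\sum_(e <- local_matching t k) phi e)%MM = (\sum_(e <- local_matching t k') phi e)%MM ->
  k = k'.
Proof.
move=> t4 k6 k'6; have := local_matching_ordering t4 k6; have := local_matching_ordering t4 k'6.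
have := local_uniq t4; case: (others _ _) => [|a [|b [|c [|? ?]]]] // u -> -> /eqP.
by rewrite nth_uniq ?uniq_matchings // => /eqP.
Qed.

Lemma local_matching_init t : (t < 4)%N ->
  exists2 k, (k < 6)%N & init t = (\sum_(e <- local_matching t k) phi e)%MM.
Proof.
move=> t4; have hk k := @local_matching_ordering t k t4; rewrite /init.
have := local_uniq t4; case: (others _ _) hk => [|a [|b [|c [|? ?]]]] // hk _.
have [x xin e] := bracket_init_mem ole (cm a) (cm b) (cm c).
have := map_f (fun t : bool * ('I_6 * 'I_6 * 'I_6) => matching t.2) xin.
case/(nthP 0%MM) => k; rewrite size_map => k6 nk; exists k => //.
by rewrite hk // e -nk.
Qed.

(** Suppose another choice of four matchings used the same edges. Then its total would equal the sum
    of the four maxima, so each of its matchings would be maximal, and the choices would coincide.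
    Thus the choice made by the order does not share its key, and the finite check applies. *)
Lemma linked_choice : exists c, [/\ linked c,
  forall t, (t < 4)%N -> (nth 0%N c t < 6)%N &
  forall t, (t < 4)%N -> init t = (\sum_(e <- choice_matching c t) phi e)%MM].
Proof.
have [k0 k06 e0] := local_matching_init (isT : (0 < 4)%N).
have [k1 k16 e1] := local_matching_init (isT : (1 < 4)%N).
have [k2 k26 e2] := local_matching_init (isT : (2 < 4)%N).
have [k3 k36 e3] := local_matching_init (isT : (3 < 4)%N).
pose c := [:: k0; k1; k2; k3].
have cinit t : (t < 4)%N -> init t = (\sum_(e <- choice_matching c t) phi e)%MM.
  by case: t => [|[|[|[|t]]]].
have c6 t : (t < 4)%N -> (nth 0%N c t < 6)%N by case: t => [|[|[|[|t]]]].
exists c; split => //.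
have in4 d : d \in choices4 <-> size d = 4%N /\ all (ltn^~ 6) d.
  split.
    have : all (fun d => (size d == 4) && all (ltn^~ 6) d)%N choices4 by vm_compute.
    by move/allP=> h /h /andP[/eqP].
  move=> [/eqP sd d6]; case: d sd d6 => [|a [|b [|x [|y [|? ?]]]]] // _ d6.
  have [a6 b6 x6 y6] : [/\ a < 6, b < 6, x < 6 & y < 6]%N by move: d6; rewrite /= andbT => /and4P.
  by do 2 (apply: allpairs_f; first by rewrite mem_iota); apply: allpairs_f; rewrite mem_iota.
pose key d := sort leq [seq 4 * e.1 + e.2 | e <- choice_edges d]%N.
have keyed d : d \in choices4 -> (key d, d) \in keyed_choices.
  exact: (map_f (fun d => (key d, d))).
have cin : c \in choices4 by apply/in4; split => //=; rewrite k06 k16 k26 k36.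
have := isolated_linkedP (p := (key c, c)) four_columns_check_true.
rewrite mem_sort => /(_ (keyed _ cin)) [//|[q]] /=; rewrite mem_sort.
case/mapP=> d /in4[sd d6] ->; rewrite /same_key /=; case: eqP => // ek /eqP dc; case: dc.
have d6' t : (t < 4)%N -> (nth 0%N d t < 6)%N by move=> t4; apply: (all_nthP 0%N d6); rewrite sd.
have ple : perm_eq [seq 4 * e.1 + e.2 | e <- choice_edges d]%N [seq 4 * e.1 + e.2 | e <- choice_edges c]%N.
  by rewrite -(perm_sort leq) ek perm_sort.
have small b k t : (t < 4)%N -> (k < 6)%N -> b \in local_matching t k -> (b.2 < 4)%N.
  by case: t => [|[|[|[|t]]]] // _; case: k => [|[|[|[|[|[|k]]]]]] // _;
     rewrite /local_matching /= !inE => /or3P[] /eqP->.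
(* A key stores the edge (i, j) as [4 * i + j], from which the edge is recovered because [j < 4]; so
   sums over edges depend on the key only. *)
pose psi (x : nat) := phi (x %/ 4, x %% 4)%N.
have psiE b d' : (forall t, (t < 4)%N -> (nth 0%N d' t < 6)%N) -> b \in choice_edges d' ->
    psi (4 * b.1 + b.2)%N = phi b.
  move=> d'6 bin; have b4 : (b.2 < 4)%N.
    by move: bin; rewrite /choice_edges !mem_cat => /or4P[] bin; apply: small bin => //; apply: d'6.
  have q4 : ((4 * b.1 + b.2) %/ 4 = b.1)%N by lia.
  have r4 : ((4 * b.1 + b.2) %% 4 = b.2)%N by lia.
  by rewrite /psi q4 r4.
have sumE d' : (forall t, (t < 4)%N -> (nth 0%N d' t < 6)%N) ->
   (\sum_(x <- [seq 4 * e.1 + e.2 | e <- choice_edges d']%N) psi x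
    = \sum_(e <- choice_edges d') phi e)%MM.
  by move=> h; rewrite big_map; apply: eq_big_seq => b /psiE ->.
have : (\sum_(x <- [seq 4 * e.1 + e.2 | e <- choice_edges d]%N) psi x
    = \sum_(x <- [seq 4 * e.1 + e.2 | e <- choice_edges c]%N) psi x)%MM by apply: perm_big.
rewrite !sumE //.
rewrite /choice_edges !big_cat /= -!cinit // => es.
pose mu t := (\sum_(e <- choice_matching d t) phi e)%MM.
have mule t : (t < 4)%N -> le (mu t) (init t) by move=> t4; apply: local_matching_le; auto.
have mueq t : (t < 4)%N -> mu t = init t -> nth 0%N d t = nth 0%N c t.
  by move=> t4; rewrite cinit // => /local_matching_inj; apply; auto.
rewrite -/(mu 0%N) -/(mu 1%N) -/(mu 2%N) -/(mu 3%N) in es.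
(* A single strict inequality among the four would make the sums differ, contrary to [es]. *)
have tot : forall t, (t < 4)%N -> mu t = init t.
  have l0 := mule 0%N isT; have l1 := mule 1%N isT; have l2 := mule 2%N isT; have l3 := mule 3%N isT.
  have ne : ~ mlt le (mu 0%N + (mu 1%N + (mu 2%N + mu 3%N)))%MM (init 0 + (init 1 + (init 2 + init 3)))%MM.
    by rewrite es mlt_neqAle // eqxx.
  move=> t t4; apply/eqP/negPn/negP => nt; apply: ne.
  have lt : mlt le (mu t) (init t) by rewrite mlt_neqAle // nt mule.
  case: t t4 nt lt => [|[|[|[|t]]]] // _ _ lt.
  - by apply: mlt_le_add => //; do 2 (apply: mle_add => //).
  - by apply: mle_lt_add => //; apply: mlt_le_add => //; apply: mle_add.
  - by do 2 (apply: mle_lt_add => //); apply: mlt_le_add.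
  by do 3 (apply: mle_lt_add => //).
apply: (@eq_from_nth _ 0%N); rewrite sd // => t t4; exact: mueq (tot t t4).
Qed.

End FourColumns.
End Rank.

Lemma uniq_inord (l : seq nat) :
  uniq l -> all (ltn^~ 6) l -> uniq [seq inord x : 'I_6 | x <- l].
Proof.
move=> ul l6; rewrite map_inj_in_uniq // => x y xl yl /(congr1 val) /=.
by rewrite !inordK //; [apply: (allP l6)|apply: (allP l6)].
Qed.

(** * From four columns to all six *)

Section Rank.
Variable le : rel 'X_{1..3 * 6}.
Hypothesis ole : monomial_order le.
Variable m : nat.
Variable M : 'M[rat]_(m, 3 * 6).
Hypothesis M_init : forall a b c : 'I_6, uniq [:: a; b; c] ->
  (mnm_row (bracket_init le a b c) <= M)%MS.

Definition entry_row (i : 'I_3) (j : 'I_6) : 'rV[rat]_(3 * 6) := mnm_row (edge i j).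

Definition uses (a b c : 'I_6) (i : 'I_3) (j : 'I_6) : bool :=
  bracket_init le a b c (mxvec_index i j) != 0%N.

(** Being linked means that two initial monomials on these four columns differ exactly by the
    replacement of (i, j) by (i, j'), so that the difference of the two entries lies in the row
    space. *)
Lemma exchange_column p q r s i j j' : uniq [:: p; q; r; s] ->
  uses p q r i j -> uses p q s i j' -> (entry_row i j - entry_row i j' <= M)%MS.
Proof.
move=> u uj uj'; pose cm := nth p [:: p; q; r; s].
have [c [lc c6 ci]] := @linked_choice le ole cm u.
pose phi (e : nat * nat) := edge (inord e.1) (cm e.2).
pose col t := nth 0%N (unzip2 (choice_matching c t)) i.
have colP t l : (t < 4)%N ->
    (\sum_(e <- choice_matching c t) phi e)%MM (mxvec_index i l) != 0%N -> l = cm (col t).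
  move=> t4; rewrite mnm_sumE sum_nat_seq_neq0 => /hasP[e ein /=].
  rewrite edge_entry eqb0 negbK => /andP[/eqP ei /eqP <-]; congr cm.
  rewrite /col -ei; move: ein (c6 t t4); rewrite /choice_matching; move: (nth 0%N c t) => k.
  by case: t t4 {k} (k) => [|[|[|[|t]]]] // _ [|[|[|[|[|[|k]]]]]] //;
    rewrite /local_matching /= !inE => /or3P[] /eqP-> _; rewrite /= inordK.
(* Matchings are numbered by the omitted column: 3 leaves [p, q, r] and 2 leaves [p, q, s]. *)
have ja : j = cm (col 3%N) by apply: colP => //; have := ci 3%N isT => /= <-.
have jb : j' = cm (col 2%N) by apply: colP => //; have := ci 2%N isT => /= <-.
have sum_init t : (t < 4)%N -> (mnm_row (\sum_(e <- choice_matching c t) phi e)%MM <= M)%MS.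
  move=> t4; rewrite -(ci t t4); have := @local_uniq cm u t t4.
  by case: (others _ _) => [|x [|y [|z [|? ?]]]] //; apply: M_init.
have := allP lc i; rewrite mem_iota ltn_ord => /(_ isT); cbv zeta beta.
rewrite -/(col 3%N) -/(col 2%N); case: eqP => [e|_ /hasP[t + /hasP[v]]].
  by rewrite ja jb e subrr sub0mx.
rewrite !mem_iota => t4 v4 pe.
have : (\sum_(e <- (i : nat, col 2%N) :: choice_matching c t) phi e =
        \sum_(e <- (i : nat, col 3%N) :: choice_matching c v) phi e)%MM by apply: perm_big.
rewrite !big_cons /= => /(congr1 (@mnm_row _)); rewrite !mnm_row_add.
rewrite /phi /= inord_val -ja -jb -/(entry_row i j) -/(entry_row i j') => e.
have -> : entry_row i j - entry_row i j' =
    mnm_row (\sum_(e <- choice_matching c t) phi e)%MM - mnm_row (\sum_(e <- choice_matching c v) phi e)%MM.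
  by apply/eqP; rewrite subr_eq addrAC eq_sym subr_eq addrC e.
by apply: addmx_sub; rewrite ?eqmx_opp sum_init.
Qed.

Lemma uses_exists a b c i : uniq [:: a; b; c] -> exists2 j, j \in [:: a; b; c] & uses a b c i j.
Proof.
move=> _; have [t tin e] := bracket_init_mem ole a b c.
exists (if i == mrow0 then t.2.1.1 else if i == mrow1 then t.2.1.2 else t.2.2).
  by move: tin; rewrite !inE => /or4P[/eqP->|/eqP->|/eqP->|/or3P[]/eqP->] /=;
     case: ifP => _; rewrite ?eqxx ?orbT //; case: ifP => _; rewrite ?eqxx ?orbT.
rewrite /uses e /matching !mnmDE !edge_entry.
by case: i => [[|[|[|i]]] hi]; rewrite // -!val_eqE /= !eqxx ?addn0.
Qed.

Lemma uses_swap12 a b c i j : uses a b c i j = uses b a c i j.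
Proof. by rewrite /uses bracket_init_swap12. Qed.

Lemma uses_swap23 a b c i j : uses a b c i j = uses a c b i j.
Proof. by rewrite /uses bracket_init_swap23. Qed.

Definition tied (i : 'I_3) (j j' : 'I_6) : bool := (entry_row i j - entry_row i j' <= M)%MS.

Lemma tied_sym i j j' : tied i j j' = tied i j' j.
Proof. by rewrite /tied -eqmx_opp opprB. Qed.

Lemma tied_trans i j j' j'' : tied i j j' -> tied i j' j'' -> tied i j j''.
Proof. by move=> h h'; have := addmx_sub h h'; rewrite addrA subrK. Qed.

(* Any increasing triple is reached from the first one by increasing one
   column at a time. *)
Lemma uses_tied_sorted (a b c : nat) i j j0 : (a < b < c)%N -> (c < 6)%N ->
  uses (inord a) (inord b) (inord c) i j -> uses (inord 0) (inord 1) (inord 2) i j0 -> tied i j j0.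
Proof.
have un := uniq_inord.
have [n] := ubnP (a + b + c)%N; elim: n a b c j => // n IH a b c j; rewrite ltnS => le_n.
move=> /andP[ab bc] c6 uj u0.
have step a' b' c' j' : (a' + b' + c' < a + b + c)%N -> (a' < b' < c')%N -> (c' < 6)%N ->
    uses (inord a') (inord b') (inord c') i j' -> tied i j j' -> tied i j j0.
  move=> lt h' c'6 u' t; apply: tied_trans t _; apply: IH h' c'6 u' u0.
  exact: leq_trans lt le_n.
have exch x y z w jx : uniq [:: x; y; z; w]%N -> all (ltn^~ 6)%N [:: x; y; z; w] ->
    uses (inord x) (inord y) (inord z) i jx ->
    exists2 jw, uses (inord x) (inord y) (inord w) i jw & tied i jx jw.
  move=> uq h6 ux; have U := un _ uq h6.
  have [|jw _ uw] := @uses_exists (inord x) (inord y) (inord w) i.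
    exact: (mask_uniq U [:: true; true; false; true]).
  by exists jw => //; apply: exchange_column U ux uw.
case: (ltnP b.+1 c) => [bc1|cb].
  have [||jw uw tw] := exch a b c c.-1 j _ _ uj; try by rewrite /= ?inE; lia.
  by apply: step uw tw; lia.
case: (ltnP a.+1 b) => [ab1|ba].
  move: uj; rewrite uses_swap23 => uj.
  have [||jw uw tw] := exch a c b b.-1 j _ _ uj; try by rewrite /= ?inE; lia.
  by move: uw; rewrite uses_swap23 => uw; apply: step uw tw; lia.
case: (posnP a) => [a0|a0].
  have [b1 c2] : b = 1%N /\ c = 2%N by lia.
  (* Both [j] and [j0] are used by the first triple; each is tied to the entry used by the columns
     0, 1, 3. *)
  rewrite a0 b1 c2 in uj; rewrite /tied; have [j1 _ u1] := @uses_exists (inord 0) (inord 1) (inord 3) i (un [:: 0; 1; 3]%N isT isT).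
  have U := un [:: 0; 1; 2; 3]%N isT isT.
  have t1 := exchange_column U uj u1; have t2 := exchange_column U u0 u1.
  by apply: tied_trans t1 _; rewrite tied_sym.
move: uj; rewrite uses_swap12 uses_swap23 => uj.
have [||jw uw tw] := exch b c a a.-1 j _ _ uj; try by rewrite /= ?inE; lia.
by move: uw; rewrite uses_swap23 uses_swap12 => uw; apply: step uw tw; lia.
Qed.

Lemma uses_tied a b c i j j0 : uniq [:: a; b; c] ->
  uses a b c i j -> uses (inord 0) (inord 1) (inord 2) i j0 -> tied i j j0.
Proof.
move=> u; have [ab ac bc] : [/\ a != b, a != c & b != c].
  by move: u; rewrite /= !inE negb_or => /and3P[/andP[-> ->] ->].
have S (x y z : 'I_6) : (x < y)%N -> (y < z)%N -> uses x y z i j ->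
    uses (inord 0) (inord 1) (inord 2) i j0 -> tied i j j0.
  by move=> xy yz; rewrite -[x]inord_val -[y]inord_val -[z]inord_val; apply: uses_tied_sorted;
    rewrite ?inord_val ?xy.
rewrite -!val_eqE /= in ab ac bc.
case: (ltngtP a b) ab => // [ab|ba] _; case: (ltngtP a c) ac => // [ac|ca] _;
  case: (ltngtP b c) bc => // [bc|cb] _; try lia.
- exact: S.
- by rewrite uses_swap23; apply: S.
- by rewrite uses_swap23 uses_swap12; apply: S.
- by rewrite uses_swap12; apply: S.
- by rewrite uses_swap12 uses_swap23; apply: S.
by rewrite uses_swap12 uses_swap23 uses_swap12; apply: S.
Qed.

(* Modulo M all entries of a row that are used become equal; adding the unused
   entries, at most two in each row, and one used entry in each of the first two
   rows gives the whole space. *)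
Theorem rank_initials : (10 <= \rank M)%N.
Proof.
have un : uniq [:: inord 0; inord 1; inord 2 : 'I_6].
  exact: (@uniq_inord [:: 0; 1; 2]%N).
have [t _ e] := bracket_init_mem ole (inord 0) (inord 1) (inord 2).
pose j0 (i : 'I_3) := if i == mrow0 then t.2.1.1 else if i == mrow1 then t.2.1.2 else t.2.2.
have used i : uses (inord 0) (inord 1) (inord 2) i (j0 i).
  rewrite /uses e /matching !mnmDE !edge_entry /j0.
  by case: i => [[|[|[|i]]] hi]; rewrite // -!val_eqE /= !eqxx ?addn0.
have x0E : ((entry_row mrow0 (j0 mrow0) + entry_row mrow1 (j0 mrow1) + entry_row mrow2 (j0 mrow2))%R <= M)%MS.
  by have := M_init un; rewrite e /matching !mnm_row_add.
pose D i := [set j | tied i j (j0 i)].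
(* Given three columns outside [D i], their own bracket would use one of them in row [i], and a used
   entry is tied to [j0 i]. *)
have cardD i : (#|~: D i| <= 2)%N.
  rewrite leqNgt; apply/negP => /card_gt2P[a [b [c [[aD bD cD] [ab bc ca]]]]].
  have u : uniq [:: a; b; c] by rewrite /= !inE negb_or ab bc eq_sym ca.
  have [j jin uj] := @uses_exists a b c i u; have := uses_tied u uj (used i).
  move: aD bD cD; rewrite !inE => /negP na /negP nb /negP nc.
  by move: jin; rewrite !inE => /or3P[] /eqP->.
pose C := (\sum_i \sum_(j in ~: D i) <<entry_row i j>> + entry_row mrow0 (j0 mrow0)
  + entry_row mrow1 (j0 mrow1))%MS.
have rank1 i j : (\rank (entry_row i j) <= 1)%N by apply: rank_leq_row.
(* Here 8 = 3 * 2 + 2, and 18 - 8 = 10 is the claimed bound. *)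
have rankC : (\rank C <= 8)%N.
  have adds p q (A : 'M[rat]_(p, 3 * 6)) (B : 'M[rat]_(q, 3 * 6)) : (\rank (A + B) <= \rank A + \rank B)%N.
    by rewrite mxrank_adds_leqif.
  have sums (I : finType) (P : pred I) (F : I -> 'M[rat]_(3 * 6)) :
      (\rank (\sum_(i | P i) F i) <= \sum_(i | P i) \rank (F i))%N.
    by rewrite mxrank_sum_leqif.
  apply: leq_trans (adds _ _ _ _) (leq_add (n1 := 7) _ (rank1 _ _)).
  apply: leq_trans (adds _ _ _ _) (leq_add (n1 := 6) _ (rank1 _ _)).
  apply: leq_trans (sums _ _ _) _.
  apply: (@leq_trans (\sum_(i < 3) 2)%N); last by rewrite sum_nat_const card_ord.
  apply: leq_sum => i _; apply: leq_trans (sums _ _ _) _.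
  apply: leq_trans (cardD i); rewrite -sum1_card; apply: leq_sum => j _.
  by rewrite mxrank_gen.
have subC i j : j \notin D i -> (entry_row i j <= M + C)%MS.
  move=> jD; apply: submx_trans (addsmxSr _ _); rewrite /C -addsmxA.
  apply: submx_trans (addsmxSl _ _); apply: (sumsmx_sup i) => //.
  by apply: (sumsmx_sup j); [rewrite inE|rewrite genmxE].
have sub0 : (entry_row mrow0 (j0 mrow0) <= M + C)%MS.
  by apply: submx_trans (addsmxSr _ _); rewrite /C; apply: submx_trans (addsmxSl _ _); apply: addsmxSr.
have sub1 : (entry_row mrow1 (j0 mrow1) <= M + C)%MS.
  by apply: submx_trans (addsmxSr _ _); rewrite /C; apply: addsmxSr.
(* The initial monomial of the first triple is the sum of its three used entries, so that the third
   follows from the other two. *)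
have sub2 : (entry_row mrow2 (j0 mrow2) <= M + C)%MS.
  rewrite -[entry_row mrow2 _](addKr (entry_row mrow0 (j0 mrow0) + entry_row mrow1 (j0 mrow1))).
  apply: addmx_sub; first by rewrite eqmx_opp addmx_sub.
  exact: submx_trans x0E (addsmxSl _ _).
have subj0 i : (entry_row i (j0 i) <= M + C)%MS.
  have : [\/ i = mrow0, i = mrow1 | i = mrow2].
    by case: i => [[|[|[|i]]] hi] //; [constructor 1|constructor 2|constructor 3]; apply: val_inj.
  by case=> ->.
have full : (1%:M <= M + C)%MS.
  apply/row_subP => k; rewrite row1; case/mxvec_indexP: k => i j.
  have -> : 'e_(mxvec_index i j) = entry_row i j.
    by apply/rowP => l; rewrite !mxE mnm1E eq_sym.
  case: (boolP (j \in D i)) => [|/subC //]; rewrite inE /tied => tj.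
  rewrite -[entry_row i j](subrK (entry_row i (j0 i))); apply: addmx_sub => //.
  exact: submx_trans tj (addsmxSl _ _).
have := leq_trans (mxrankS full) (leq_of_leqif (mxrank_adds_leqif M C)); rewrite mxrank1 => h.
by move: h rankC; move: (\rank M) (\rank C) => x y; rewrite -[(3 * 6)%N]/18%N; lia.
Qed.

End Rank.

(** * Certificates for the maximal cones *)

(* The 20 minors, followed by the exchange polynomial with columns
   0, 2, 1, 3, 4, 5. *)
Definition generators : seq lpoly :=
  rcons [seq lbracket (nth 0%N t 0) (nth 0%N t 1) (nth 0%N t 2) | t <- triples]
    (lmul (lbracket 0 2 1) (lbracket 3 4 5) ++ lneg (lmul (lbracket 0 2 3) (lbracket 1 4 5))).

(* The equalities that hold on the cone of the weight W. *)
Definition cone_relations (W : seq nat) : seq (seq nat * seq nat) :=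
  let rel ws :=
    match low_index W ws with
    | 0 => (nth [::] ws 1, nth [::] ws 2)
    | 1 => (nth [::] ws 0, nth [::] ws 2)
    | _ => (nth [::] ws 0, nth [::] ws 1)
    end in
  [seq rel ws | ws <- flatten cell_rows].

(* Found by a search over random weights: the rules decrease the weight
   [weights], whose regular triangulation has the facets on which the functionals
   [facets] vanish; the functionals [walls] cut out boundary facets. *)
Record certificate := Certificate {
  rules : rewriting;
  weights : seq nat;
  facets : seq (seq nat);
  walls : seq (seq nat);
  base : seq nat
}.

(** Facets are tested with coefficient 1 since a facet functional is the lifting weight minus a
    linear function of the exponents; walls are linear functions themselves, hence the coefficient
    0. *)
Definition certificate_check (N : nat) (E : seq (seq nat * seq nat)) (c : certificate) : bool :=
  [&& rewriting_valid generators (rules c), rewriting_lowers N (weights c) (rules c),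
      triangulation_check N (rules c) (facets c) (walls c),
      all (fun v => respects E v 1 (weights c)) (facets c),
      all (fun v => respects E v 0 (weights c)) (walls c),
      relations_determine N E (base c) & size (base c) == 10]%N.

(** In this and the next five certificates, the 35 rules match the 35 linearly independent quadratic
    relations among the minors, and the 42 facets match the degree of the Grassmannian in its
    Pluecker embedding. *)
Definition certificate1 : certificate := @Certificate
  [:: (0, 7, [:: (false, [:: 1; 5]); (true, [:: 2; 4])]);
      (1, 6, [:: (false, [:: 0; 8]); (false, [:: 3; 4])]);
      (2, 6, [:: (false, [:: 0; 9]); (false, [:: 3; 5])]);
      (0, 13, [:: (false, [:: 1; 11]); (true, [:: 2; 10])]);
      (3, 10, [:: (true, [:: 0; 14]); (false, [:: 1; 12])]);
      (5, 10, [:: (true, [:: 0; 16]); (false, [:: 4; 11])]);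
      (0, 17, [:: (false, [:: 4; 12]); (true, [:: 6; 10])]);
      (0, 18, [:: (false, [:: 5; 12]); (true, [:: 6; 11])]);
      (0, 19, [:: (false, [:: 7; 12]); (true, [:: 8; 11]); (false, [:: 9; 10])]);
      (2, 17, [:: (false, [:: 3; 16]); (false, [:: 4; 15]); (true, [:: 9; 10])]);
      (6, 13, [:: (false, [:: 3; 16]); (false, [:: 8; 11]); (true, [:: 9; 10])]);
      (1, 9, [:: (false, [:: 2; 8]); (true, [:: 3; 7])]);
      (1, 17, [:: (false, [:: 4; 14]); (true, [:: 8; 10])]);
      (1, 18, [:: (false, [:: 4; 15]); (false, [:: 7; 12]); (true, [:: 8; 11])]);
      (1, 19, [:: (false, [:: 7; 14]); (true, [:: 8; 13])]);
      (3, 11, [:: (true, [:: 0; 15]); (false, [:: 2; 12])]);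
      (3, 13, [:: (true, [:: 1; 15]); (false, [:: 2; 14])]);
      (5, 13, [:: (false, [:: 2; 16]); (false, [:: 7; 11])]);
      (2, 18, [:: (false, [:: 5; 15]); (true, [:: 9; 11])]);
      (2, 19, [:: (false, [:: 7; 15]); (true, [:: 9; 13])]);
      (5, 14, [:: (false, [:: 3; 16]); (false, [:: 4; 15]); (false, [:: 7; 12])]);
      (3, 17, [:: (false, [:: 6; 14]); (true, [:: 8; 12])]);
      (3, 18, [:: (false, [:: 6; 15]); (true, [:: 9; 12])]);
      (3, 19, [:: (false, [:: 8; 15]); (true, [:: 9; 14])]);
      (6, 7, [:: (true, [:: 4; 9]); (false, [:: 5; 8])]);
      (7, 10, [:: (true, [:: 1; 16]); (false, [:: 4; 13])]);
      (7, 17, [:: (false, [:: 4; 19]); (false, [:: 8; 16])]);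
      (5, 17, [:: (false, [:: 4; 18]); (false, [:: 6; 16])]);
      (5, 19, [:: (false, [:: 7; 18]); (true, [:: 9; 16])]);
      (6, 19, [:: (false, [:: 8; 18]); (true, [:: 9; 17])]);
      (10, 18, [:: (false, [:: 11; 17]); (true, [:: 12; 16])]);
      (13, 17, [:: (false, [:: 10; 19]); (false, [:: 14; 16])]);
      (11, 14, [:: (false, [:: 10; 15]); (false, [:: 12; 13])]);
      (13, 18, [:: (false, [:: 11; 19]); (false, [:: 15; 16])]);
      (14, 18, [:: (false, [:: 12; 19]); (false, [:: 15; 17])])]%N
  [:: 7; 3; 7; 6; 0; 5; 7; 2; 0; 6; 7; 7; 3; 8; 5; 0; 3; 8; 9; 8]%N
  [:: [:: 0; 0; 0; 0; 0; 0; 3; 2; 0; 2; 2; 3; 0; 3; 1; 0; 0; 6; 8; 6];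
      [:: 0; 0; 0; 0; 0; 1; 3; 2; 0; 2; 1; 3; 0; 2; 0; 0; 0; 5; 8; 5];
      [:: 0; 0; 0; 3; 0; 2; 3; 2; 0; 2; 0; 0; 0; 1; 2; 0; 0; 4; 5; 4];
      [:: 0; 0; 0; 1; 0; 2; 3; 2; 0; 2; 0; 2; 0; 1; 0; 0; 0; 4; 7; 4];
      [:: 0; 0; 0; 3; 0; 0; 3; 2; 0; 2; 2; 0; 0; 3; 4; 0; 0; 6; 5; 6];
      [:: 2; 0; 0; 0; 0; 0; 5; 0; 0; 2; 4; 3; 0; 3; 1; 0; 0; 8; 8; 6];
      [:: 2; 0; 0; 0; 0; 1; 5; 0; 0; 2; 3; 3; 0; 2; 0; 0; 0; 7; 8; 5];
      [:: 2; 0; 0; 3; 0; 0; 5; 0; 0; 2; 4; 0; 0; 3; 4; 0; 0; 8; 5; 6];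
      [:: 2; 0; 0; 3; 0; 3; 5; 0; 0; 2; 1; 0; 0; 0; 1; 0; 0; 5; 5; 3];
      [:: 2; 0; 0; 2; 0; 3; 5; 0; 0; 2; 1; 1; 0; 0; 0; 0; 0; 5; 6; 3];
      [:: 1; 0; 0; 3; 0; 3; 4; 1; 0; 2; 0; 0; 0; 0; 1; 0; 0; 4; 5; 3];
      [:: 1; 0; 0; 2; 0; 3; 4; 1; 0; 2; 0; 1; 0; 0; 0; 0; 0; 4; 6; 3];
      [:: 0; 2; 0; 0; 0; 0; 1; 2; 0; 0; 2; 3; 0; 3; 1; 0; 0; 4; 6; 4];
      [:: 0; 2; 0; 0; 0; 1; 1; 2; 0; 0; 1; 3; 0; 2; 0; 0; 0; 3; 6; 3];
      [:: 0; 3; 1; 0; 0; 0; 0; 3; 0; 0; 2; 4; 0; 4; 1; 0; 0; 3; 6; 4];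
      [:: 0; 3; 1; 0; 0; 1; 0; 3; 0; 0; 1; 4; 0; 3; 0; 0; 0; 2; 6; 3];
      [:: 2; 2; 0; 0; 0; 0; 3; 0; 0; 0; 4; 3; 0; 3; 1; 0; 0; 6; 6; 4];
      [:: 2; 2; 0; 0; 0; 1; 3; 0; 0; 0; 3; 3; 0; 2; 0; 0; 0; 5; 6; 3];
      [:: 0; 2; 0; 3; 0; 0; 1; 2; 0; 0; 2; 0; 0; 3; 4; 0; 0; 4; 3; 4];
      [:: 0; 3; 1; 4; 0; 0; 0; 3; 0; 0; 2; 0; 0; 4; 5; 0; 0; 3; 2; 4];
      [:: 2; 2; 0; 3; 0; 0; 3; 0; 0; 0; 4; 0; 0; 3; 4; 0; 0; 6; 3; 4];
      [:: 5; 5; 3; 6; 0; 0; 3; 0; 0; 0; 7; 0; 0; 6; 7; 0; 0; 6; 0; 4];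
      [:: 2; 5; 3; 6; 0; 0; 0; 3; 0; 0; 4; 0; 0; 6; 7; 0; 0; 3; 0; 4];
      [:: 5; 5; 3; 6; 0; 4; 3; 0; 0; 0; 3; 0; 0; 2; 3; 0; 0; 2; 0; 0];
      [:: 3; 3; 1; 4; 0; 4; 3; 0; 0; 0; 1; 0; 0; 0; 1; 0; 0; 2; 2; 0];
      [:: 2; 2; 0; 3; 0; 3; 3; 0; 0; 0; 1; 0; 0; 0; 1; 0; 0; 3; 3; 1];
      [:: 0; 2; 0; 3; 0; 2; 1; 2; 0; 0; 0; 0; 0; 1; 2; 0; 0; 2; 3; 2];
      [:: 0; 3; 1; 4; 0; 2; 0; 3; 0; 0; 0; 0; 0; 2; 3; 0; 0; 1; 2; 2];
      [:: 1; 2; 0; 3; 0; 3; 2; 1; 0; 0; 0; 0; 0; 0; 1; 0; 0; 2; 3; 1];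
      [:: 2; 3; 1; 4; 0; 4; 2; 1; 0; 0; 0; 0; 0; 0; 1; 0; 0; 1; 2; 0];
      [:: 2; 4; 2; 5; 0; 4; 1; 2; 0; 0; 0; 0; 0; 1; 2; 0; 0; 0; 1; 0];
      [:: 1; 4; 2; 5; 0; 3; 0; 3; 0; 0; 0; 0; 0; 2; 3; 0; 0; 0; 1; 1];
      [:: 3; 5; 3; 6; 0; 4; 1; 2; 0; 0; 1; 0; 0; 2; 3; 0; 0; 0; 0; 0];
      [:: 2; 5; 3; 6; 0; 3; 0; 3; 0; 0; 1; 0; 0; 3; 4; 0; 0; 0; 0; 1];
      [:: 2; 2; 0; 2; 0; 3; 3; 0; 0; 0; 1; 1; 0; 0; 0; 0; 0; 3; 4; 1];
      [:: 3; 3; 1; 3; 0; 4; 3; 0; 0; 0; 1; 1; 0; 0; 0; 0; 0; 2; 3; 0];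
      [:: 0; 2; 0; 1; 0; 2; 1; 2; 0; 0; 0; 2; 0; 1; 0; 0; 0; 2; 5; 2];
      [:: 0; 3; 1; 1; 0; 2; 0; 3; 0; 0; 0; 3; 0; 2; 0; 0; 0; 1; 5; 2];
      [:: 1; 2; 0; 2; 0; 3; 2; 1; 0; 0; 0; 1; 0; 0; 0; 0; 0; 2; 4; 1];
      [:: 2; 3; 1; 3; 0; 4; 2; 1; 0; 0; 0; 1; 0; 0; 0; 0; 0; 1; 3; 0];
      [:: 2; 4; 2; 3; 0; 4; 1; 2; 0; 0; 0; 2; 0; 1; 0; 0; 0; 0; 3; 0];
      [:: 1; 4; 2; 2; 0; 3; 0; 3; 0; 0; 0; 3; 0; 2; 0; 0; 0; 0; 4; 1]]%N
  [:: [:: 0; 0; 0; 0; 0; 0; 0; 0; 0; 0; 0; 0; 0; 0; 0; 1; 0; 0; 0; 0];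
      [:: 0; 0; 0; 0; 0; 0; 0; 0; 0; 0; 0; 1; 1; 0; 0; 0; 0; 0; 1; 0];
      [:: 0; 0; 0; 0; 0; 0; 0; 0; 0; 0; 1; 0; 0; 1; 1; 0; 1; 1; 0; 1];
      [:: 0; 0; 0; 0; 0; 0; 1; 0; 1; 1; 0; 0; 0; 0; 0; 0; 0; 1; 1; 1];
      [:: 0; 0; 0; 0; 0; 1; 0; 0; 0; 0; 0; 0; 0; 0; 0; 0; 1; 0; 0; 0];
      [:: 0; 0; 0; 0; 1; 0; 0; 1; 0; 0; 0; 0; 0; 0; 0; 0; 0; 0; 0; 0];
      [:: 0; 0; 0; 1; 0; 0; 0; 0; 0; 0; 0; 0; 1; 0; 1; 0; 0; 0; 0; 0];
      [:: 0; 0; 1; 0; 0; 0; 0; 1; 0; 1; 0; 1; 0; 1; 0; 0; 0; 0; 1; 1];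
      [:: 0; 0; 1; 1; 0; 0; 0; 1; 0; 1; 0; 0; 0; 1; 1; 0; 0; 0; 0; 1];
      [:: 0; 1; 0; 0; 0; 0; 0; 0; 1; 0; 0; 0; 0; 0; 0; 0; 0; 0; 0; 0];
      [:: 1; 0; 0; 0; 1; 0; 1; 0; 0; 0; 1; 0; 0; 0; 0; 0; 0; 1; 0; 0];
      [:: 1; 0; 1; 0; 0; 0; 1; 0; 0; 1; 1; 1; 0; 1; 0; 0; 0; 1; 1; 1];
      [:: 1; 0; 1; 1; 0; 0; 1; 0; 0; 1; 1; 0; 0; 1; 1; 0; 0; 1; 0; 1];
      [:: 1; 0; 1; 1; 0; 1; 1; 0; 0; 1; 0; 0; 0; 0; 0; 0; 0; 0; 0; 0];
      [:: 1; 1; 1; 0; 0; 0; 0; 0; 0; 0; 1; 1; 0; 1; 0; 0; 0; 0; 0; 0]]%N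
  [:: 16; 12; 2; 9; 1; 11; 13; 0; 15; 7]%N.

Definition certificate2 : certificate := @Certificate
  [:: (2, 4, [:: (true, [:: 0; 7]); (false, [:: 1; 5])]);
      (2, 6, [:: (false, [:: 0; 9]); (false, [:: 3; 5])]);
      (2, 10, [:: (true, [:: 0; 13]); (false, [:: 1; 11])]);
      (2, 12, [:: (false, [:: 0; 15]); (false, [:: 3; 11])]);
      (4, 11, [:: (false, [:: 0; 16]); (false, [:: 5; 10])]);
      (6, 11, [:: (true, [:: 0; 18]); (false, [:: 5; 12])]);
      (3, 4, [:: (true, [:: 0; 8]); (false, [:: 1; 6])]);
      (3, 7, [:: (true, [:: 1; 9]); (false, [:: 2; 8])]);
      (3, 10, [:: (true, [:: 0; 14]); (false, [:: 1; 12])]);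
      (3, 13, [:: (true, [:: 1; 15]); (false, [:: 2; 14])]);
      (3, 16, [:: (true, [:: 1; 18]); (false, [:: 5; 14]); (true, [:: 8; 11])]);
      (2, 16, [:: (false, [:: 5; 13]); (true, [:: 7; 11])]);
      (2, 17, [:: (true, [:: 0; 19]); (false, [:: 5; 14]); (true, [:: 8; 11])]);
      (2, 18, [:: (false, [:: 5; 15]); (true, [:: 9; 11])]);
      (4, 9, [:: (false, [:: 5; 8]); (true, [:: 6; 7])]);
      (4, 12, [:: (false, [:: 0; 17]); (false, [:: 6; 10])]);
      (7, 10, [:: (true, [:: 1; 16]); (false, [:: 4; 13])]);
      (8, 10, [:: (true, [:: 1; 17]); (false, [:: 4; 14])]);
      (4, 15, [:: (true, [:: 0; 19]); (false, [:: 5; 14]); (true, [:: 6; 13])]);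
      (7, 12, [:: (false, [:: 0; 19]); (false, [:: 1; 18]); (true, [:: 5; 14]); (false, [:: 6; 13]); (false, [:: 8; 11])]);
      (9, 10, [:: (true, [:: 1; 18]); (false, [:: 5; 14]); (true, [:: 6; 13])]);
      (4, 18, [:: (false, [:: 5; 17]); (true, [:: 6; 16])]);
      (8, 12, [:: (true, [:: 3; 17]); (false, [:: 6; 14])]);
      (9, 12, [:: (true, [:: 3; 18]); (false, [:: 6; 15])]);
      (7, 14, [:: (false, [:: 1; 19]); (false, [:: 8; 13])]);
      (7, 15, [:: (false, [:: 2; 19]); (false, [:: 9; 13])]);
      (8, 16, [:: (true, [:: 4; 19]); (false, [:: 7; 17])]);
      (7, 18, [:: (false, [:: 5; 19]); (false, [:: 9; 16])]);
      (8, 15, [:: (false, [:: 3; 19]); (false, [:: 9; 14])]);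
      (8, 18, [:: (false, [:: 6; 19]); (false, [:: 9; 17])]);
      (10, 15, [:: (false, [:: 11; 14]); (true, [:: 12; 13])]);
      (10, 18, [:: (false, [:: 11; 17]); (true, [:: 12; 16])]);
      (14, 16, [:: (true, [:: 10; 19]); (false, [:: 13; 17])]);
      (15, 16, [:: (true, [:: 11; 19]); (false, [:: 13; 18])]);
      (14, 18, [:: (false, [:: 12; 19]); (false, [:: 15; 17])])]%N
  [:: 3; 0; 16; 4; 18; 4; 17; 24; 6; 25; 18; 14; 18; 21; 4; 24; 24; 5; 26; 9]%N
  [:: [:: 0; 0; 5; 0; 5; 0; 0; 3; 2; 0; 6; 2; 2; 1; 1; 0; 2; 0; 0; 0];
      [:: 0; 0; 5; 0; 5; 0; 0; 3; 0; 0; 7; 4; 3; 2; 0; 1; 4; 0; 2; 0];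
      [:: 0; 0; 5; 0; 5; 0; 0; 3; 1; 0; 6; 3; 2; 1; 0; 0; 3; 0; 1; 0];
      [:: 0; 0; 0; 0; 10; 0; 5; 3; 0; 0; 12; 0; 8; 2; 0; 1; 5; 1; 3; 0];
      [:: 0; 0; 0; 0; 10; 0; 5; 3; 1; 0; 11; 0; 7; 1; 0; 0; 5; 2; 3; 0];
      [:: 0; 0; 3; 0; 7; 0; 2; 3; 2; 0; 8; 0; 4; 1; 1; 0; 2; 0; 0; 0];
      [:: 0; 0; 1; 0; 9; 0; 4; 3; 0; 0; 11; 0; 7; 2; 0; 1; 4; 0; 2; 0];
      [:: 0; 0; 2; 0; 8; 0; 3; 3; 1; 0; 9; 0; 5; 1; 0; 0; 3; 0; 1; 0];
      [:: 0; 0; 7; 0; 7; 0; 2; 7; 6; 4; 4; 0; 0; 1; 1; 0; 2; 0; 0; 0];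
      [:: 0; 0; 7; 0; 5; 0; 0; 5; 4; 2; 4; 2; 0; 1; 1; 0; 2; 0; 0; 0];
      [:: 0; 0; 7; 0; 8; 0; 3; 8; 6; 5; 4; 0; 0; 1; 0; 0; 3; 0; 1; 0];
      [:: 0; 0; 7; 0; 5; 0; 0; 5; 3; 2; 4; 3; 0; 1; 0; 0; 3; 0; 1; 0];
      [:: 0; 0; 0; 2; 8; 0; 5; 1; 0; 0; 10; 0; 8; 0; 0; 1; 3; 1; 3; 0];
      [:: 0; 0; 0; 3; 7; 0; 5; 0; 0; 0; 10; 0; 9; 0; 1; 2; 2; 1; 3; 0];
      [:: 0; 0; 0; 1; 9; 0; 5; 2; 1; 0; 10; 0; 7; 0; 0; 0; 4; 2; 3; 0];
      [:: 0; 0; 8; 5; 0; 0; 0; 1; 0; 3; 2; 7; 3; 0; 0; 4; 2; 0; 5; 0];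
      [:: 0; 0; 7; 5; 0; 0; 0; 0; 0; 2; 3; 6; 4; 0; 1; 4; 1; 0; 4; 0];
      [:: 0; 0; 10; 5; 0; 0; 0; 3; 2; 5; 0; 7; 1; 0; 0; 4; 2; 0; 5; 0];
      [:: 0; 0; 10; 5; 0; 0; 0; 3; 4; 5; 0; 5; 1; 0; 2; 4; 0; 0; 3; 0];
      [:: 0; 0; 7; 5; 0; 0; 0; 0; 1; 2; 3; 5; 4; 0; 2; 4; 0; 0; 3; 0];
      [:: 0; 0; 5; 2; 3; 0; 0; 1; 0; 0; 5; 4; 3; 0; 0; 1; 2; 0; 2; 0];
      [:: 0; 0; 5; 3; 2; 0; 0; 0; 0; 0; 5; 4; 4; 0; 1; 2; 1; 0; 2; 0];
      [:: 0; 0; 5; 1; 4; 0; 0; 2; 1; 0; 5; 3; 2; 0; 0; 0; 2; 0; 1; 0];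
      [:: 0; 0; 5; 1; 4; 0; 0; 2; 2; 0; 5; 2; 2; 0; 1; 0; 1; 0; 0; 0];
      [:: 0; 0; 5; 2; 3; 0; 0; 1; 2; 0; 5; 2; 3; 0; 2; 1; 0; 0; 0; 0];
      [:: 0; 0; 5; 3; 2; 0; 0; 0; 1; 0; 5; 3; 4; 0; 2; 2; 0; 0; 1; 0];
      [:: 0; 0; 10; 4; 1; 0; 0; 4; 5; 5; 0; 4; 0; 0; 2; 3; 0; 0; 2; 0];
      [:: 0; 0; 10; 4; 1; 0; 0; 4; 3; 5; 0; 6; 0; 0; 0; 3; 2; 0; 4; 0];
      [:: 0; 0; 8; 2; 3; 0; 0; 4; 5; 3; 2; 2; 0; 0; 2; 1; 0; 0; 0; 0];
      [:: 0; 0; 7; 1; 4; 0; 0; 4; 4; 2; 3; 2; 0; 0; 1; 0; 1; 0; 0; 0];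
      [:: 0; 0; 7; 1; 4; 0; 0; 4; 3; 2; 3; 3; 0; 0; 0; 0; 2; 0; 1; 0];
      [:: 0; 0; 1; 2; 7; 0; 4; 1; 0; 0; 9; 0; 7; 0; 0; 1; 2; 0; 2; 0];
      [:: 0; 0; 1; 3; 6; 0; 4; 0; 0; 0; 9; 0; 8; 0; 1; 2; 1; 0; 2; 0];
      [:: 0; 0; 2; 1; 7; 0; 3; 2; 1; 0; 8; 0; 5; 0; 0; 0; 2; 0; 1; 0];
      [:: 0; 0; 3; 1; 6; 0; 2; 2; 2; 0; 7; 0; 4; 0; 1; 0; 1; 0; 0; 0];
      [:: 0; 0; 3; 2; 5; 0; 2; 1; 2; 0; 7; 0; 5; 0; 2; 1; 0; 0; 0; 0];
      [:: 0; 0; 2; 3; 5; 0; 3; 0; 1; 0; 8; 0; 7; 0; 2; 2; 0; 0; 1; 0];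
      [:: 0; 0; 10; 4; 5; 0; 4; 8; 9; 9; 0; 0; 0; 0; 2; 3; 0; 0; 2; 0];
      [:: 0; 0; 10; 4; 7; 0; 6; 10; 9; 11; 0; 0; 0; 0; 0; 3; 2; 0; 4; 0];
      [:: 0; 0; 8; 2; 5; 0; 2; 6; 7; 5; 2; 0; 0; 0; 2; 1; 0; 0; 0; 0];
      [:: 0; 0; 7; 1; 6; 0; 2; 6; 6; 4; 3; 0; 0; 0; 1; 0; 1; 0; 0; 0];
      [:: 0; 0; 7; 1; 7; 0; 3; 7; 6; 5; 3; 0; 0; 0; 0; 0; 2; 0; 1; 0]]%N
  [:: [:: 0; 0; 0; 0; 0; 0; 0; 0; 0; 0; 0; 0; 0; 0; 0; 0; 0; 0; 0; 1];
      [:: 0; 0; 0; 0; 0; 0; 0; 0; 0; 0; 0; 1; 0; 0; 0; 0; 1; 1; 1; 0];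
      [:: 0; 0; 0; 0; 0; 0; 0; 0; 0; 0; 1; 0; 1; 1; 1; 1; 0; 0; 0; 0];
      [:: 0; 0; 0; 0; 0; 0; 0; 0; 1; 0; 0; 0; 0; 0; 1; 0; 0; 1; 0; 0];
      [:: 0; 0; 0; 0; 0; 1; 0; 0; 0; 0; 0; 0; 0; 0; 0; 0; 0; 0; 0; 0];
      [:: 0; 0; 0; 0; 1; 0; 1; 1; 0; 1; 1; 0; 1; 1; 0; 1; 1; 0; 1; 0];
      [:: 0; 0; 0; 0; 1; 0; 1; 1; 1; 1; 0; 0; 0; 0; 0; 0; 1; 1; 1; 0];
      [:: 0; 0; 0; 1; 0; 0; 1; 0; 0; 1; 0; 0; 1; 0; 0; 1; 0; 0; 1; 0];
      [:: 0; 0; 1; 0; 0; 0; 0; 1; 0; 1; 0; 1; 0; 1; 0; 1; 1; 0; 1; 0];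
      [:: 0; 0; 1; 0; 0; 0; 0; 1; 1; 1; 0; 0; 0; 1; 1; 1; 0; 0; 0; 0];
      [:: 0; 0; 1; 0; 1; 0; 1; 2; 1; 2; 0; 0; 0; 1; 0; 1; 1; 0; 1; 0];
      [:: 0; 1; 0; 0; 1; 0; 0; 1; 0; 0; 1; 0; 0; 1; 0; 0; 1; 0; 0; 0];
      [:: 0; 1; 0; 1; 0; 0; 0; 0; 0; 0; 0; 0; 0; 0; 0; 0; 0; 0; 0; 0];
      [:: 1; 0; 0; 0; 1; 0; 1; 0; 0; 0; 1; 0; 1; 0; 0; 0; 0; 0; 0; 0];
      [:: 1; 0; 1; 0; 0; 0; 0; 0; 0; 0; 0; 1; 0; 0; 0; 0; 0; 0; 0; 0];
      [:: 1; 0; 1; 0; 1; 0; 1; 1; 1; 1; 0; 0; 0; 0; 0; 0; 0; 0; 0; 0]]%N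
  [:: 11; 7; 17; 4; 18; 6; 19; 10; 1; 5]%N.

Definition certificate3 : certificate := @Certificate
  [:: (2, 4, [:: (true, [:: 0; 7]); (false, [:: 1; 5])]);
      (0, 8, [:: (false, [:: 1; 6]); (true, [:: 3; 4])]);
      (3, 5, [:: (true, [:: 0; 9]); (false, [:: 2; 6])]);
      (2, 10, [:: (true, [:: 0; 13]); (false, [:: 1; 11])]);
      (0, 14, [:: (false, [:: 1; 12]); (true, [:: 3; 10])]);
      (0, 15, [:: (false, [:: 2; 12]); (true, [:: 3; 11])]);
      (0, 16, [:: (false, [:: 4; 11]); (true, [:: 5; 10])]);
      (0, 18, [:: (false, [:: 5; 12]); (true, [:: 6; 11])]);
      (0, 19, [:: (false, [:: 7; 12]); (true, [:: 8; 11]); (false, [:: 9; 10])]);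
      (3, 16, [:: (true, [:: 1; 18]); (false, [:: 2; 17]); (false, [:: 7; 12]); (true, [:: 8; 11]); (false, [:: 9; 10])]);
      (5, 14, [:: (false, [:: 2; 17]); (false, [:: 7; 12]); (false, [:: 9; 10])]);
      (2, 8, [:: (false, [:: 1; 9]); (false, [:: 3; 7])]);
      (2, 14, [:: (false, [:: 1; 15]); (false, [:: 3; 13])]);
      (2, 16, [:: (false, [:: 5; 13]); (true, [:: 7; 11])]);
      (2, 18, [:: (false, [:: 5; 15]); (true, [:: 9; 11])]);
      (2, 19, [:: (false, [:: 7; 15]); (true, [:: 9; 13])]);
      (3, 18, [:: (false, [:: 6; 15]); (true, [:: 9; 12])]);
      (3, 19, [:: (false, [:: 8; 15]); (true, [:: 9; 14])]);
      (5, 8, [:: (false, [:: 4; 9]); (false, [:: 6; 7])]);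
      (4, 12, [:: (false, [:: 0; 17]); (false, [:: 6; 10])]);
      (4, 13, [:: (false, [:: 1; 16]); (false, [:: 7; 10])]);
      (8, 10, [:: (true, [:: 1; 17]); (false, [:: 4; 14])]);
      (4, 15, [:: (false, [:: 1; 18]); (true, [:: 7; 12]); (false, [:: 8; 11])]);
      (6, 13, [:: (true, [:: 1; 18]); (false, [:: 2; 17]); (false, [:: 7; 12])]);
      (4, 18, [:: (false, [:: 5; 17]); (true, [:: 6; 16])]);
      (8, 16, [:: (true, [:: 4; 19]); (false, [:: 7; 17])]);
      (5, 19, [:: (false, [:: 7; 18]); (true, [:: 9; 16])]);
      (8, 12, [:: (true, [:: 3; 17]); (false, [:: 6; 14])]);
      (8, 18, [:: (false, [:: 6; 19]); (false, [:: 9; 17])]);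
      (8, 13, [:: (true, [:: 1; 19]); (false, [:: 7; 14])]);
      (10, 15, [:: (false, [:: 11; 14]); (true, [:: 12; 13])]);
      (10, 18, [:: (false, [:: 11; 17]); (true, [:: 12; 16])]);
      (14, 16, [:: (true, [:: 10; 19]); (false, [:: 13; 17])]);
      (14, 18, [:: (false, [:: 12; 19]); (false, [:: 15; 17])]);
      (15, 16, [:: (true, [:: 11; 19]); (false, [:: 13; 18])])]%N
  [:: 8; 3; 11; 7; 8; 9; 0; 8; 9; 6; 13; 0; 6; 15; 13; 11; 16; 3; 11; 15]%N
  [:: [:: 2; 0; 5; 0; 0; 4; 0; 0; 0; 0; 1; 0; 2; 3; 0; 7; 5; 0; 8; 3];
      [:: 5; 0; 8; 3; 0; 4; 0; 0; 0; 0; 1; 0; 2; 3; 0; 7; 2; 0; 5; 0];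
      [:: 0; 0; 3; 0; 0; 2; 0; 0; 2; 0; 0; 0; 1; 2; 1; 6; 4; 0; 7; 4];
      [:: 0; 0; 3; 2; 0; 0; 0; 0; 4; 0; 0; 0; 1; 2; 3; 6; 2; 0; 5; 4];
      [:: 4; 0; 7; 3; 0; 3; 0; 0; 1; 0; 0; 0; 1; 2; 0; 6; 1; 0; 4; 0];
      [:: 1; 0; 4; 0; 0; 3; 0; 0; 1; 0; 0; 0; 1; 2; 0; 6; 4; 0; 7; 3];
      [:: 4; 0; 7; 4; 0; 2; 0; 0; 2; 0; 0; 0; 1; 2; 1; 6; 0; 0; 3; 0];
      [:: 2; 0; 5; 4; 0; 0; 0; 0; 4; 0; 0; 0; 1; 2; 3; 6; 0; 0; 3; 2];
      [:: 12; 0; 8; 3; 7; 11; 0; 0; 0; 0; 8; 0; 2; 3; 0; 0; 9; 0; 5; 0];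
      [:: 9; 0; 5; 0; 7; 11; 0; 0; 0; 0; 8; 0; 2; 3; 0; 0; 12; 0; 8; 3];
      [:: 0; 0; 0; 0; 3; 2; 0; 0; 5; 0; 2; 0; 0; 1; 3; 2; 6; 0; 6; 6];
      [:: 0; 0; 2; 0; 1; 2; 0; 0; 3; 0; 0; 0; 0; 1; 1; 4; 4; 0; 6; 4];
      [:: 1; 0; 3; 0; 1; 3; 0; 0; 2; 0; 0; 0; 0; 1; 0; 4; 4; 0; 6; 3];
      [:: 5; 0; 3; 0; 5; 7; 0; 0; 2; 0; 4; 0; 0; 1; 0; 0; 8; 0; 6; 3];
      [:: 2; 0; 0; 0; 5; 4; 0; 0; 5; 0; 4; 0; 0; 1; 3; 0; 8; 0; 6; 6];
      [:: 0; 0; 0; 2; 3; 0; 0; 0; 7; 0; 2; 0; 0; 1; 5; 2; 4; 0; 4; 6];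
      [:: 0; 0; 2; 2; 1; 0; 0; 0; 5; 0; 0; 0; 0; 1; 3; 4; 2; 0; 4; 4];
      [:: 2; 0; 0; 4; 5; 0; 0; 0; 9; 0; 4; 0; 0; 1; 7; 0; 4; 0; 2; 6];
      [:: 4; 0; 2; 6; 5; 0; 0; 0; 9; 0; 4; 0; 0; 1; 7; 0; 2; 0; 0; 4];
      [:: 4; 0; 4; 6; 3; 0; 0; 0; 7; 0; 2; 0; 0; 1; 5; 2; 0; 0; 0; 2];
      [:: 2; 0; 4; 4; 1; 0; 0; 0; 5; 0; 0; 0; 0; 1; 3; 4; 0; 0; 2; 2];
      [:: 4; 0; 6; 3; 1; 3; 0; 0; 2; 0; 0; 0; 0; 1; 0; 4; 1; 0; 3; 0];
      [:: 8; 0; 6; 3; 5; 7; 0; 0; 2; 0; 4; 0; 0; 1; 0; 0; 5; 0; 3; 0];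
      [:: 4; 0; 6; 4; 1; 2; 0; 0; 3; 0; 0; 0; 0; 1; 1; 4; 0; 0; 2; 0];
      [:: 6; 0; 6; 6; 3; 2; 0; 0; 5; 0; 2; 0; 0; 1; 3; 2; 0; 0; 0; 0];
      [:: 8; 0; 6; 6; 5; 4; 0; 0; 5; 0; 4; 0; 0; 1; 3; 0; 2; 0; 0; 0];
      [:: 0; 0; 0; 0; 3; 2; 1; 0; 5; 0; 1; 0; 0; 0; 2; 2; 5; 0; 6; 5];
      [:: 0; 0; 1; 0; 2; 2; 1; 0; 4; 0; 0; 0; 0; 0; 1; 3; 4; 0; 6; 4];
      [:: 1; 0; 2; 0; 2; 3; 1; 0; 3; 0; 0; 0; 0; 0; 0; 3; 4; 0; 6; 3];
      [:: 4; 0; 2; 0; 5; 6; 1; 0; 3; 0; 3; 0; 0; 0; 0; 0; 7; 0; 6; 3];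
      [:: 2; 0; 0; 0; 5; 4; 1; 0; 5; 0; 3; 0; 0; 0; 2; 0; 7; 0; 6; 5];
      [:: 0; 0; 0; 2; 3; 0; 1; 0; 7; 0; 1; 0; 0; 0; 4; 2; 3; 0; 4; 5];
      [:: 0; 0; 1; 2; 2; 0; 1; 0; 6; 0; 0; 0; 0; 0; 3; 3; 2; 0; 4; 4];
      [:: 2; 0; 0; 4; 5; 0; 1; 0; 9; 0; 3; 0; 0; 0; 6; 0; 3; 0; 2; 5];
      [:: 4; 0; 2; 6; 5; 0; 1; 0; 9; 0; 3; 0; 0; 0; 6; 0; 1; 0; 0; 3];
      [:: 4; 0; 3; 6; 4; 0; 1; 0; 8; 0; 2; 0; 0; 0; 5; 1; 0; 0; 0; 2];
      [:: 2; 0; 3; 4; 2; 0; 1; 0; 6; 0; 0; 0; 0; 0; 3; 3; 0; 0; 2; 2];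
      [:: 4; 0; 5; 3; 2; 3; 1; 0; 3; 0; 0; 0; 0; 0; 0; 3; 1; 0; 3; 0];
      [:: 7; 0; 5; 3; 5; 6; 1; 0; 3; 0; 3; 0; 0; 0; 0; 0; 4; 0; 3; 0];
      [:: 4; 0; 5; 4; 2; 2; 1; 0; 4; 0; 0; 0; 0; 0; 1; 3; 0; 0; 2; 0];
      [:: 6; 0; 5; 6; 4; 2; 1; 0; 6; 0; 2; 0; 0; 0; 3; 1; 0; 0; 0; 0];
      [:: 7; 0; 5; 6; 5; 3; 1; 0; 6; 0; 3; 0; 0; 0; 3; 0; 1; 0; 0; 0]]%N
  [:: [:: 0; 0; 0; 0; 0; 0; 0; 0; 0; 0; 0; 0; 0; 0; 0; 0; 0; 1; 0; 0];
      [:: 0; 0; 0; 0; 0; 0; 0; 0; 0; 0; 0; 1; 0; 0; 0; 0; 0; 0; 0; 0];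
      [:: 0; 0; 0; 0; 0; 0; 0; 0; 0; 0; 1; 0; 1; 1; 1; 1; 1; 0; 1; 1];
      [:: 0; 0; 0; 0; 0; 0; 1; 0; 0; 0; 0; 0; 1; 0; 0; 1; 0; 0; 1; 0];
      [:: 0; 0; 0; 0; 0; 1; 0; 0; 0; 1; 0; 0; 0; 0; 0; 0; 1; 0; 1; 1];
      [:: 0; 0; 0; 0; 1; 0; 0; 1; 1; 0; 1; 0; 0; 1; 1; 0; 1; 0; 0; 1];
      [:: 0; 0; 0; 0; 1; 0; 1; 1; 1; 0; 0; 0; 0; 0; 0; 0; 0; 0; 0; 0];
      [:: 0; 0; 0; 1; 0; 0; 0; 0; 1; 1; 0; 0; 0; 0; 1; 0; 0; 0; 0; 1];
      [:: 0; 0; 1; 0; 0; 0; 0; 1; 0; 0; 0; 0; 0; 1; 0; 1; 0; 0; 0; 0];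
      [:: 0; 1; 0; 0; 0; 0; 0; 0; 0; 0; 0; 0; 0; 0; 0; 0; 0; 0; 0; 0];
      [:: 1; 0; 0; 0; 1; 1; 0; 0; 0; 0; 2; 0; 1; 1; 1; 0; 2; 0; 1; 1];
      [:: 1; 0; 0; 0; 1; 1; 1; 0; 0; 0; 1; 0; 1; 0; 0; 0; 1; 0; 1; 0];
      [:: 1; 0; 0; 1; 1; 0; 0; 0; 1; 0; 2; 0; 1; 1; 2; 0; 1; 0; 0; 1];
      [:: 1; 0; 0; 1; 1; 0; 1; 0; 1; 0; 1; 0; 1; 0; 1; 0; 0; 0; 0; 0];
      [:: 1; 0; 1; 0; 1; 1; 0; 1; 0; 0; 1; 0; 0; 1; 0; 0; 1; 0; 0; 0];
      [:: 1; 0; 1; 1; 0; 0; 0; 0; 0; 0; 1; 0; 1; 1; 1; 1; 0; 0; 0; 0];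
      [:: 1; 0; 1; 1; 0; 1; 0; 0; 0; 1; 0; 0; 0; 0; 0; 0; 0; 0; 0; 0];
      [:: 2; 0; 1; 1; 1; 1; 0; 0; 0; 0; 2; 0; 1; 1; 1; 0; 1; 0; 0; 0]]%N
  [:: 0; 5; 15; 9; 7; 1; 13; 16; 11; 17]%N.

Definition certificate4 : certificate := @Certificate
  [:: (0, 7, [:: (false, [:: 1; 5]); (true, [:: 2; 4])]);
      (0, 8, [:: (false, [:: 1; 6]); (true, [:: 3; 4])]);
      (0, 13, [:: (false, [:: 1; 11]); (true, [:: 2; 10])]);
      (1, 12, [:: (false, [:: 0; 14]); (false, [:: 3; 10])]);
      (0, 16, [:: (false, [:: 4; 11]); (true, [:: 5; 10])]);
      (0, 17, [:: (false, [:: 4; 12]); (true, [:: 6; 10])]);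
      (0, 19, [:: (false, [:: 1; 18]); (true, [:: 4; 15]); (false, [:: 9; 10])]);
      (1, 16, [:: (false, [:: 4; 13]); (true, [:: 7; 10])]);
      (1, 17, [:: (false, [:: 4; 14]); (true, [:: 8; 10])]);
      (3, 5, [:: (true, [:: 0; 9]); (false, [:: 2; 6])]);
      (3, 7, [:: (true, [:: 1; 9]); (false, [:: 2; 8])]);
      (3, 11, [:: (true, [:: 0; 15]); (false, [:: 2; 12])]);
      (3, 13, [:: (true, [:: 1; 15]); (false, [:: 2; 14])]);
      (3, 16, [:: (false, [:: 2; 17]); (true, [:: 4; 15]); (false, [:: 9; 10])]);
      (5, 15, [:: (false, [:: 2; 18]); (false, [:: 9; 11])]);
      (7, 15, [:: (false, [:: 2; 19]); (false, [:: 9; 13])]);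
      (6, 15, [:: (false, [:: 3; 18]); (false, [:: 9; 12])]);
      (3, 19, [:: (false, [:: 8; 15]); (true, [:: 9; 14])]);
      (6, 7, [:: (true, [:: 4; 9]); (false, [:: 5; 8])]);
      (6, 11, [:: (true, [:: 0; 18]); (false, [:: 5; 12])]);
      (7, 11, [:: (true, [:: 2; 16]); (false, [:: 5; 13])]);
      (6, 13, [:: (true, [:: 1; 18]); (false, [:: 5; 14]); (true, [:: 9; 10])]);
      (7, 12, [:: (true, [:: 2; 17]); (false, [:: 5; 14]); (true, [:: 9; 10])]);
      (8, 11, [:: (true, [:: 1; 18]); (true, [:: 2; 17]); (false, [:: 4; 15]); (false, [:: 5; 14]); (true, [:: 9; 10])]);
      (6, 16, [:: (true, [:: 4; 18]); (false, [:: 5; 17])]);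
      (5, 19, [:: (false, [:: 7; 18]); (true, [:: 9; 16])]);
      (8, 12, [:: (true, [:: 3; 17]); (false, [:: 6; 14])]);
      (6, 19, [:: (false, [:: 8; 18]); (true, [:: 9; 17])]);
      (8, 13, [:: (true, [:: 1; 19]); (false, [:: 7; 14])]);
      (8, 16, [:: (true, [:: 4; 19]); (false, [:: 7; 17])]);
      (12, 13, [:: (true, [:: 10; 15]); (false, [:: 11; 14])]);
      (12, 16, [:: (true, [:: 10; 18]); (false, [:: 11; 17])]);
      (11, 19, [:: (false, [:: 13; 18]); (true, [:: 15; 16])]);
      (12, 19, [:: (false, [:: 14; 18]); (true, [:: 15; 17])]);
      (13, 17, [:: (false, [:: 10; 19]); (false, [:: 14; 16])])]%N
  [:: 8; 6; 5; 8; 1; 4; 6; 5; 5; 0; 2; 8; 8; 7; 5; 5; 4; 3; 2; 4]%N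
  [:: [:: 0; 0; 0; 0; 0; 1; 0; 4; 1; 0; 0; 4; 1; 5; 0; 1; 7; 3; 0; 4];
      [:: 0; 0; 0; 0; 0; 2; 1; 5; 2; 0; 0; 4; 1; 5; 0; 0; 7; 3; 0; 4];
      [:: 1; 0; 0; 0; 0; 1; 0; 3; 0; 0; 0; 5; 2; 5; 0; 1; 7; 3; 0; 3];
      [:: 2; 0; 0; 0; 0; 2; 1; 3; 0; 0; 0; 6; 3; 5; 0; 0; 7; 3; 0; 2];
      [:: 0; 0; 0; 4; 0; 0; 3; 3; 4; 0; 0; 0; 1; 1; 0; 2; 3; 3; 0; 4];
      [:: 0; 0; 0; 1; 0; 0; 0; 3; 1; 0; 0; 3; 1; 4; 0; 2; 6; 3; 0; 4];
      [:: 3; 0; 0; 3; 0; 0; 2; 0; 0; 0; 0; 4; 4; 2; 0; 2; 4; 3; 0; 1];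
      [:: 3; 0; 0; 5; 0; 0; 4; 0; 2; 0; 0; 2; 4; 0; 0; 2; 2; 3; 0; 1];
      [:: 1; 0; 0; 1; 0; 0; 0; 2; 0; 0; 0; 4; 2; 4; 0; 2; 6; 3; 0; 3];
      [:: 1; 0; 0; 5; 0; 0; 4; 2; 4; 0; 0; 0; 2; 0; 0; 2; 2; 3; 0; 3];
      [:: 0; 0; 0; 4; 0; 2; 5; 5; 6; 0; 0; 0; 1; 1; 0; 0; 3; 3; 0; 4];
      [:: 1; 0; 0; 5; 0; 2; 6; 4; 6; 0; 0; 0; 2; 0; 0; 0; 2; 3; 0; 3];
      [:: 4; 0; 0; 2; 0; 2; 3; 1; 0; 0; 0; 6; 5; 3; 0; 0; 5; 3; 0; 0];
      [:: 4; 0; 0; 5; 0; 2; 6; 1; 3; 0; 0; 3; 5; 0; 0; 0; 2; 3; 0; 0];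
      [:: 4; 0; 0; 3; 0; 1; 3; 0; 0; 0; 0; 5; 5; 2; 0; 1; 4; 3; 0; 0];
      [:: 4; 0; 0; 5; 0; 1; 5; 0; 2; 0; 0; 3; 5; 0; 0; 1; 2; 3; 0; 0];
      [:: 0; 1; 0; 0; 0; 1; 0; 5; 2; 0; 0; 3; 0; 5; 0; 1; 6; 2; 0; 5];
      [:: 0; 1; 0; 0; 0; 2; 1; 6; 3; 0; 0; 3; 0; 5; 0; 0; 6; 2; 0; 5];
      [:: 0; 1; 0; 3; 0; 0; 2; 4; 4; 0; 0; 0; 0; 2; 0; 2; 3; 2; 0; 5];
      [:: 0; 1; 0; 1; 0; 0; 0; 4; 2; 0; 0; 2; 0; 4; 0; 2; 5; 2; 0; 5];
      [:: 0; 1; 0; 3; 0; 2; 4; 6; 6; 0; 0; 0; 0; 2; 0; 0; 3; 2; 0; 5];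
      [:: 2; 3; 0; 0; 0; 1; 0; 5; 2; 0; 0; 3; 0; 5; 0; 1; 4; 0; 0; 5];
      [:: 2; 3; 0; 0; 0; 2; 1; 6; 3; 0; 0; 3; 0; 5; 0; 0; 4; 0; 0; 5];
      [:: 2; 3; 0; 3; 0; 0; 2; 4; 4; 0; 0; 0; 0; 2; 0; 2; 1; 0; 0; 5];
      [:: 2; 3; 0; 1; 0; 0; 0; 4; 2; 0; 0; 2; 0; 4; 0; 2; 3; 0; 0; 5];
      [:: 2; 3; 0; 3; 0; 2; 4; 6; 6; 0; 0; 0; 0; 2; 0; 0; 1; 0; 0; 5];
      [:: 3; 2; 0; 5; 0; 0; 4; 2; 4; 0; 0; 0; 2; 0; 0; 2; 0; 1; 0; 3];
      [:: 5; 2; 0; 5; 0; 0; 4; 0; 2; 0; 0; 2; 4; 0; 0; 2; 0; 1; 0; 1];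
      [:: 3; 2; 0; 5; 0; 2; 6; 4; 6; 0; 0; 0; 2; 0; 0; 0; 0; 1; 0; 3];
      [:: 6; 2; 0; 5; 0; 2; 6; 1; 3; 0; 0; 3; 5; 0; 0; 0; 0; 1; 0; 0];
      [:: 6; 2; 0; 5; 0; 1; 5; 0; 2; 0; 0; 3; 5; 0; 0; 1; 0; 1; 0; 0];
      [:: 3; 3; 0; 4; 0; 0; 3; 3; 4; 0; 0; 0; 1; 1; 0; 2; 0; 0; 0; 4];
      [:: 6; 3; 0; 4; 0; 0; 3; 0; 1; 0; 0; 3; 4; 1; 0; 2; 0; 0; 0; 1];
      [:: 3; 3; 0; 4; 0; 2; 5; 5; 6; 0; 0; 0; 1; 1; 0; 0; 0; 0; 0; 4];
      [:: 7; 3; 0; 4; 0; 2; 5; 1; 2; 0; 0; 4; 5; 1; 0; 0; 0; 0; 0; 0];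
      [:: 7; 3; 0; 4; 0; 1; 4; 0; 1; 0; 0; 4; 5; 1; 0; 1; 0; 0; 0; 0];
      [:: 4; 3; 0; 0; 0; 1; 0; 3; 0; 0; 0; 5; 2; 5; 0; 1; 4; 0; 0; 3];
      [:: 5; 3; 0; 0; 0; 2; 1; 3; 0; 0; 0; 6; 3; 5; 0; 0; 4; 0; 0; 2];
      [:: 4; 3; 0; 1; 0; 0; 0; 2; 0; 0; 0; 4; 2; 4; 0; 2; 3; 0; 0; 3];
      [:: 6; 3; 0; 3; 0; 0; 2; 0; 0; 0; 0; 4; 4; 2; 0; 2; 1; 0; 0; 1];
      [:: 7; 3; 0; 3; 0; 1; 3; 0; 0; 0; 0; 5; 5; 2; 0; 1; 1; 0; 0; 0];
      [:: 7; 3; 0; 2; 0; 2; 3; 1; 0; 0; 0; 6; 5; 3; 0; 0; 2; 0; 0; 0]]%N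
  [:: [:: 0; 0; 0; 0; 0; 0; 0; 0; 0; 0; 0; 0; 0; 0; 0; 1; 0; 0; 1; 1];
      [:: 0; 0; 0; 0; 0; 0; 0; 0; 0; 0; 0; 1; 1; 1; 1; 0; 1; 1; 0; 0];
      [:: 0; 0; 0; 0; 0; 0; 0; 0; 0; 0; 1; 0; 0; 0; 0; 0; 0; 0; 0; 0];
      [:: 0; 0; 0; 0; 0; 0; 0; 0; 0; 1; 0; 0; 0; 0; 0; 0; 0; 0; 0; 0];
      [:: 0; 0; 0; 0; 0; 1; 1; 1; 1; 0; 0; 0; 0; 0; 0; 0; 0; 0; 1; 1];
      [:: 0; 0; 0; 0; 1; 0; 0; 0; 0; 0; 0; 0; 0; 0; 0; 0; 1; 1; 0; 0];
      [:: 0; 0; 0; 1; 0; 0; 1; 0; 1; 0; 0; 0; 1; 0; 1; 0; 0; 1; 0; 0];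
      [:: 0; 0; 1; 0; 0; 1; 0; 1; 0; 0; 0; 1; 0; 1; 0; 0; 1; 0; 0; 0];
      [:: 0; 0; 1; 1; 0; 0; 0; 0; 0; 0; 0; 0; 0; 0; 0; 1; 0; 0; 0; 0];
      [:: 0; 0; 1; 1; 0; 1; 1; 1; 1; 0; 0; 0; 0; 0; 0; 0; 0; 0; 0; 0];
      [:: 0; 1; 0; 0; 0; 0; 0; 1; 1; 0; 0; 0; 0; 1; 1; 0; 0; 0; 0; 1];
      [:: 1; 0; 0; 0; 0; 1; 1; 0; 0; 0; 0; 1; 1; 0; 0; 0; 0; 0; 1; 0];
      [:: 1; 1; 0; 0; 0; 0; 0; 0; 0; 0; 0; 1; 1; 1; 1; 0; 0; 0; 0; 0];
      [:: 1; 1; 0; 0; 1; 0; 0; 0; 0; 0; 0; 0; 0; 0; 0; 0; 0; 0; 0; 0]]%N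
  [:: 9; 6; 13; 7; 5; 19; 10; 1; 4; 2]%N.

Definition certificate5 : certificate := @Certificate
  [:: (2, 4, [:: (true, [:: 0; 7]); (false, [:: 1; 5])]);
      (3, 4, [:: (true, [:: 0; 8]); (false, [:: 1; 6])]);
      (1, 9, [:: (false, [:: 2; 8]); (true, [:: 3; 7])]);
      (2, 10, [:: (true, [:: 0; 13]); (false, [:: 1; 11])]);
      (3, 10, [:: (true, [:: 0; 14]); (false, [:: 1; 12])]);
      (3, 13, [:: (true, [:: 1; 15]); (false, [:: 2; 14])]);
      (1, 16, [:: (false, [:: 4; 13]); (true, [:: 7; 10])]);
      (1, 17, [:: (false, [:: 4; 14]); (true, [:: 8; 10])]);
      (1, 18, [:: (false, [:: 4; 15]); (false, [:: 7; 12]); (true, [:: 8; 11])]);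
      (3, 16, [:: (true, [:: 4; 15]); (false, [:: 5; 14]); (true, [:: 7; 12])]);
      (9, 10, [:: (false, [:: 0; 19]); (true, [:: 7; 12]); (false, [:: 8; 11])]);
      (8, 13, [:: (true, [:: 1; 19]); (false, [:: 7; 14])]);
      (3, 5, [:: (true, [:: 0; 9]); (false, [:: 2; 6])]);
      (2, 12, [:: (false, [:: 0; 15]); (false, [:: 3; 11])]);
      (2, 16, [:: (false, [:: 5; 13]); (true, [:: 7; 11])]);
      (2, 17, [:: (true, [:: 0; 19]); (false, [:: 5; 14]); (true, [:: 8; 11])]);
      (2, 18, [:: (false, [:: 5; 15]); (true, [:: 9; 11])]);
      (3, 17, [:: (false, [:: 6; 14]); (true, [:: 8; 12])]);
      (3, 18, [:: (false, [:: 6; 15]); (true, [:: 9; 12])]);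
      (8, 15, [:: (false, [:: 3; 19]); (false, [:: 9; 14])]);
      (4, 9, [:: (false, [:: 5; 8]); (true, [:: 6; 7])]);
      (5, 10, [:: (true, [:: 0; 16]); (false, [:: 4; 11])]);
      (4, 12, [:: (false, [:: 0; 17]); (false, [:: 6; 10])]);
      (6, 13, [:: (true, [:: 0; 19]); (true, [:: 4; 15]); (false, [:: 5; 14])]);
      (4, 18, [:: (false, [:: 5; 17]); (true, [:: 6; 16])]);
      (5, 12, [:: (false, [:: 0; 18]); (false, [:: 6; 11])]);
      (9, 13, [:: (true, [:: 2; 19]); (false, [:: 7; 15])]);
      (7, 17, [:: (false, [:: 4; 19]); (false, [:: 8; 16])]);
      (9, 16, [:: (true, [:: 5; 19]); (false, [:: 7; 18])]);
      (9, 17, [:: (true, [:: 6; 19]); (false, [:: 8; 18])]);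
      (12, 13, [:: (true, [:: 10; 15]); (false, [:: 11; 14])]);
      (10, 18, [:: (false, [:: 11; 17]); (true, [:: 12; 16])]);
      (13, 17, [:: (false, [:: 10; 19]); (false, [:: 14; 16])]);
      (15, 17, [:: (true, [:: 12; 19]); (false, [:: 14; 18])]);
      (13, 18, [:: (false, [:: 11; 19]); (false, [:: 15; 16])])]%N
  [:: 1; 7; 7; 9; 3; 2; 3; 4; 6; 8; 7; 5; 8; 5; 0; 4; 5; 8; 8; 0]%N
  [:: [:: 0; 0; 0; 0; 2; 1; 0; 0; 0; 2; 2; 0; 1; 4; 0; 1; 3; 4; 4; 0];
      [:: 0; 0; 0; 1; 1; 0; 0; 0; 0; 3; 2; 0; 2; 4; 0; 2; 3; 4; 5; 0];
      [:: 0; 0; 2; 2; 0; 1; 0; 0; 0; 4; 0; 0; 1; 4; 0; 3; 1; 2; 4; 0];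
      [:: 0; 0; 1; 2; 0; 0; 0; 0; 0; 4; 1; 0; 2; 4; 0; 3; 2; 3; 5; 0];
      [:: 0; 0; 2; 1; 1; 2; 0; 0; 0; 3; 0; 0; 0; 4; 0; 2; 1; 2; 3; 0];
      [:: 0; 0; 1; 0; 2; 2; 0; 0; 0; 2; 1; 0; 0; 4; 0; 1; 2; 3; 3; 0];
      [:: 0; 2; 0; 0; 4; 1; 0; 0; 0; 0; 4; 0; 1; 6; 0; 1; 3; 4; 2; 0];
      [:: 0; 3; 0; 1; 4; 0; 0; 0; 0; 0; 5; 0; 2; 7; 0; 2; 3; 4; 2; 0];
      [:: 0; 3; 2; 1; 4; 2; 0; 0; 0; 0; 3; 0; 0; 7; 0; 2; 1; 2; 0; 0];
      [:: 0; 2; 1; 0; 4; 2; 0; 0; 0; 0; 3; 0; 0; 6; 0; 1; 2; 3; 1; 0];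
      [:: 0; 5; 2; 3; 4; 0; 0; 0; 0; 0; 5; 0; 2; 9; 0; 4; 1; 2; 0; 0];
      [:: 0; 1; 3; 3; 0; 1; 0; 0; 0; 4; 0; 0; 1; 5; 0; 4; 0; 1; 3; 0];
      [:: 0; 2; 3; 4; 0; 0; 0; 0; 0; 4; 1; 0; 2; 6; 0; 5; 0; 1; 3; 0];
      [:: 0; 1; 3; 2; 1; 2; 0; 0; 0; 3; 0; 0; 0; 5; 0; 3; 0; 1; 2; 0];
      [:: 0; 3; 3; 2; 3; 2; 0; 0; 0; 1; 2; 0; 0; 7; 0; 3; 0; 1; 0; 0];
      [:: 0; 5; 3; 4; 3; 0; 0; 0; 0; 1; 4; 0; 2; 9; 0; 5; 0; 1; 0; 0];
      [:: 0; 0; 0; 0; 2; 1; 0; 0; 1; 2; 2; 0; 1; 3; 0; 0; 3; 5; 4; 0];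
      [:: 0; 0; 0; 1; 1; 0; 0; 0; 2; 3; 2; 0; 2; 2; 0; 0; 3; 6; 5; 0];
      [:: 0; 0; 2; 2; 0; 1; 0; 0; 3; 4; 0; 0; 1; 1; 0; 0; 1; 5; 4; 0];
      [:: 0; 0; 1; 2; 0; 0; 0; 0; 3; 4; 1; 0; 2; 1; 0; 0; 2; 6; 5; 0];
      [:: 0; 0; 2; 1; 1; 2; 0; 0; 2; 3; 0; 0; 0; 2; 0; 0; 1; 4; 3; 0];
      [:: 0; 0; 1; 0; 2; 2; 0; 0; 1; 2; 1; 0; 0; 3; 0; 0; 2; 4; 3; 0];
      [:: 0; 2; 0; 0; 4; 1; 0; 0; 1; 0; 4; 0; 1; 5; 0; 0; 3; 5; 2; 0];
      [:: 0; 3; 0; 1; 4; 0; 0; 0; 2; 0; 5; 0; 2; 5; 0; 0; 3; 6; 2; 0];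
      [:: 0; 3; 2; 1; 4; 2; 0; 0; 2; 0; 3; 0; 0; 5; 0; 0; 1; 4; 0; 0];
      [:: 0; 2; 1; 0; 4; 2; 0; 0; 1; 0; 3; 0; 0; 5; 0; 0; 2; 4; 1; 0];
      [:: 0; 5; 2; 3; 4; 0; 0; 0; 4; 0; 5; 0; 2; 5; 0; 0; 1; 6; 0; 0];
      [:: 0; 1; 3; 3; 0; 1; 0; 0; 4; 4; 0; 0; 1; 1; 0; 0; 0; 5; 3; 0];
      [:: 0; 2; 3; 4; 0; 0; 0; 0; 5; 4; 1; 0; 2; 1; 0; 0; 0; 6; 3; 0];
      [:: 0; 1; 3; 2; 1; 2; 0; 0; 3; 3; 0; 0; 0; 2; 0; 0; 0; 4; 2; 0];
      [:: 0; 3; 3; 2; 3; 2; 0; 0; 3; 1; 2; 0; 0; 4; 0; 0; 0; 4; 0; 0];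
      [:: 0; 5; 3; 4; 3; 0; 0; 0; 5; 1; 4; 0; 2; 4; 0; 0; 0; 6; 0; 0];
      [:: 0; 2; 4; 4; 0; 1; 0; 1; 0; 5; 0; 0; 1; 6; 0; 5; 0; 0; 3; 0];
      [:: 0; 3; 4; 5; 0; 0; 0; 1; 0; 5; 1; 0; 2; 7; 0; 6; 0; 0; 3; 0];
      [:: 0; 2; 4; 3; 1; 2; 0; 1; 0; 4; 0; 0; 0; 6; 0; 4; 0; 0; 2; 0];
      [:: 0; 4; 4; 3; 3; 2; 0; 1; 0; 2; 2; 0; 0; 8; 0; 4; 0; 0; 0; 0];
      [:: 0; 6; 4; 5; 3; 0; 0; 1; 0; 2; 4; 0; 2; 10; 0; 6; 0; 0; 0; 0];
      [:: 0; 0; 0; 3; 1; 0; 2; 0; 4; 5; 2; 0; 4; 0; 0; 0; 3; 8; 7; 0];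
      [:: 0; 0; 2; 3; 0; 1; 1; 0; 4; 5; 0; 0; 2; 0; 0; 0; 1; 6; 5; 0];
      [:: 0; 0; 1; 3; 0; 0; 1; 0; 4; 5; 1; 0; 3; 0; 0; 0; 2; 7; 6; 0];
      [:: 0; 1; 3; 4; 0; 1; 1; 0; 5; 5; 0; 0; 2; 0; 0; 0; 0; 6; 4; 0];
      [:: 0; 2; 3; 5; 0; 0; 1; 0; 6; 5; 1; 0; 3; 0; 0; 0; 0; 7; 4; 0]]%N
  [:: [:: 0; 0; 0; 0; 0; 0; 0; 0; 0; 0; 0; 0; 0; 0; 1; 0; 0; 0; 0; 0];
      [:: 0; 0; 0; 0; 0; 0; 0; 0; 0; 0; 0; 0; 0; 1; 0; 1; 0; 0; 0; 1];
      [:: 0; 0; 0; 0; 0; 0; 0; 0; 0; 0; 1; 1; 1; 0; 0; 0; 1; 1; 1; 0];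
      [:: 0; 0; 0; 0; 0; 0; 0; 0; 1; 0; 0; 0; 0; 0; 0; 0; 0; 1; 0; 1];
      [:: 0; 0; 0; 0; 0; 0; 0; 1; 0; 1; 0; 0; 0; 0; 0; 0; 1; 0; 1; 0];
      [:: 0; 0; 0; 0; 1; 1; 1; 0; 0; 0; 0; 0; 0; 0; 0; 0; 0; 0; 0; 0];
      [:: 0; 0; 0; 1; 0; 0; 1; 0; 0; 1; 0; 0; 1; 0; 0; 1; 0; 0; 1; 0];
      [:: 0; 0; 1; 0; 0; 1; 0; 0; 0; 0; 0; 1; 0; 0; 0; 0; 0; 0; 0; 0];
      [:: 0; 1; 0; 0; 1; 0; 0; 1; 0; 0; 1; 0; 0; 1; 0; 0; 1; 0; 0; 0];
      [:: 0; 1; 0; 1; 1; 0; 1; 0; 0; 0; 1; 0; 1; 1; 0; 1; 0; 0; 0; 0];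
      [:: 0; 1; 0; 1; 1; 0; 1; 0; 1; 0; 1; 0; 1; 0; 0; 0; 0; 1; 0; 0];
      [:: 0; 1; 1; 1; 0; 0; 0; 0; 0; 0; 1; 1; 1; 1; 0; 1; 0; 0; 0; 0];
      [:: 0; 1; 1; 1; 0; 0; 0; 0; 1; 0; 1; 1; 1; 0; 0; 0; 0; 1; 0; 0];
      [:: 0; 1; 1; 1; 0; 0; 0; 1; 1; 1; 0; 0; 0; 0; 0; 0; 0; 0; 0; 0];
      [:: 1; 0; 0; 0; 0; 0; 0; 0; 0; 0; 0; 0; 0; 0; 0; 0; 0; 0; 0; 0]]%N
  [:: 17; 9; 11; 14; 12; 6; 19; 10; 1; 0]%N.

Definition certificate6 : certificate := @Certificate
  [:: (2, 4, [:: (true, [:: 0; 7]); (false, [:: 1; 5])]);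
      (1, 6, [:: (false, [:: 0; 8]); (false, [:: 3; 4])]);
      (2, 8, [:: (false, [:: 1; 9]); (false, [:: 3; 7])]);
      (2, 10, [:: (true, [:: 0; 13]); (false, [:: 1; 11])]);
      (1, 12, [:: (false, [:: 0; 14]); (false, [:: 3; 10])]);
      (3, 13, [:: (true, [:: 1; 15]); (false, [:: 2; 14])]);
      (1, 16, [:: (false, [:: 4; 13]); (true, [:: 7; 10])]);
      (1, 17, [:: (false, [:: 4; 14]); (true, [:: 8; 10])]);
      (1, 19, [:: (false, [:: 7; 14]); (true, [:: 8; 13])]);
      (2, 6, [:: (false, [:: 0; 9]); (false, [:: 3; 5])]);
      (2, 12, [:: (false, [:: 0; 15]); (false, [:: 3; 11])]);
      (2, 16, [:: (false, [:: 5; 13]); (true, [:: 7; 11])]);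
      (2, 17, [:: (false, [:: 5; 14]); (true, [:: 7; 12]); (true, [:: 9; 10])]);
      (3, 16, [:: (false, [:: 0; 19]); (true, [:: 1; 18]); (false, [:: 5; 14]); (true, [:: 7; 12]); (true, [:: 9; 10])]);
      (4, 15, [:: (true, [:: 0; 19]); (false, [:: 1; 18]); (false, [:: 9; 10])]);
      (6, 13, [:: (true, [:: 1; 18]); (false, [:: 5; 14]); (true, [:: 9; 10])]);
      (8, 11, [:: (true, [:: 0; 19]); (false, [:: 7; 12]); (false, [:: 9; 10])]);
      (2, 19, [:: (false, [:: 7; 15]); (true, [:: 9; 13])]);
      (3, 17, [:: (false, [:: 6; 14]); (true, [:: 8; 12])]);
      (3, 19, [:: (false, [:: 8; 15]); (true, [:: 9; 14])]);
      (4, 9, [:: (false, [:: 5; 8]); (true, [:: 6; 7])]);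
      (4, 11, [:: (false, [:: 0; 16]); (false, [:: 5; 10])]);
      (6, 10, [:: (true, [:: 0; 17]); (false, [:: 4; 12])]);
      (8, 16, [:: (true, [:: 4; 19]); (false, [:: 7; 17])]);
      (6, 11, [:: (true, [:: 0; 18]); (false, [:: 5; 12])]);
      (5, 15, [:: (false, [:: 2; 18]); (false, [:: 9; 11])]);
      (6, 16, [:: (true, [:: 4; 18]); (false, [:: 5; 17])]);
      (9, 16, [:: (true, [:: 5; 19]); (false, [:: 7; 18])]);
      (6, 15, [:: (false, [:: 3; 18]); (false, [:: 9; 12])]);
      (6, 19, [:: (false, [:: 8; 18]); (true, [:: 9; 17])]);
      (12, 13, [:: (true, [:: 10; 15]); (false, [:: 11; 14])]);
      (13, 17, [:: (false, [:: 10; 19]); (false, [:: 14; 16])]);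
      (12, 16, [:: (true, [:: 10; 18]); (false, [:: 11; 17])]);
      (15, 16, [:: (true, [:: 11; 19]); (false, [:: 13; 18])]);
      (12, 19, [:: (false, [:: 14; 18]); (true, [:: 15; 17])])]%N
  [:: 6; 16; 21; 16; 15; 15; 17; 0; 14; 15; 15; 17; 16; 19; 4; 18; 21; 16; 1; 19]%N
  [:: [:: 0; 4; 9; 2; 0; 0; 0; 0; 0; 1; 1; 3; 0; 8; 0; 5; 7; 0; 0; 6];
      [:: 0; 2; 7; 0; 0; 0; 0; 0; 0; 1; 1; 3; 0; 8; 0; 5; 9; 2; 0; 8];
      [:: 0; 0; 5; 0; 0; 0; 2; 0; 0; 1; 0; 2; 1; 5; 0; 4; 8; 3; 0; 7];
      [:: 0; 0; 5; 5; 0; 0; 7; 0; 0; 1; 0; 2; 6; 0; 0; 4; 3; 3; 0; 2];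
      [:: 0; 3; 8; 2; 0; 0; 1; 0; 0; 1; 0; 2; 0; 6; 0; 4; 6; 0; 0; 5];
      [:: 0; 1; 6; 0; 0; 0; 1; 0; 0; 1; 0; 2; 0; 6; 0; 4; 8; 2; 0; 7];
      [:: 0; 3; 8; 7; 0; 0; 6; 0; 0; 1; 0; 2; 5; 1; 0; 4; 1; 0; 0; 0];
      [:: 0; 2; 7; 7; 0; 0; 7; 0; 0; 1; 0; 2; 6; 0; 0; 4; 1; 1; 0; 0];
      [:: 0; 4; 9; 9; 0; 0; 7; 0; 1; 2; 0; 2; 6; 1; 0; 5; 0; 0; 0; 0];
      [:: 0; 3; 8; 9; 0; 0; 8; 0; 1; 2; 0; 2; 7; 0; 0; 5; 0; 1; 0; 0];
      [:: 0; 0; 0; 0; 5; 0; 7; 0; 4; 0; 3; 0; 4; 2; 0; 1; 10; 10; 0; 8];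
      [:: 0; 0; 0; 2; 5; 0; 9; 0; 4; 0; 3; 0; 6; 0; 0; 1; 8; 10; 0; 6];
      [:: 0; 5; 9; 2; 1; 0; 0; 0; 0; 0; 2; 3; 0; 8; 0; 4; 7; 0; 0; 5];
      [:: 0; 3; 7; 0; 1; 0; 0; 0; 0; 0; 2; 3; 0; 8; 0; 4; 9; 2; 0; 7];
      [:: 0; 0; 4; 0; 1; 0; 3; 0; 0; 0; 0; 1; 1; 3; 0; 2; 7; 3; 0; 5];
      [:: 0; 0; 4; 3; 1; 0; 6; 0; 0; 0; 0; 1; 4; 0; 0; 2; 4; 3; 0; 2];
      [:: 0; 3; 7; 2; 1; 0; 2; 0; 0; 0; 0; 1; 0; 4; 0; 2; 5; 0; 0; 3];
      [:: 0; 1; 5; 0; 1; 0; 2; 0; 0; 0; 0; 1; 0; 4; 0; 2; 7; 2; 0; 5];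
      [:: 0; 3; 7; 5; 1; 0; 5; 0; 0; 0; 0; 1; 3; 1; 0; 2; 2; 0; 0; 0];
      [:: 0; 2; 6; 5; 1; 0; 6; 0; 0; 0; 0; 1; 4; 0; 0; 2; 2; 1; 0; 0];
      [:: 0; 0; 3; 0; 2; 0; 4; 0; 1; 0; 0; 0; 1; 2; 0; 1; 7; 4; 0; 5];
      [:: 0; 0; 3; 2; 2; 0; 6; 0; 1; 0; 0; 0; 3; 0; 0; 1; 5; 4; 0; 3];
      [:: 0; 4; 7; 3; 2; 0; 3; 0; 1; 0; 0; 0; 0; 3; 0; 1; 4; 0; 0; 2];
      [:: 0; 1; 4; 0; 2; 0; 3; 0; 1; 0; 0; 0; 0; 3; 0; 1; 7; 3; 0; 5];
      [:: 0; 4; 7; 5; 2; 0; 5; 0; 1; 0; 0; 0; 2; 1; 0; 1; 2; 0; 0; 0];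
      [:: 0; 3; 6; 5; 2; 0; 6; 0; 1; 0; 0; 0; 3; 0; 0; 1; 2; 1; 0; 0];
      [:: 0; 6; 9; 9; 2; 0; 7; 0; 3; 2; 0; 0; 4; 1; 0; 3; 0; 0; 0; 0];
      [:: 0; 5; 8; 9; 2; 0; 8; 0; 3; 2; 0; 0; 5; 0; 0; 3; 0; 1; 0; 0];
      [:: 0; 0; 0; 0; 6; 1; 8; 0; 4; 0; 3; 0; 4; 1; 0; 0; 10; 10; 0; 7];
      [:: 0; 0; 0; 1; 6; 1; 9; 0; 4; 0; 3; 0; 5; 0; 0; 0; 9; 10; 0; 6];
      [:: 0; 0; 4; 0; 3; 2; 5; 0; 0; 0; 0; 1; 1; 1; 0; 0; 7; 3; 0; 3];
      [:: 0; 0; 4; 1; 3; 2; 6; 0; 0; 0; 0; 1; 2; 0; 0; 0; 6; 3; 0; 2];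
      [:: 0; 3; 7; 2; 3; 2; 4; 0; 0; 0; 0; 1; 0; 2; 0; 0; 5; 0; 0; 1];
      [:: 0; 1; 5; 0; 3; 2; 4; 0; 0; 0; 0; 1; 0; 2; 0; 0; 7; 2; 0; 3];
      [:: 0; 3; 7; 3; 3; 2; 5; 0; 0; 0; 0; 1; 1; 1; 0; 0; 4; 0; 0; 0];
      [:: 0; 2; 6; 3; 3; 2; 6; 0; 0; 0; 0; 1; 2; 0; 0; 0; 4; 1; 0; 0];
      [:: 0; 0; 3; 0; 3; 1; 5; 0; 1; 0; 0; 0; 1; 1; 0; 0; 7; 4; 0; 4];
      [:: 0; 0; 3; 1; 3; 1; 6; 0; 1; 0; 0; 0; 2; 0; 0; 0; 6; 4; 0; 3];
      [:: 0; 4; 7; 3; 3; 1; 4; 0; 1; 0; 0; 0; 0; 2; 0; 0; 4; 0; 0; 1];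
      [:: 0; 1; 4; 0; 3; 1; 4; 0; 1; 0; 0; 0; 0; 2; 0; 0; 7; 3; 0; 4];
      [:: 0; 4; 7; 4; 3; 1; 5; 0; 1; 0; 0; 0; 1; 1; 0; 0; 3; 0; 0; 0];
      [:: 0; 3; 6; 4; 3; 1; 6; 0; 1; 0; 0; 0; 2; 0; 0; 0; 3; 1; 0; 0]]%N
  [:: [:: 0; 0; 0; 0; 0; 0; 0; 0; 0; 0; 0; 0; 0; 0; 0; 0; 0; 0; 1; 0];
      [:: 0; 0; 0; 0; 0; 0; 0; 0; 0; 0; 0; 0; 0; 0; 1; 0; 0; 0; 0; 0];
      [:: 0; 0; 0; 0; 0; 0; 0; 0; 0; 0; 1; 1; 1; 1; 0; 1; 1; 1; 0; 1];
      [:: 0; 0; 0; 0; 0; 0; 0; 0; 1; 1; 0; 0; 0; 1; 0; 1; 1; 1; 0; 2];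
      [:: 0; 0; 0; 0; 0; 0; 0; 1; 0; 0; 0; 0; 0; 0; 0; 0; 0; 0; 0; 0];
      [:: 0; 0; 0; 0; 1; 1; 1; 0; 0; 0; 1; 1; 1; 0; 0; 0; 1; 1; 0; 0];
      [:: 0; 0; 0; 0; 1; 1; 1; 0; 1; 1; 0; 0; 0; 0; 0; 0; 1; 1; 0; 1];
      [:: 0; 0; 0; 1; 0; 0; 1; 0; 0; 0; 1; 1; 2; 0; 0; 1; 0; 1; 0; 0];
      [:: 0; 0; 0; 1; 0; 0; 1; 0; 1; 1; 0; 0; 1; 0; 0; 1; 0; 1; 0; 1];
      [:: 0; 0; 1; 0; 0; 1; 0; 0; 0; 1; 0; 1; 0; 1; 0; 1; 1; 0; 0; 1];
      [:: 0; 0; 1; 0; 1; 2; 1; 0; 0; 1; 0; 1; 0; 0; 0; 0; 1; 0; 0; 0];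
      [:: 0; 0; 1; 1; 0; 1; 1; 0; 0; 1; 0; 1; 1; 0; 0; 1; 0; 0; 0; 0];
      [:: 0; 1; 0; 0; 1; 0; 0; 0; 1; 0; 1; 0; 0; 1; 0; 0; 1; 1; 0; 1];
      [:: 0; 1; 0; 1; 1; 0; 1; 0; 1; 0; 1; 0; 1; 0; 0; 0; 0; 1; 0; 0];
      [:: 0; 1; 1; 0; 1; 1; 0; 0; 0; 0; 1; 1; 0; 1; 0; 0; 1; 0; 0; 0];
      [:: 0; 1; 1; 1; 0; 0; 0; 0; 0; 0; 1; 1; 1; 1; 0; 1; 0; 0; 0; 0];
      [:: 0; 1; 1; 1; 0; 0; 0; 0; 1; 1; 0; 0; 0; 1; 0; 1; 0; 0; 0; 1];
      [:: 0; 1; 1; 1; 1; 1; 1; 0; 1; 1; 0; 0; 0; 0; 0; 0; 0; 0; 0; 0];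
      [:: 0; 2; 1; 1; 1; 0; 0; 0; 1; 0; 1; 0; 0; 1; 0; 0; 0; 0; 0; 0];
      [:: 1; 0; 0; 0; 0; 0; 0; 0; 0; 0; 0; 0; 0; 0; 0; 0; 0; 0; 0; 0]]%N
  [:: 12; 15; 2; 13; 7; 4; 0; 14; 11; 18]%N.

(** Letter 20 is the exchange polynomial. The rule for the pair (0, 19) is its definition, and the
    rules with words of three letters rewrite its products with minors. *)
Definition certificate7 : certificate := @Certificate
  [:: (0, 7, [:: (false, [:: 1; 5]); (true, [:: 2; 4])]);
      (0, 8, [:: (false, [:: 1; 6]); (true, [:: 3; 4])]);
      (0, 16, [:: (false, [:: 4; 11]); (true, [:: 5; 10])]);
      (0, 17, [:: (false, [:: 4; 12]); (true, [:: 6; 10])]);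
      (0, 19, [:: (true, [:: 20]); (true, [:: 4; 15])]);
      (1, 11, [:: (false, [:: 0; 13]); (false, [:: 2; 10])]);
      (3, 10, [:: (true, [:: 0; 14]); (false, [:: 1; 12])]);
      (7, 10, [:: (true, [:: 1; 16]); (false, [:: 4; 13])]);
      (8, 10, [:: (true, [:: 1; 17]); (false, [:: 4; 14])]);
      (9, 10, [:: (true, [:: 20]); (true, [:: 1; 18])]);
      (3, 5, [:: (true, [:: 0; 9]); (false, [:: 2; 6])]);
      (3, 7, [:: (true, [:: 1; 9]); (false, [:: 2; 8])]);
      (3, 11, [:: (true, [:: 0; 15]); (false, [:: 2; 12])]);
      (3, 13, [:: (true, [:: 1; 15]); (false, [:: 2; 14])]);
      (7, 11, [:: (true, [:: 2; 16]); (false, [:: 5; 13])]);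
      (3, 16, [:: (true, [:: 20]); (true, [:: 1; 18]); (false, [:: 2; 17]); (true, [:: 4; 15])]);
      (7, 12, [:: (false, [:: 1; 18]); (true, [:: 2; 17]); (false, [:: 6; 13])]);
      (8, 11, [:: (true, [:: 2; 17]); (false, [:: 4; 15]); (false, [:: 6; 13])]);
      (9, 11, [:: (true, [:: 2; 18]); (false, [:: 5; 15])]);
      (7, 15, [:: (false, [:: 2; 19]); (false, [:: 9; 13])]);
      (2, 20, [:: (false, [:: 0; 9; 13]); (true, [:: 1; 5; 15])]);
      (8, 12, [:: (true, [:: 3; 17]); (false, [:: 6; 14])]);
      (3, 18, [:: (false, [:: 6; 15]); (true, [:: 9; 12])]);
      (8, 15, [:: (false, [:: 3; 19]); (false, [:: 9; 14])]);
      (3, 20, [:: (false, [:: 0; 9; 14]); (true, [:: 1; 6; 15])]);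
      (5, 8, [:: (false, [:: 4; 9]); (false, [:: 6; 7])]);
      (5, 12, [:: (false, [:: 0; 18]); (false, [:: 6; 11])]);
      (5, 14, [:: (true, [:: 20]); (false, [:: 6; 13])]);
      (5, 17, [:: (false, [:: 4; 18]); (false, [:: 6; 16])]);
      (8, 13, [:: (true, [:: 1; 19]); (false, [:: 7; 14])]);
      (8, 16, [:: (true, [:: 4; 19]); (false, [:: 7; 17])]);
      (7, 18, [:: (false, [:: 5; 19]); (false, [:: 9; 16])]);
      (7, 20, [:: (true, [:: 1; 5; 19]); (true, [:: 4; 9; 13])]);
      (8, 18, [:: (false, [:: 6; 19]); (false, [:: 9; 17])]);
      (8, 20, [:: (true, [:: 1; 6; 19]); (true, [:: 4; 9; 14])]);
      (12, 13, [:: (true, [:: 10; 15]); (false, [:: 11; 14])]);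
      (12, 16, [:: (true, [:: 10; 18]); (false, [:: 11; 17])]);
      (15, 16, [:: (true, [:: 11; 19]); (false, [:: 13; 18])]);
      (11, 20, [:: (true, [:: 0; 13; 18]); (true, [:: 5; 10; 15])]);
      (15, 17, [:: (true, [:: 12; 19]); (false, [:: 14; 18])]);
      (12, 20, [:: (true, [:: 0; 14; 18]); (true, [:: 6; 10; 15])]);
      (14, 16, [:: (true, [:: 10; 19]); (false, [:: 13; 17])]);
      (16, 20, [:: (true, [:: 4; 13; 18]); (false, [:: 5; 10; 19])]);
      (17, 20, [:: (true, [:: 4; 14; 18]); (false, [:: 6; 10; 19])])]%N
  [:: 14; 13; 41; 34; 0; 16; 3; 35; 26; 19; 14; 43; 33; 30; 19; 34; 33; 21; 19; 21; 23]%N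
  [:: [:: 0; 0; 0; 0; 0; 6; 0; 8; 6; 0; 2; 3; 0; 4; 0; 0; 7; 2; 1; 1; 5];
      [:: 0; 0; 0; 6; 0; 0; 0; 8; 12; 0; 1; 2; 5; 0; 2; 0; 6; 7; 0; 1; 1];
      [:: 0; 0; 0; 4; 0; 2; 0; 8; 10; 0; 1; 2; 3; 0; 0; 0; 6; 5; 0; 1; 1];
      [:: 0; 0; 0; 1; 0; 5; 0; 8; 7; 0; 1; 2; 0; 3; 0; 0; 6; 2; 0; 1; 4];
      [:: 6; 0; 0; 6; 0; 0; 0; 2; 6; 0; 1; 2; 5; 0; 2; 5; 0; 1; 0; 0; 7];
      [:: 8; 0; 0; 6; 0; 0; 0; 0; 4; 0; 3; 4; 7; 0; 2; 7; 0; 1; 2; 0; 9];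
      [:: 1; 0; 0; 6; 0; 0; 0; 7; 11; 0; 1; 2; 5; 0; 2; 0; 5; 6; 0; 0; 2];
      [:: 1; 0; 0; 1; 0; 5; 0; 7; 6; 0; 1; 2; 0; 3; 0; 0; 5; 1; 0; 0; 5];
      [:: 1; 0; 0; 4; 0; 2; 0; 7; 9; 0; 1; 2; 3; 0; 0; 0; 5; 4; 0; 0; 2];
      [:: 1; 0; 0; 0; 0; 6; 0; 7; 5; 0; 2; 3; 0; 4; 0; 0; 6; 1; 1; 0; 6];
      [:: 6; 0; 0; 0; 0; 6; 0; 2; 0; 0; 6; 7; 4; 4; 0; 5; 5; 0; 5; 0; 11];
      [:: 2; 0; 0; 0; 0; 6; 0; 6; 4; 0; 2; 3; 0; 4; 0; 1; 5; 0; 1; 0; 7];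
      [:: 8; 0; 0; 2; 0; 4; 0; 0; 0; 0; 6; 7; 6; 2; 0; 7; 3; 0; 5; 0; 11];
      [:: 8; 0; 0; 4; 0; 2; 0; 0; 2; 0; 4; 5; 6; 0; 0; 7; 1; 0; 3; 0; 9];
      [:: 2; 0; 0; 1; 0; 5; 0; 6; 5; 0; 1; 2; 0; 3; 0; 1; 4; 0; 0; 0; 6];
      [:: 5; 0; 0; 4; 0; 2; 0; 3; 5; 0; 1; 2; 3; 0; 0; 4; 1; 0; 0; 0; 6];
      [:: 6; 0; 0; 5; 0; 1; 0; 2; 5; 0; 1; 2; 4; 0; 1; 5; 0; 0; 0; 0; 7];
      [:: 8; 0; 0; 5; 0; 1; 0; 0; 3; 0; 3; 4; 6; 0; 1; 7; 0; 0; 2; 0; 9];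
      [:: 0; 0; 0; 2; 0; 4; 0; 8; 8; 1; 0; 1; 0; 2; 0; 0; 5; 2; 0; 1; 4];
      [:: 2; 0; 0; 2; 0; 4; 0; 6; 6; 1; 0; 1; 0; 2; 0; 1; 3; 0; 0; 0; 6];
      [:: 1; 0; 0; 2; 0; 4; 0; 7; 7; 1; 0; 1; 0; 2; 0; 0; 4; 1; 0; 0; 5];
      [:: 0; 0; 0; 6; 0; 0; 0; 8; 12; 1; 0; 1; 4; 0; 2; 0; 5; 6; 0; 1; 2];
      [:: 0; 0; 0; 4; 0; 2; 0; 8; 10; 1; 0; 1; 2; 0; 0; 0; 5; 4; 0; 1; 2];
      [:: 4; 0; 0; 4; 0; 2; 0; 4; 6; 1; 0; 1; 2; 0; 0; 3; 1; 0; 0; 0; 6];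
      [:: 1; 0; 0; 4; 0; 2; 0; 7; 9; 1; 0; 1; 2; 0; 0; 0; 4; 3; 0; 0; 3];
      [:: 1; 0; 0; 6; 0; 0; 0; 7; 11; 1; 0; 1; 4; 0; 2; 0; 4; 5; 0; 0; 3];
      [:: 5; 0; 0; 5; 0; 1; 0; 3; 6; 1; 0; 1; 3; 0; 1; 4; 0; 0; 0; 0; 7];
      [:: 5; 0; 0; 6; 0; 0; 0; 3; 7; 1; 0; 1; 4; 0; 2; 4; 0; 1; 0; 0; 7];
      [:: 0; 0; 1; 7; 0; 0; 0; 9; 13; 0; 1; 3; 6; 0; 2; 0; 7; 8; 0; 1; 0];
      [:: 0; 0; 1; 5; 0; 2; 0; 9; 11; 0; 1; 3; 4; 0; 0; 0; 7; 6; 0; 1; 0];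
      [:: 0; 0; 2; 8; 0; 0; 0; 10; 14; 1; 0; 3; 6; 0; 2; 0; 7; 8; 0; 1; 0];
      [:: 0; 0; 2; 6; 0; 2; 0; 10; 12; 1; 0; 3; 4; 0; 0; 0; 7; 6; 0; 1; 0];
      [:: 1; 0; 2; 8; 0; 0; 0; 9; 13; 0; 1; 4; 7; 0; 2; 0; 7; 8; 0; 0; 0];
      [:: 1; 0; 2; 6; 0; 2; 0; 9; 11; 0; 1; 4; 5; 0; 0; 0; 7; 6; 0; 0; 0];
      [:: 1; 0; 3; 9; 0; 0; 0; 10; 14; 1; 0; 4; 7; 0; 2; 0; 7; 8; 0; 0; 0];
      [:: 1; 0; 3; 7; 0; 2; 0; 10; 12; 1; 0; 4; 5; 0; 0; 0; 7; 6; 0; 0; 0];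
      [:: 0; 1; 0; 3; 0; 3; 0; 8; 9; 2; 0; 0; 0; 1; 0; 0; 4; 2; 0; 1; 4];
      [:: 2; 1; 0; 3; 0; 3; 0; 6; 7; 2; 0; 0; 0; 1; 0; 1; 2; 0; 0; 0; 6];
      [:: 1; 1; 0; 3; 0; 3; 0; 7; 8; 2; 0; 0; 0; 1; 0; 0; 3; 1; 0; 0; 5];
      [:: 0; 1; 0; 6; 0; 0; 0; 8; 12; 2; 0; 0; 3; 0; 2; 0; 4; 5; 0; 1; 3];
      [:: 0; 1; 0; 4; 0; 2; 0; 8; 10; 2; 0; 0; 1; 0; 0; 0; 4; 3; 0; 1; 3];
      [:: 3; 1; 0; 4; 0; 2; 0; 5; 7; 2; 0; 0; 1; 0; 0; 2; 1; 0; 0; 0; 6];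
      [:: 1; 1; 0; 4; 0; 2; 0; 7; 9; 2; 0; 0; 1; 0; 0; 0; 3; 2; 0; 0; 4];
      [:: 1; 1; 0; 6; 0; 0; 0; 7; 11; 2; 0; 0; 3; 0; 2; 0; 3; 4; 0; 0; 4];
      [:: 4; 1; 0; 5; 0; 1; 0; 4; 7; 2; 0; 0; 2; 0; 1; 3; 0; 0; 0; 0; 7];
      [:: 4; 1; 0; 6; 0; 0; 0; 4; 8; 2; 0; 0; 3; 0; 2; 3; 0; 1; 0; 0; 7]]%N
  [:: [:: 0; 0; 0; 0; 0; 0; 0; 0; 0; 0; 0; 0; 0; 0; 0; 1; 0; 0; 0; 1; 0];
      [:: 0; 0; 0; 0; 0; 0; 0; 0; 0; 0; 0; 0; 0; 1; 1; 0; 0; 0; 0; 0; 1];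
      [:: 0; 0; 0; 0; 0; 0; 0; 0; 0; 0; 1; 1; 1; 0; 0; 0; 1; 1; 1; 0; 0];
      [:: 0; 0; 0; 0; 0; 0; 0; 0; 0; 1; 0; 0; 0; 0; 0; 0; 0; 0; 1; 0; 1];
      [:: 0; 0; 0; 0; 0; 1; 1; 0; 0; 0; 0; 0; 0; 0; 0; 0; 0; 0; 0; 0; 0];
      [:: 0; 0; 0; 0; 1; 0; 0; 1; 1; 0; 0; 0; 0; 0; 0; 0; 1; 1; 0; 1; 0];
      [:: 0; 0; 0; 1; 0; 0; 1; 0; 1; 0; 0; 0; 1; 0; 1; 0; 0; 1; 0; 0; 0];
      [:: 0; 0; 1; 0; 0; 1; 0; 1; 0; 0; 0; 1; 0; 1; 0; 0; 1; 0; 0; 0; 0];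
      [:: 0; 0; 1; 1; 0; 0; 0; 1; 1; 0; 0; 1; 1; 1; 1; 0; 1; 1; 0; 0; 0];
      [:: 0; 0; 1; 1; 0; 0; 0; 1; 1; 1; 0; 1; 1; 0; 0; 0; 1; 1; 1; 0; 0];
      [:: 0; 1; 0; 0; 0; 0; 0; 0; 0; 0; 1; 0; 0; 0; 0; 0; 0; 0; 0; 0; 0];
      [:: 0; 1; 1; 1; 0; 0; 0; 1; 1; 1; 0; 0; 0; 0; 0; 0; 0; 0; 0; 0; 0];
      [:: 1; 0; 0; 0; 1; 0; 0; 0; 0; 0; 0; 0; 0; 0; 0; 0; 0; 0; 0; 0; 1];
      [:: 1; 0; 1; 1; 0; 0; 0; 0; 0; 0; 0; 1; 1; 0; 0; 1; 0; 0; 0; 0; 0];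
      [:: 1; 0; 1; 1; 1; 0; 0; 1; 1; 0; 0; 1; 1; 0; 0; 0; 1; 1; 0; 0; 0]]%N
  [:: 1; 17; 14; 2; 13; 18; 8; 15; 4; 6]%N.

Definition certificate8 : certificate := @Certificate
  [:: (2, 4, [:: (true, [:: 0; 7]); (false, [:: 1; 5])]);
      (3, 4, [:: (true, [:: 0; 8]); (false, [:: 1; 6])]);
      (4, 11, [:: (false, [:: 0; 16]); (false, [:: 5; 10])]);
      (4, 12, [:: (false, [:: 0; 17]); (false, [:: 6; 10])]);
      (4, 15, [:: (true, [:: 20]); (true, [:: 0; 19])]);
      (2, 10, [:: (true, [:: 0; 13]); (false, [:: 1; 11])]);
      (3, 10, [:: (true, [:: 0; 14]); (false, [:: 1; 12])]);
      (7, 10, [:: (true, [:: 1; 16]); (false, [:: 4; 13])]);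
      (8, 10, [:: (true, [:: 1; 17]); (false, [:: 4; 14])]);
      (9, 10, [:: (true, [:: 20]); (true, [:: 1; 18])]);
      (3, 5, [:: (true, [:: 0; 9]); (false, [:: 2; 6])]);
      (3, 7, [:: (true, [:: 1; 9]); (false, [:: 2; 8])]);
      (2, 12, [:: (false, [:: 0; 15]); (false, [:: 3; 11])]);
      (3, 13, [:: (true, [:: 1; 15]); (false, [:: 2; 14])]);
      (2, 16, [:: (false, [:: 5; 13]); (true, [:: 7; 11])]);
      (2, 17, [:: (true, [:: 0; 19]); (false, [:: 5; 14]); (true, [:: 8; 11])]);
      (3, 16, [:: (true, [:: 1; 18]); (false, [:: 5; 14]); (true, [:: 8; 11])]);
      (7, 12, [:: (false, [:: 20]); (false, [:: 0; 19]); (false, [:: 1; 18]); (false, [:: 8; 11])]);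
      (2, 18, [:: (false, [:: 5; 15]); (true, [:: 9; 11])]);
      (2, 19, [:: (false, [:: 7; 15]); (true, [:: 9; 13])]);
      (2, 20, [:: (false, [:: 0; 9; 13]); (true, [:: 1; 5; 15])]);
      (3, 17, [:: (false, [:: 6; 14]); (true, [:: 8; 12])]);
      (9, 12, [:: (true, [:: 3; 18]); (false, [:: 6; 15])]);
      (3, 19, [:: (false, [:: 8; 15]); (true, [:: 9; 14])]);
      (3, 20, [:: (false, [:: 0; 9; 14]); (true, [:: 1; 6; 15])]);
      (5, 8, [:: (false, [:: 4; 9]); (false, [:: 6; 7])]);
      (5, 12, [:: (false, [:: 0; 18]); (false, [:: 6; 11])]);
      (6, 13, [:: (false, [:: 20]); (false, [:: 5; 14])]);
      (5, 17, [:: (false, [:: 4; 18]); (false, [:: 6; 16])]);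
      (8, 13, [:: (true, [:: 1; 19]); (false, [:: 7; 14])]);
      (7, 17, [:: (false, [:: 4; 19]); (false, [:: 8; 16])]);
      (7, 18, [:: (false, [:: 5; 19]); (false, [:: 9; 16])]);
      (7, 20, [:: (true, [:: 1; 5; 19]); (true, [:: 4; 9; 13])]);
      (9, 17, [:: (true, [:: 6; 19]); (false, [:: 8; 18])]);
      (8, 20, [:: (true, [:: 1; 6; 19]); (true, [:: 4; 9; 14])]);
      (12, 13, [:: (true, [:: 10; 15]); (false, [:: 11; 14])]);
      (12, 16, [:: (true, [:: 10; 18]); (false, [:: 11; 17])]);
      (11, 19, [:: (false, [:: 13; 18]); (true, [:: 15; 16])]);
      (11, 20, [:: (true, [:: 0; 13; 18]); (true, [:: 5; 10; 15])]);
      (12, 19, [:: (false, [:: 14; 18]); (true, [:: 15; 17])]);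
      (12, 20, [:: (true, [:: 0; 14; 18]); (true, [:: 6; 10; 15])]);
      (13, 17, [:: (false, [:: 10; 19]); (false, [:: 14; 16])]);
      (16, 20, [:: (true, [:: 4; 13; 18]); (false, [:: 5; 10; 19])]);
      (17, 20, [:: (true, [:: 4; 14; 18]); (false, [:: 6; 10; 19])])]%N
  [:: 4; 4; 20; 15; 5; 8; 0; 16; 9; 2; 8; 18; 17; 16; 7; 8; 16; 12; 3; 7; 9]%N
  [:: [:: 0; 0; 5; 7; 0; 1; 0; 0; 0; 0; 4; 3; 9; 2; 0; 2; 0; 3; 1; 0; 7];
      [:: 0; 0; 5; 8; 0; 0; 0; 0; 1; 0; 4; 3; 10; 1; 0; 2; 0; 4; 1; 0; 6];
      [:: 0; 0; 6; 9; 0; 0; 0; 1; 2; 0; 3; 3; 10; 1; 0; 2; 0; 4; 0; 0; 5];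
      [:: 0; 0; 9; 12; 0; 0; 0; 4; 5; 3; 0; 3; 10; 1; 0; 2; 0; 4; 0; 0; 2];
      [:: 0; 0; 6; 7; 0; 2; 0; 1; 0; 0; 3; 3; 8; 3; 0; 2; 0; 2; 0; 0; 7];
      [:: 0; 0; 8; 7; 0; 4; 0; 3; 0; 2; 1; 3; 6; 5; 0; 2; 0; 0; 0; 0; 7];
      [:: 0; 0; 9; 8; 0; 4; 0; 4; 1; 3; 0; 3; 6; 5; 0; 2; 0; 0; 0; 0; 6];
      [:: 0; 0; 11; 14; 0; 0; 0; 6; 7; 0; 3; 8; 15; 1; 0; 2; 5; 9; 0; 0; 0];
      [:: 0; 0; 11; 14; 0; 0; 0; 6; 7; 3; 0; 5; 12; 1; 0; 2; 2; 6; 0; 0; 0];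
      [:: 0; 0; 0; 3; 5; 0; 0; 0; 1; 0; 6; 0; 7; 1; 0; 0; 2; 6; 3; 3; 9];
      [:: 0; 0; 3; 6; 3; 0; 0; 1; 2; 0; 3; 0; 7; 1; 0; 0; 0; 4; 0; 1; 6];
      [:: 0; 0; 2; 5; 3; 0; 0; 0; 1; 0; 4; 0; 7; 1; 0; 0; 0; 4; 1; 1; 7];
      [:: 0; 0; 6; 9; 3; 0; 0; 4; 5; 3; 0; 0; 7; 1; 0; 0; 0; 4; 0; 1; 3];
      [:: 0; 0; 0; 0; 7; 3; 0; 2; 0; 0; 6; 0; 4; 4; 0; 0; 4; 5; 3; 5; 12];
      [:: 0; 0; 0; 2; 5; 1; 0; 0; 0; 0; 6; 0; 6; 2; 0; 0; 2; 5; 3; 3; 10];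
      [:: 0; 0; 3; 0; 7; 6; 0; 5; 0; 0; 3; 0; 1; 7; 0; 0; 4; 2; 0; 5; 12];
      [:: 0; 0; 3; 4; 3; 2; 0; 1; 0; 0; 3; 0; 5; 3; 0; 0; 0; 2; 0; 1; 8];
      [:: 0; 0; 2; 4; 3; 1; 0; 0; 0; 0; 4; 0; 6; 2; 0; 0; 0; 3; 1; 1; 8];
      [:: 0; 0; 5; 1; 6; 7; 0; 6; 0; 2; 1; 0; 0; 8; 0; 0; 3; 0; 0; 4; 11];
      [:: 0; 0; 4; 0; 7; 7; 0; 6; 0; 1; 2; 0; 0; 8; 0; 0; 4; 1; 0; 5; 12];
      [:: 0; 0; 5; 4; 3; 4; 0; 3; 0; 2; 1; 0; 3; 5; 0; 0; 0; 0; 0; 1; 8];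
      [:: 0; 0; 6; 5; 3; 4; 0; 4; 1; 3; 0; 0; 3; 5; 0; 0; 0; 0; 0; 1; 7];
      [:: 0; 0; 6; 2; 6; 7; 0; 7; 1; 3; 0; 0; 0; 8; 0; 0; 3; 0; 0; 4; 10];
      [:: 0; 0; 3; 5; 2; 1; 0; 0; 0; 0; 4; 1; 7; 2; 0; 0; 0; 3; 1; 0; 7];
      [:: 0; 0; 3; 6; 2; 0; 0; 0; 1; 0; 4; 1; 8; 1; 0; 0; 0; 4; 1; 0; 6];
      [:: 0; 0; 4; 7; 2; 0; 0; 1; 2; 0; 3; 1; 8; 1; 0; 0; 0; 4; 0; 0; 5];
      [:: 0; 0; 7; 10; 2; 0; 0; 4; 5; 3; 0; 1; 8; 1; 0; 0; 0; 4; 0; 0; 2];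
      [:: 0; 0; 4; 5; 2; 2; 0; 1; 0; 0; 3; 1; 6; 3; 0; 0; 0; 2; 0; 0; 7];
      [:: 0; 0; 6; 5; 2; 4; 0; 3; 0; 2; 1; 1; 4; 5; 0; 0; 0; 0; 0; 0; 7];
      [:: 0; 0; 7; 6; 2; 4; 0; 4; 1; 3; 0; 1; 4; 5; 0; 0; 0; 0; 0; 0; 6];
      [:: 0; 0; 9; 12; 2; 0; 0; 6; 7; 0; 3; 6; 13; 1; 0; 0; 5; 9; 0; 0; 0];
      [:: 0; 0; 9; 12; 2; 0; 0; 6; 7; 3; 0; 3; 10; 1; 0; 0; 2; 6; 0; 0; 0];
      [:: 0; 0; 6; 10; 0; 0; 1; 1; 3; 0; 3; 3; 11; 0; 0; 2; 0; 5; 0; 0; 5];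
      [:: 0; 0; 5; 9; 0; 0; 1; 0; 2; 0; 4; 3; 11; 0; 0; 2; 0; 5; 1; 0; 6];
      [:: 0; 0; 11; 15; 0; 0; 1; 6; 8; 0; 3; 8; 16; 0; 0; 2; 5; 10; 0; 0; 0];
      [:: 0; 0; 0; 4; 5; 0; 1; 0; 2; 0; 6; 0; 8; 0; 0; 0; 2; 7; 3; 3; 9];
      [:: 0; 0; 4; 8; 2; 0; 1; 1; 3; 0; 3; 1; 9; 0; 0; 0; 0; 5; 0; 0; 5];
      [:: 0; 0; 3; 7; 2; 0; 1; 0; 2; 0; 4; 1; 9; 0; 0; 0; 0; 5; 1; 0; 6];
      [:: 0; 0; 3; 7; 3; 0; 1; 1; 3; 0; 3; 0; 8; 0; 0; 0; 0; 5; 0; 1; 6];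
      [:: 0; 0; 2; 6; 3; 0; 1; 0; 2; 0; 4; 0; 8; 0; 0; 0; 0; 5; 1; 1; 7];
      [:: 0; 0; 9; 13; 2; 0; 1; 6; 8; 0; 3; 6; 14; 0; 0; 0; 5; 10; 0; 0; 0];
      [:: 0; 0; 9; 13; 0; 0; 1; 4; 6; 3; 0; 3; 11; 0; 0; 2; 0; 5; 0; 0; 2];
      [:: 0; 0; 7; 11; 2; 0; 1; 4; 6; 3; 0; 1; 9; 0; 0; 0; 0; 5; 0; 0; 2];
      [:: 0; 0; 6; 10; 3; 0; 1; 4; 6; 3; 0; 0; 8; 0; 0; 0; 0; 5; 0; 1; 3];
      [:: 0; 0; 11; 15; 0; 0; 1; 6; 8; 3; 0; 5; 13; 0; 0; 2; 2; 7; 0; 0; 0];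
      [:: 0; 0; 9; 13; 2; 0; 1; 6; 8; 3; 0; 3; 11; 0; 0; 0; 2; 7; 0; 0; 0]]%N
  [:: [:: 0; 0; 0; 0; 0; 0; 0; 0; 0; 0; 0; 0; 0; 0; 0; 1; 0; 0; 0; 1; 1];
      [:: 0; 0; 0; 0; 0; 0; 0; 0; 0; 0; 0; 0; 0; 1; 1; 0; 0; 0; 0; 0; 0];
      [:: 0; 0; 0; 0; 0; 0; 0; 0; 0; 0; 1; 1; 1; 0; 0; 0; 1; 1; 1; 0; 0];
      [:: 0; 0; 0; 0; 0; 0; 0; 0; 0; 1; 0; 0; 0; 0; 0; 0; 0; 0; 1; 0; 0];
      [:: 0; 0; 0; 0; 0; 1; 1; 0; 0; 0; 0; 0; 0; 0; 0; 0; 0; 0; 0; 0; 1];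
      [:: 0; 0; 0; 0; 1; 0; 0; 1; 1; 0; 0; 0; 0; 0; 0; 0; 1; 1; 0; 1; 0];
      [:: 0; 0; 0; 1; 0; 0; 1; 0; 1; 0; 0; 0; 1; 0; 1; 0; 0; 1; 0; 0; 0];
      [:: 0; 0; 1; 0; 0; 1; 0; 1; 0; 0; 0; 1; 0; 1; 0; 0; 1; 0; 0; 0; 0];
      [:: 0; 0; 1; 1; 0; 0; 0; 1; 1; 0; 0; 1; 1; 0; 0; 1; 1; 1; 0; 1; 0];
      [:: 0; 0; 1; 1; 0; 1; 1; 1; 1; 0; 0; 1; 1; 0; 0; 0; 1; 1; 0; 0; 0];
      [:: 0; 1; 0; 0; 0; 0; 0; 0; 0; 0; 1; 0; 0; 0; 0; 0; 0; 0; 0; 0; 1];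
      [:: 0; 1; 1; 1; 0; 0; 0; 1; 1; 0; 1; 1; 1; 0; 0; 0; 1; 1; 0; 0; 0];
      [:: 0; 1; 1; 1; 0; 0; 0; 1; 1; 1; 0; 0; 0; 0; 0; 0; 0; 0; 0; 0; 0];
      [:: 1; 0; 0; 0; 1; 0; 0; 0; 0; 0; 0; 0; 0; 0; 0; 0; 0; 0; 0; 0; 0];
      [:: 1; 0; 1; 1; 0; 0; 0; 0; 0; 0; 0; 1; 1; 0; 0; 1; 0; 0; 0; 0; 0]]%N
  [:: 4; 14; 2; 9; 15; 17; 11; 0; 1; 20]%N.

(* On the remaining cone the initial monomial of the last generator depends on
   which of the two terms of [bipyramid_rule] is larger. *)
Definition bipyramid_relations (w : seq nat) : seq (seq nat * seq nat) :=
  rcons (cone_relations (head [::] cone_weights)) ([:: 20; 2]%N, w).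

(* With H the last generator, H [0,1,4] = [0,1,2][0,4,5][1,3,4] - [0,1,3][0,2,4][1,4,5]. *)
Definition bipyramid_words : seq nat * seq nat := ([:: 0; 9; 13], [:: 1; 5; 15])%N.

Definition bipyramid_rule : bool :=
  lzero (lword generators [:: 20; 2]%N ++ lneg (lword generators bipyramid_words.1)
    ++ lword generators bipyramid_words.2).

Lemma bipyramid_ruleT : bipyramid_rule.
Proof. by vm_compute. Qed.

(** It satisfies all equalities of the cone but has weights 6 and 5 on the two words. Being a linear
    function of the exponents, it shows that their initial monomials never tie. *)
Definition bipyramid_functional : seq nat :=
  [:: 1; 1; 4; 3; 0; 1; 0; 3; 2; 2; 1; 4; 3; 3; 2; 3; 3; 2; 2; 2]%N.

Lemma bipyramid_functional_check :
  [&& respects (cone_relations (head [::] cone_weights)) bipyramid_functional 0 [::],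
      relations_determine 20 (cone_relations (head [::] cone_weights)) (base certificate7),
      weight bipyramid_functional bipyramid_words.1
        != weight bipyramid_functional bipyramid_words.2
    & size (base certificate7) == 10]%N.
Proof. by vm_compute. Qed.

Lemma cone_certificates_check k : (k < 6)%N ->
  exists c, certificate_check 20 (cone_relations (nth [::] cone_weights k.+1)) c.
Proof.
case: k => [|[|[|[|[|[|k]]]]]] // _;
  [exists certificate1 | exists certificate2 | exists certificate3
  |exists certificate4 | exists certificate5 | exists certificate6]; by vm_compute.
Qed.

Lemma certificate7_check :
  certificate_check 21 (bipyramid_relations bipyramid_words.1) certificate7.
Proof. by vm_compute. Qed.

Lemma certificate8_check :
  certificate_check 21 (bipyramid_relations bipyramid_words.2) certificate8.
Proof. by vm_compute. Qed.

(** * Relabelling the columns *)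

Lemma perm_eq2 (T : eqType) (y z b c : T) : perm_eq [:: y; z] [:: b; c] ->
  (y = b /\ z = c) \/ (y = c /\ z = b).
Proof.
move=> h; have := perm_mem h y; rewrite mem_head !inE => /esym /orP[]/eqP e.
  left; split=> //; move: h; rewrite e perm_cons => /perm_mem /(_ z).
  by rewrite !inE eqxx => /esym/eqP.
right; split=> //; move: h; rewrite e perm_sym (perm_catC [:: b] [:: c]) perm_sym perm_cons.
by move=> /perm_mem /(_ z); rewrite !inE eqxx => /esym/eqP.
Qed.

(** The two adjacent transpositions generate all permutations of three arguments. *)
Lemma perm_eq3_sym (T : eqType) (U : Type) (F : T -> T -> T -> U) :
  (forall a b c, F a b c = F b a c) -> (forall a b c, F a b c = F a c b) ->
  forall x y z a b c, perm_eq [:: x; y; z] [:: a; b; c] -> F x y z = F a b c.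
Proof.
move=> s12 s23 x y z a b c h.
have aux y' z' b' c' x' : perm_eq [:: y'; z'] [:: b'; c'] -> F x' y' z' = F x' b' c'.
  by case/perm_eq2=> -[-> ->].
have := perm_mem h x; rewrite mem_head !inE => /esym /or3P[]/eqP e; move: h; rewrite e.
- by rewrite perm_cons => /aux.
- by rewrite perm_sym (perm_catCA [:: a] [:: b] [:: c]) perm_sym perm_cons => /aux ->.
rewrite perm_sym (perm_catC [:: a; b] [:: c]) perm_sym perm_cons => /aux ->.
by rewrite s12 s23.
Qed.

(** A relabelling carries the cell of (a, f) to the cell of the image pair, but only up to the order
    of the three products; the positions inside a cell are not preserved. *)
Definition sextuple_check : bool :=
  all (fun p => if p is [:: a; b; c; d; e; f] then
      let ws := cell a f in
      all (fun q => has (perm_eq [seq tindex t | t <- q]) ws) (three_splits a [:: b; c; d; e])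
    else false) perms6.

Lemma sextuple_check_true : sextuple_check.
Proof. by vm_compute. Qed.

(** A unique minimum lets the low product be recognized by its weight after a relabelling has
    permuted the products of a cell. *)
Definition strict_check : bool :=
  all (fun W => all (fun ws =>
    let k := low_index W ws in
    all (fun i => (i == k) || (weight W (nth [::] ws k) < weight W (nth [::] ws i))%N) (iota 0 3))
    (flatten cell_rows)) cone_weights.

Lemma strict_check_true : strict_check.
Proof. by vm_compute. Qed.

Section Relabel.
Variable le : rel 'X_{1..3 * 6}.
Hypothesis ole : monomial_order le.

Definition triple_init (col : nat -> 'I_6) (t : seq nat) : 'X_{1..3 * 6} :=
  if t is [:: a; b; c] then bracket_init le (col a) (col b) (col c) else 0%MM.

Lemma triple_init_perm col t u : perm_eq t u -> triple_init col t = triple_init col u.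
Proof.
move=> h; have := perm_size h; rewrite /triple_init.
case: t h => [|a [|b [|c [|? ?]]]] h; case: u h => [|x [|y [|z [|? ?]]]] h //= _.
apply: (perm_eq3_sym (F := fun a b c => bracket_init le (col a) (col b) (col c))) h => *.
  exact: bracket_init_swap12.
exact: bracket_init_swap23.
Qed.

Definition gen_init (col : nat -> 'I_6) (i : nat) : 'X_{1..3 * 6} :=
  triple_init col (nth [::] triples i).

Lemma sort_triple t : size t = 3%N -> uniq t -> all (ltn^~ 6) t -> sort leq t \in triples.
Proof.
move=> st ut t6; rewrite mem_filter.
have -> : sorted ltn (sort leq t).
  by rewrite ltn_sorted_uniq_leq sort_uniq ut sort_sorted //; apply: leq_total.
rewrite andTb.
have : size (sort leq t) = 3%N by rewrite size_sort.
have : all (ltn^~ 6) (sort leq t) by rewrite all_sort.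
case: (sort leq t) => [|a [|b [|c [|? ?]]]] // l6 _.
have /and4P[a6 b6 c6 _] : [&& a < 6, b < 6, c < 6 & true]%N by exact: l6.
apply: (allpairs_f (fun i p => i :: p)); first by rewrite (mem_iota 0 6).
by apply: (allpairs_f (fun j k => [:: j; k])); rewrite (mem_iota 0 6).
Qed.

Lemma nth_tindex t : size t = 3%N -> uniq t -> all (ltn^~ 6) t ->
  nth [::] triples (tindex t) = sort leq t.
Proof. by move=> *; rewrite nth_index // sort_triple. Qed.

Lemma tindex_lt t : size t = 3%N -> uniq t -> all (ltn^~ 6) t -> (tindex t < 20)%N.
Proof.
move=> *; have -> : 20%N = size triples by vm_compute.
by rewrite index_mem sort_triple.
Qed.

Lemma gen_init_tindex col t : size t = 3%N -> uniq t -> all (ltn^~ 6) t ->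
  gen_init col (tindex t) = triple_init col t.
Proof. by move=> *; rewrite /gen_init nth_tindex //; apply: triple_init_perm; rewrite perm_sort. Qed.

Lemma tindex_perm t u : perm_eq t u -> tindex t = tindex u.
Proof. by move=> h; congr (index _ _); apply/perm_sortP => //; [apply: leq_total|apply: leq_trans|apply: anti_leq]. Qed.

Lemma low_gen_init a f : (a < 6)%N -> (f < 6)%N -> a != f ->
  exists2 k, (k < 3)%N & low_at le (gen_init inord) (cell a f) k.
Proof.
move=> a6 f6 af; rewrite /cell.
have so : size (others 6 [:: a; f]) = 4%N.
  by move: af; case: a a6 => [|[|[|[|[|[|a]]]]]] // _; case: f f6 => [|[|[|[|[|[|f]]]]]].
have uo : uniq (a :: others 6 [:: a; f]).
  by rewrite /= mem_filter inE eqxx /= filter_uniq ?iota_uniq.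
have o6 : all (ltn^~ 6) (a :: others 6 [:: a; f]).
  by rewrite /= a6; apply/allP => x; rewrite mem_filter mem_iota => /andP[].
case: (others 6 [:: a; f]) so uo o6 => [|b [|c [|d [|e [|? ?]]]]] // _ uo o6.
have [k k3 h] := three_term_low ole (uniq_inord uo o6); exists k => //.
have E (mk : bitseq) : size (mask mk [:: a; b; c; d; e]) = 3%N ->
    gen_init inord (tindex (mask mk [:: a; b; c; d; e])) = triple_init inord (mask mk [:: a; b; c; d; e]).
  move=> sm; apply: gen_init_tindex => //; first exact: (mask_uniq uo).
  by apply/allP => x /mem_mask /(allP o6).
have Eabc := E [:: true; true; true] erefl.
have Eabd := E [:: true; true; false; true] erefl.
have Eabe := E [:: true; true; false; false; true] erefl.
have Eacd := E [:: true; false; true; true] erefl.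
have Eace := E [:: true; false; true; false; true] erefl.
have Eade := E [:: true; false; false; true; true] erefl.
rewrite /= in Eabc Eabd Eabe Eacd Eace Eade.
move: k3 h; rewrite /low_at; case: k => [|[|[|k]]] //= _;
  by rewrite !big_cons !big_nil Eabc Eabd Eabe Eacd Eace Eade.
Qed.

Section Permuted.
Variable s W : seq nat.
Hypothesis s_perm : s \in perms6.
Hypothesis W_cone : W \in cone_weights.
Hypothesis low_sW : forall a f, (a < 6)%N -> (f < 6)%N -> a != f ->
  low_at le (gen_init inord) (cell a f) (low_index (permuted_weight s W) (cell a f)).

(** As [permuted_weight s W] reads [W] at the images under [s], relabelling the columns by the
    inverse brings the order into the cone of [W] itself. One certificate then serves a whole
    orbit. *)
Definition inverse_label (k : nat) : nat := index k s.
Definition label (k : nat) : 'I_6 := inord (inverse_label k).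

Let sP : perm_eq s (iota 0 6). Proof. by rewrite -mem_permutations. Qed.
Let s_size : size s = 6%N. Proof. by rewrite (perm_size sP). Qed.
Let s_uniq : uniq s. Proof. by rewrite (perm_uniq sP) iota_uniq. Qed.

Lemma inverse_label_lt k : (k < 6)%N -> (inverse_label k < 6)%N.
Proof. by move=> k6; rewrite -[X in (_ < X)%N]s_size index_mem (perm_mem sP) mem_iota. Qed.

Lemma nth_inverse_label k : (k < 6)%N -> nth 0%N s (inverse_label k) = k.
Proof. by move=> k6; rewrite nth_index // (perm_mem sP) mem_iota. Qed.

Lemma inverse_label_nth k : (k < 6)%N -> inverse_label (nth 0%N s k) = k.
Proof. by move=> k6; rewrite /inverse_label index_uniq ?s_size. Qed.

Lemma inverse_label_triple t : uniq t -> all (ltn^~ 6) t ->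
  uniq (map inverse_label t) /\ all (ltn^~ 6) (map inverse_label t).
Proof.
move=> ut t6; split; last by apply/allP => _ /mapP[k /(allP t6) k6 ->]; apply: inverse_label_lt.
rewrite map_inj_in_uniq // => x y /(allP t6) x6 /(allP t6) y6 /(congr1 (nth 0%N s)).
by rewrite !nth_inverse_label.
Qed.

Lemma label_nth (a : 'I_6) : label (nth 0%N s a) = a.
Proof. by rewrite /label inverse_label_nth // inord_val. Qed.

Lemma gen_init_label t : size t = 3%N -> uniq t -> all (ltn^~ 6) t ->
  gen_init label (tindex t) = gen_init inord (tindex (map inverse_label t)).
Proof.
move=> st ut t6; have [u' l'] := inverse_label_triple ut t6.
rewrite !gen_init_tindex ?size_map //.
by case: t st {ut t6 u' l'} => [|a [|b [|c [|? ?]]]].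
Qed.

Lemma permuted_weight_label t : size t = 3%N -> uniq t -> all (ltn^~ 6) t ->
  nth 0%N (permuted_weight s W) (tindex (map inverse_label t)) = nth 0%N W (tindex t).
Proof.
move=> st ut t6; have [u' l'] := inverse_label_triple ut t6.
have lt : (tindex (map inverse_label t) < size triples)%N.
  by rewrite index_mem sort_triple ?size_map.
rewrite (nth_map [::]) // nth_tindex ?size_map //; congr nth; apply: tindex_perm.
apply: (@perm_trans _ [seq nth 0%N s i | i <- map inverse_label t]).
  by apply: perm_map; rewrite perm_sort.
rewrite -map_comp (eq_in_map _ id t).1 ?map_id // => k /(allP t6) k6 /=.
exact: nth_inverse_label.
Qed.

Lemma low_index_lt V ws : (low_index V ws < 3)%N.
Proof. by rewrite /low_index; do 2 case: ifP. Qed.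

Lemma low_index_min V ws i : (i < 3)%N ->
  (weight V (nth [::] ws (low_index V ws)) <= weight V (nth [::] ws i))%N.
Proof.
rewrite /low_index; case: i => [|[|[|i]]] // _; do 2 (case: ltnP => ? //=); lia.
Qed.

Lemma low_at_equal (y : nat -> 'X_{1..3 * 6}) ws k i j : low_at le y ws k ->
  (k < 3)%N -> (i < 3)%N -> (j < 3)%N -> i != k -> j != k ->
  (\sum_(l <- nth [::] ws i) y l)%MM = (\sum_(l <- nth [::] ws j) y l)%MM.
Proof.
case: k => [|[|[|k]]] // [_ e] _; case: i => [|[|[|i]]] // _; by case: j => [|[|[|j]]].
Qed.

Lemma sextuple_words a f k : (a < 6)%N -> (f < 6)%N -> a != f -> (k < 3)%N ->
  exists i, [/\ (i < 3)%N,
    (\sum_(l <- nth [::] (cell a f) k) gen_init label l)%MM =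
      (\sum_(l <- nth [::] (cell (inverse_label a) (inverse_label f)) i) gen_init inord l)%MM &
    weight W (nth [::] (cell a f) k) =
      weight (permuted_weight s W) (nth [::] (cell (inverse_label a) (inverse_label f)) i)].
Proof.
move=> a6 f6 af k3.
have so : size (others 6 [:: a; f]) = 4%N.
  by move: af; case: a a6 => [|[|[|[|[|[|a]]]]]] // _; case: f f6 => [|[|[|[|[|[|f]]]]]].
have pall : perm_eq (a :: rcons (others 6 [:: a; f]) f) (iota 0 6).
  by move: af; case: a {so} a6 => [|[|[|[|[|[|a]]]]]] // _; case: f f6 => [|[|[|[|[|[|f]]]]]].
have ua : uniq (a :: rcons (others 6 [:: a; f]) f) by rewrite (perm_uniq pall) iota_uniq.
have a6' : all (ltn^~ 6) (a :: rcons (others 6 [:: a; f]) f).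
  by rewrite (perm_all _ pall).
have [um lm] := inverse_label_triple ua a6'.
have pin : map inverse_label (a :: rcons (others 6 [:: a; f]) f) \in perms6.
  have sub : {subset map inverse_label (a :: rcons (others 6 [:: a; f]) f) <= iota 0 6}.
    by move=> x /(allP lm); rewrite mem_iota.
  have [|_ h] := uniq_min_size um sub; first by rewrite size_map (perm_size pall).
  by rewrite mem_permutations; apply: uniq_perm (iota_uniq 0 6) h.
have three t : t \in flatten (three_splits a (others 6 [:: a; f])) ->
    [/\ size t = 3%N, uniq t & all (ltn^~ 6) t].
  move: ua a6'; case: (others 6 _) so => [|b [|c [|d [|e [|? ?]]]]] // _ ua a6' tin.
  have [mk [et st]] : exists mk, t = mask mk [:: a; b; c; d; e; f] /\ size t = 3%N.
    move: tin; rewrite /= !inE => /or4P[/eqP->|/eqP->|/eqP->|/or3P[] /eqP->].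
    - by exists [:: true; true; true].
    - by exists [:: true; false; false; true; true].
    - by exists [:: true; true; false; true].
    - by exists [:: true; false; true; false; true].
    - by exists [:: true; true; false; false; true].
    - by exists [:: true; false; true; true].
  split => //; first by rewrite et; apply: (mask_uniq ua).
  by rewrite et; apply/allP => x /mem_mask /(allP a6').
pose q := nth [::] (three_splits a (others 6 [:: a; f])) k.
have eq_cell : nth [::] (cell a f) k = map tindex q.
  rewrite /cell (nth_map [::]) //.
  by case: (others _ _) so => [|b [|c [|d [|e [|? ?]]]]].
have qin t : t \in q -> [/\ size t = 3%N, uniq t & all (ltn^~ 6) t].
  move=> tq; apply: three; apply/flattenP; exists q => //; apply: mem_nth.
  by case: (others _ _) so => [|b [|c [|d [|e [|? ?]]]]].
have [w win pw] : exists2 w, w \in cell (inverse_label a) (inverse_label f) &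
    perm_eq [seq tindex (map inverse_label t) | t <- q] w.
  have := sextuple_check_true; rewrite /sextuple_check => /allP /(_ _ pin).
  rewrite /q; case: (others _ _) so => [|b [|c [|d [|e [|? ?]]]]] // _ /=.
  have E x y z : tindex [:: inverse_label x; inverse_label y; inverse_label z]
      = tindex (map inverse_label [:: x; y; z]) by [].
  case/and4P=> /hasP[w0 h0 p0] /hasP[w1 h1 p1] /hasP[w2 h2 p2] _.
  by case: k k3 {q qin eq_cell} => [|[|[|k]]] // _; [exists w0|exists w1|exists w2].
have [i isz ei] := nthP [::] win.
have i3 : (i < 3)%N.
  apply: leq_trans isz _; rewrite size_map.
  by case: (others 6 [:: inverse_label a; inverse_label f]) => [|b [|c [|d [|e [|? ?]]]]].
exists i; rewrite ei eq_cell; split => //.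
  rewrite -(perm_big _ pw) !big_map; apply: eq_big_seq => t /qin[st ut t6].
  exact: gen_init_label.
rewrite -(weight_perm _ pw) !weightE !big_map; apply: eq_big_seq => t /qin[st ut t6].
by rewrite permuted_weight_label.
Qed.

(* Both sides are invariant under the relabelling, and the smallest product of
   each cell is determined by the weight. *)
Theorem cone_relations_hold e : e \in cone_relations W ->
  (\sum_(i <- e.1) gen_init label i)%MM = (\sum_(i <- e.2) gen_init label i)%MM.
Proof.
case/mapP=> ws wsin ->.
have [a [f [a6 f6 af ews]]] : exists a f, [/\ (a < 6)%N, (f < 6)%N, a != f & ws = cell a f].
  case/flattenP: wsin => _ /mapP[a + ->] /mapP[f + ->]; rewrite mem_iota => a6.
  by rewrite mem_filter inE mem_iota eq_sym => /andP[af f6]; exists a, f.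
rewrite ews in wsin *; set cl := cell a f in wsin *; pose k := low_index W cl.
have k3 : (k < 3)%N := low_index_lt W cl.
have strict i : (i < 3)%N -> i != k -> (weight W (nth [::] cl k) < weight W (nth [::] cl i))%N.
  move=> i3 ik; have := strict_check_true; rewrite /strict_check => /allP /(_ _ W_cone) /allP.
  by move=> /(_ _ wsin) /allP /(_ i); rewrite mem_iota => /(_ i3); rewrite -/k (negbTE ik).
have a'6 := inverse_label_lt a6; have f'6 := inverse_label_lt f6.
have af' : inverse_label a != inverse_label f.
  by apply: contra af => /eqP/(congr1 (nth 0%N s)); rewrite !nth_inverse_label // => ->.
have [k' [k'3 _ wk]] := sextuple_words a6 f6 af k3.
have low' := low_sW a'6 f'6 af'.
set l := low_index _ _ in low'; have l3 : (l < 3)%N by apply: low_index_lt.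
have key i j : (i < 3)%N -> (j < 3)%N -> i != k -> j != k ->
    (\sum_(l <- nth [::] cl i) gen_init label l)%MM = (\sum_(l <- nth [::] cl j) gen_init label l)%MM.
  move=> i3 j3 ik jk.
  have [i' [i'3 ei wi]] := sextuple_words a6 f6 af i3.
  have [j' [j'3 ej wj]] := sextuple_words a6 f6 af j3.
  rewrite ei ej; apply: low_at_equal low' l3 i'3 j'3 _ _.
    (* If the image of product [i] were the low one, [i] would have the smallest weight, against the
       strict minimality of [k]. *)
    apply: contraTneq (strict i i3 ik) => il; rewrite -leqNgt wi wk il.
    exact: low_index_min.
  apply: contraTneq (strict j j3 jk) => jl; rewrite -leqNgt wj wk jl.
  exact: low_index_min.
move: k3 key; rewrite -/k; case: k {strict wk} => [|[|[|k0]]] // _ key; exact: key.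
Qed.

End Permuted.
End Relabel.

(** * Sagbi bases from certificates *)

Lemma word_prod2 (K : fieldType) n (g : nat -> {mpoly K[n]}) i j :
  word_prod g [:: i; j] = g i * g j.
Proof. by rewrite /word_prod !big_cons big_nil mulr1. Qed.

Lemma leval_lword_sub (R : comNzRingType) (v : nat -> R) gens w w1 w2 :
  lzero (lword gens w ++ lneg (lword gens w1) ++ lword gens w2) ->
  \prod_(i <- w) leval v (nth [::] gens i) =
    \prod_(i <- w1) leval v (nth [::] gens i) - \prod_(i <- w2) leval v (nth [::] gens i).
Proof.
move/(leval_zero v); rewrite !leval_cat leval_neg !leval_word => /eqP.
by rewrite addr_eq0 opprD opprK => /eqP.
Qed.

Section Minors.
Variable K : fieldType.

Lemma bracket_swap12 (a b c : 'I_6) : bracket K b a c = - bracket K a b c.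
Proof. by rewrite !bracket_expand /orderings !big_cons !big_nil /=; ring. Qed.

Lemma bracket_swap23 (a b c : 'I_6) : bracket K a c b = - bracket K a b c.
Proof. by rewrite !bracket_expand /orderings !big_cons !big_nil /=; ring. Qed.

Lemma bracket_minor (a b c : 'I_6) : uniq [:: a; b; c] ->
  exists2 f, minors3 f & f = bracket K a b c \/ f = - bracket K a b c.
Proof.
move=> u; have [ab ac bc] : [/\ a != b, a != c & b != c].
  by move: u; rewrite /= !inE negb_or => /and3P[/andP[-> ->] ->].
have S (x y z : 'I_6) : (x < y)%N -> (y < z)%N -> minors3 (bracket K x y z).
  by move=> xy yz; exists x, y, z; rewrite xy yz.
rewrite -!val_eqE /= in ab ac bc.
case: (ltngtP a b) ab => // [ab|ba] _; case: (ltngtP a c) ac => // [ac|ca] _;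
  case: (ltngtP b c) bc => // [bc|cb] _; try lia.
- by exists (bracket K a b c); [apply: S|left].
- by exists (bracket K a c b); [apply: S|rewrite bracket_swap23; right].
- by exists (bracket K c a b); [apply: S|rewrite bracket_swap12 bracket_swap23 opprK; left].
- by exists (bracket K b a c); [apply: S|rewrite bracket_swap12; right].
- by exists (bracket K b c a); [apply: S|rewrite bracket_swap23 bracket_swap12 opprK; left].
by exists (bracket K c b a); [apply: S|
  rewrite bracket_swap12 bracket_swap23 bracket_swap12 !opprK; right].
Qed.

Lemma bracket_G36 (a b c : 'I_6) : uniq [:: a; b; c] -> G36 (bracket K a b c).
Proof.
case/bracket_minor=> f mf [] e; first by rewrite -e; apply: subalg_gen_mem.
by rewrite -[bracket K a b c]opprK -e; apply/subalg_gen_opp/subalg_gen_mem.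
Qed.

Lemma exchange_G36 (a b c d e f : 'I_6) : uniq [:: a; b; c; d; e; f] ->
  G36 (exchange K a b c d e f).
Proof.
move=> u; have h (mk : bitseq) := mask_uniq u mk.
apply: subalg_gen_sub; apply: subalg_gen_mul; apply: bracket_G36.
- exact: (h [:: true; true; true]).
- exact: (h [:: false; false; false; true; true; true]).
- exact: (h [:: true; true; false; true]).
exact: (h [:: false; false; true; false; true; true]).
Qed.

Lemma orbitF_G36 H : orbitF H -> G36 (H : {mpoly K[3 * 6]}).
Proof.
case=> a [b [c [d [e [f [E ->]]]]]]; apply: exchange_G36.
(* Six labels that exhaust a set of six elements are distinct. *)
have := cardsT 'I_6; rewrite card_ord -E => h.
apply/card_uniqP; rewrite -[RHS]h /=; apply: eq_card => x.
by rewrite !inE -!orbA.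
Qed.

End Minors.

Section Certified.
Variables (K : fieldType) (le : rel 'X_{1..3 * 6}).
Hypothesis ole : monomial_order le.
Variable s : seq nat.
Hypothesis s_perm : s \in perms6.

Definition gen (i : nat) : {mpoly K[3 * 6]} :=
  leval (entry K (label s)) (nth [::] generators i).

Lemma size_triples : size triples = 20%N. Proof. by vm_compute. Qed.

Lemma triples_nthP i : (i < 20)%N -> exists a b c,
  [/\ nth [::] triples i = [:: a; b; c], (a < b < c)%N & (c < 6)%N].
Proof.
move=> i20; have : all (fun t => if t is [:: a; b; c] then (a < b < c) && (c < 6) else false)%N triples.
  by vm_compute.
move/(all_nthP [::])/(_ i); rewrite size_triples => /(_ i20).
by case: (nth _ _ _) => [|a [|b [|c [|? ?]]]] // /andP[abc c6]; exists a, b, c.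
Qed.

Lemma label_uniq t : uniq t -> all (ltn^~ 6) t -> uniq (map (label s) t).
Proof.
move=> ut t6; have [u' l'] := inverse_label_triple s_perm ut t6.
by rewrite (map_comp (fun k => inord k) (inverse_label s)); apply: uniq_inord.
Qed.

Lemma gen_bracket i : (i < 20)%N -> exists a b c : 'I_6,
  [/\ uniq [:: a; b; c], gen i = bracket K a b c & gen_init le (label s) i = bracket_init le a b c].
Proof.
move=> i20; have [a [b [c [ti /andP[ab bc] c6]]]] := triples_nthP i20.
exists (label s a), (label s b), (label s c); split.
- by apply: (@label_uniq [:: a; b; c]); rewrite /= ?inE; lia.
- rewrite /gen /generators nth_rcons size_map size_triples i20 (nth_map [::]) ?size_triples //.
  by rewrite ti /= leval_bracket //; lia.
by rewrite /gen_init ti.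
Qed.

Lemma bracket_gen (a b c : 'I_6) : uniq [:: a; b; c] -> exists i, [/\ (i < 20)%N,
  bracket K a b c = gen i \/ bracket K a b c = - gen i &
  gen_init le (label s) i = bracket_init le a b c].
Proof.
move=> u; pose t := [seq nth 0%N s (x : 'I_6) | x <- [:: a; b; c]].
have labt : map (label s) t = [:: a; b; c] by rewrite /= !label_nth.
have ut : uniq t by apply: (@map_uniq _ _ (label s)); rewrite labt.
have t6 : all (ltn^~ 6) t.
  have sP : perm_eq s (iota 0 6) by rewrite -mem_permutations.
  have h (x : 'I_6) : (nth 0%N s x < 6)%N.
    have := mem_nth 0%N (_ : (x < size s)%N); rewrite (perm_size sP) => /(_ (ltn_ord x)).
    by rewrite (perm_mem sP) mem_iota.
  by rewrite /= !h.
have i20 : (tindex t < 20)%N by apply: tindex_lt.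
exists (tindex t); split => //; last by rewrite gen_init_tindex // /t /= !label_nth.
(* Equality up to sign is symmetric in the columns although the bracket alternates, so that
   [perm_eq3_sym] applies to it. *)
pose F x y z := (bracket K x y z == gen (tindex t)) || (bracket K x y z == - gen (tindex t)).
have F12 x y z : F x y z = F y x z.
  by rewrite /F bracket_swap12 !eqr_oppLR opprK orbC.
have F23 x y z : F x y z = F x z y.
  by rewrite /F bracket_swap23 !eqr_oppLR opprK orbC.
have [x [y [z [ti /andP[xy yz] z6]]]] := triples_nthP i20.
have pt : perm_eq [:: label s x; label s y; label s z] [:: a; b; c].
  rewrite -labt -[X in perm_eq X _]/(map (label s) [:: x; y; z]) -ti nth_tindex //.
  by apply: perm_map; rewrite perm_sort.
have : F a b c.
  rewrite -(perm_eq3_sym F12 F23 pt) /F /gen /generators nth_rcons size_map size_triples i20.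
  by rewrite (nth_map [::]) ?size_triples // ti /= leval_bracket ?eqxx //; lia.
by case/orP=> /eqP; [left|right].
Qed.

Definition gens_init (mH : 'X_{1..3 * 6}) (i : nat) : 'X_{1..3 * 6} :=
  if i == 20%N then mH else gen_init le (label s) i.

Lemma rank_gens_init mH N : (20 <= N)%N -> (10 <= \rank (exponent_mx N (gens_init mH)))%N.
Proof.
move=> N20; apply: (rank_initials ole) => a b c /bracket_gen[i [i20 _ <-]].
have iN := leq_trans i20 N20.
have -> : mnm_row (gen_init le (label s) i) = row (Ordinal iN) (exponent_mx N (gens_init mH)).
  by rewrite rowK /gens_init /= (ltn_eqF i20).
exact: row_sub.
Qed.

Lemma gen_is_init i : (i < 20)%N -> is_initial_monomial le (gen i) (gen_init le (label s) i).
Proof. by case/gen_bracket=> a [b [c [u -> ->]]]; case: (bracket_initP ole K u). Qed.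

(** The order enters only through the equalities [relE] and the initial monomials [initE]. The rank
    bound turns each functional of the certificate into a linear function of the exponents, and two
    words count as the same when their initial monomials agree. *)
Theorem sagbi_of_certificate N E c mH (T : {mpoly K[3 * 6]} -> Prop) :
  (20 <= N)%N -> certificate_check N E c ->
  (forall e, e \in E -> (\sum_(i <- e.1) gens_init mH i)%MM = (\sum_(i <- e.2) gens_init mH i)%MM) ->
  (forall i, (i < N)%N -> is_initial_monomial le (gen i) (gens_init mH i)) ->
  (forall f, T f -> G36 f) ->
  (forall i, (i < N)%N -> exists2 f, T f & f = gen i \/ f = - gen i) ->
  sagbi_basis le (@G36 K) T.
Proof.
move=> N20 /and5P[valid lowers tri facetsE /and3P[wallsE detE /eqP size_base]] relE initE TG genT.
have rank10 : (size (base c) <= \rank (exponent_mx N (gens_init mH)))%N.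
  by rewrite size_base rank_gens_init.
have functional v k := @functional_of_relations N _ _ E (base c) relE detE rank10 v k (weights c).
apply: (@sagbi_of_standard_words K _ le ole N gen (gens_init mH) (@minors3 K) T (rules c) (weights c)) => //.
- move=> f [x [y [z [xyz ->]]]]; have [|i [i20 e _]] := @bracket_gen x y z.
    by move: xyz; rewrite /= !inE -!val_eqE /=; lia.
  by exists i => //; apply: leq_trans i20 N20.
- by apply: sub_all (rewriting_validP (entry K (label s)) valid) => r /eqP e; apply/eqP; exact: e.
apply: (standard_words_separated (W := weights c) _ tri) => [w w' -> //|v w w' vF wN w'N e|v w w' vW wN w'N e].
  by have := functional v 1%N w w' (allP facetsE v vF) wN w'N e; rewrite !mul1n.
by have := functional v 0%N w w' (allP wallsE v vW) wN w'N e; rewrite !mul0n !addn0.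
Qed.

End Certified.

Lemma sagbi_basis_mono (K : fieldType) n (le : rel 'X_{1..n}) (S T T' : {mpoly K[n]} -> Prop) :
  monomial_order le -> sagbi_basis le (subalg_gen S) T -> (forall f, T f -> T' f) ->
  (forall f, T' f -> subalg_gen S f) -> sagbi_basis le (subalg_gen S) T'.
Proof.
move=> ole [_ h] TT' T'S; apply: sagbi_basis_of_initials => // f m Sf If.
have /h : initial_algebra le (subalg_gen S) 'X_[m].
  by apply: lin_span_mem; exists f, m; split.
move=> h'; apply: subalg_gen_bind h' _ => _ [g [m' [Tg Ig ->]]].
by apply: subalg_gen_mem; exists g, m'; split; auto.
Qed.

Lemma init_sub (K : fieldType) n (le : rel 'X_{1..n}) (f g : {mpoly K[n]}) m m' :
  monomial_order le -> is_initial_monomial le f m -> is_initial_monomial le g m' ->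
  mlt le m' m -> is_initial_monomial le (f - g) m.
Proof.
move=> ole /(initP le)[f0 hf] /(initP le)[_ hg] lt; apply/(initP le).
rewrite mcoeffB hg // subr0; split=> // a ma.
by rewrite mcoeffB hf // hg ?subr0 //; apply: mle_lt_trans ma => //; apply: mltW.
Qed.

(** * The cone where a further generator is needed *)

Section Bipyramid.
Variables (K : fieldType) (le : rel 'X_{1..3 * 6}).
Hypothesis ole : monomial_order le.
Variable s : seq nat.
Hypothesis s_perm : s \in perms6.
Let W := head [::] cone_weights.
Hypothesis relW : forall e, e \in cone_relations W ->
  (\sum_(i <- e.1) gen_init le (label s) i)%MM = (\sum_(i <- e.2) gen_init le (label s) i)%MM.

Lemma gen20 : gen K s 20 = exchange K (label s 0) (label s 2) (label s 1)
  (label s 3) (label s 4) (label s 5).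
Proof.
rewrite /gen /generators nth_rcons size_map size_triples ltnn eqxx leval_cat leval_neg !leval_mul.
by rewrite !leval_bracket.
Qed.

Lemma gen20_orbitF : orbitF (gen K s 20).
Proof.
exists (label s 0), (label s 2), (label s 1), (label s 3), (label s 4), (label s 5).
split; last exact: gen20.
have u := @label_uniq s s_perm [:: 0; 2; 1; 3; 4; 5]%N isT isT.
apply/eqP; rewrite eqEcard subsetT cardsT card_ord /=.
move/card_uniqP: u => /= {1}<-; apply: subset_leq_card; apply/subsetP => x.
by rewrite !inE -!orbA.
Qed.

Lemma gens_init20 mH : gens_init le s mH 20 = mH.
Proof. by rewrite /gens_init eqxx. Qed.

Lemma gens_init_lt mH i : (i < 20)%N -> gens_init le s mH i = gen_init le (label s) i.
Proof. by move=> i20; rewrite /gens_init (ltn_eqF i20). Qed.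

Lemma gens_init_small mH w : all (ltn^~ 20) w ->
  (\sum_(i <- w) gens_init le s mH i)%MM = (\sum_(i <- w) gen_init le (label s) i)%MM.
Proof.
move=> /allP w20; by apply: eq_big_seq => i /w20; apply: gens_init_lt.
Qed.

Lemma cone_relations_small V e : e \in cone_relations V ->
  all (ltn^~ 20) e.1 /\ all (ltn^~ 20) e.2.
Proof.
case/mapP=> ws wsin ->; have h : all (all (all (ltn^~ 20))) (flatten cell_rows).
  by vm_compute.
have hws i : all (ltn^~ 20) (nth [::] ws i).
  case: (ltnP i (size ws)) => hi; last by rewrite nth_default.
  exact: (allP (allP h _ wsin)) (mem_nth _ hi).
by case: low_index => [|[|k]] /=.
Qed.

Lemma gens_init_relations mH V e :
  (forall e, e \in cone_relations V ->
    (\sum_(i <- e.1) gen_init le (label s) i)%MM = (\sum_(i <- e.2) gen_init le (label s) i)%MM) ->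
  e \in cone_relations V ->
  (\sum_(i <- e.1) gens_init le s mH i)%MM = (\sum_(i <- e.2) gens_init le s mH i)%MM.
Proof.
by move=> relV eV; have [h1 h2] := cone_relations_small eV; rewrite !gens_init_small // relV.
Qed.

Let mu w := (\sum_(i <- w) gen_init le (label s) i)%MM.

Lemma bipyramid_words_neq : mu bipyramid_words.1 != mu bipyramid_words.2.
Proof.
have /and4P[resp det ne /eqP size_base] := bipyramid_functional_check.
apply: contra ne => /eqP e.
have w120 : all (ltn^~ 20) bipyramid_words.1 by [].
have w220 : all (ltn^~ 20) bipyramid_words.2 by [].
have rank10 : (size (base certificate7) <= \rank (exponent_mx 20 (gens_init le s 0%MM)))%N.
  by rewrite size_base rank_gens_init.
have relE e' : e' \in cone_relations W -> (\sum_(i <- e'.1) gens_init le s 0%MM i)%MM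
    = (\sum_(i <- e'.2) gens_init le s 0%MM i)%MM by apply: gens_init_relations.
have eS : (\sum_(i <- bipyramid_words.1) gens_init le s 0%MM i)%MM
    = (\sum_(i <- bipyramid_words.2) gens_init le s 0%MM i)%MM.
  by rewrite (gens_init_small 0%MM w120) (gens_init_small 0%MM w220).
have h := functional_of_relations relE det rank10 resp w120 w220 eS.
by move: h; rewrite !mul0n !addn0 => ->.
Qed.

(** On this cone the leading terms of the two products in the exchange polynomial cancel, so its
    initial monomial cannot be read off them. Multiplied by the minor with number 2 it becomes a
    difference of two words whose initial monomials differ, and the factor is then divided out. *)
Lemma bipyramid_init w1 w2 : all (ltn^~ 20) w1 -> all (ltn^~ 20) w2 -> mlt le (mu w2) (mu w1) ->
  word_prod (gen K s) [:: 20; 2]%N = word_prod (gen K s) w1 - word_prod (gen K s) w2 \/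
  word_prod (gen K s) [:: 20; 2]%N = - (word_prod (gen K s) w1 - word_prod (gen K s) w2) ->
  exists2 mH, is_initial_monomial le (gen K s 20) mH &
    (mH + gen_init le (label s) 2)%MM = mu w1.
Proof.
move=> /allP w1N /allP w2N lt def.
have iw w : {in w, forall i, i < 20}%N -> is_initial_monomial le (word_prod (gen K s) w) (mu w).
  by move=> wN; apply: init_prod => // i /wN; apply: gen_is_init.
have I : is_initial_monomial le (gen K s 20 * gen K s 2) (mu w1).
  have e : gen K s 20 * gen K s 2 = word_prod (gen K s) [:: 20; 2]%N.
    by rewrite word_prod2.
  by rewrite e; case: def => ->; [|apply: init_opp => //]; apply: init_sub lt => //; apply: iw.
have H0 : gen K s 20 != 0.
  by apply: contraTneq (I.1) => ->; rewrite mul0r msupp0.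
have [mH IH] := init_exists ole H0; exists mH => //.
have I2 := init_mul ole IH (@gen_is_init K le ole s s_perm 2 isT).
exact: init_unique I2 I.
Qed.

Lemma bipyramid_sagbi H : H = gen K s 20 \/ H = - gen K s 20 ->
  sagbi_basis le (@G36 K) (fun p => @minors3 K p \/ p = H).
Proof.
move=> HE.
have rule : word_prod (gen K s) [:: 20; 2]%N =
    word_prod (gen K s) bipyramid_words.1 - word_prod (gen K s) bipyramid_words.2.
  exact: leval_lword_sub bipyramid_ruleT.
have TG f : minors3 f \/ f = H -> G36 f.
  case=> [|->]; first exact: subalg_gen_mem.
  have GH := orbitF_G36 gen20_orbitF.
  by case: HE => -> //; apply: subalg_gen_opp.
have certify w c mH : is_initial_monomial le (gen K s 20) mH ->
    (mH + gen_init le (label s) 2)%MM = mu w -> all (ltn^~ 20) w ->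
    certificate_check 21 (bipyramid_relations w) c ->
    sagbi_basis le (@G36 K) (fun p => @minors3 K p \/ p = H).
  move=> IH mHE w20 check.
  apply: (sagbi_of_certificate (T := fun p => minors3 p \/ p = H) ole s_perm _ check (mH := mH)) => //.
  - move=> e; rewrite mem_rcons inE => /orP[/eqP->|]; last exact: gens_init_relations.
    rewrite /= (gens_init_small mH w20) -/(mu w) -mHE big_cons big_seq1 gens_init20.
    by rewrite (gens_init_lt mH (isT : 2 < 20)%N).
  - move=> i; rewrite ltnS leq_eqVlt => /orP[/eqP->|i20]; first by rewrite gens_init20.
    by rewrite gens_init_lt //; apply: gen_is_init.
  move=> i; rewrite ltnS leq_eqVlt => /orP[/eqP->|i20].
    by exists H; [right|].
  have [a [b [d [u -> _]]]] := @gen_bracket K le s s_perm i i20.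
  by have [f mf hf] := bracket_minor K u; exists f; [left|].
have small1 : all (ltn^~ 20) bipyramid_words.1 by [].
have small2 : all (ltn^~ 20) bipyramid_words.2 by [].
(* The hyperplane where the two words would tie cuts the cone into two halves, each with its own
   certificate. *)
case/orP: (monomial_order_total ole (mu bipyramid_words.2) (mu bipyramid_words.1)) => h.
  have lt : mlt le (mu bipyramid_words.2) (mu bipyramid_words.1).
    by rewrite mlt_neqAle // eq_sym bipyramid_words_neq.
  have [mH IH e] := bipyramid_init small1 small2 lt (or_introl rule).
  exact: certify IH e small1 certificate7_check.
have lt : mlt le (mu bipyramid_words.1) (mu bipyramid_words.2).
  by rewrite mlt_neqAle // bipyramid_words_neq.
have rule' := rule; rewrite -opprB in rule'.
have [mH IH e] := bipyramid_init small2 small1 lt (or_intror rule').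
exact: certify IH e small2 certificate8_check.
Qed.

End Bipyramid.

Theorem theorem8p4 (K : fieldType) (OF : {mpoly K[3 * 6]} -> Prop)
    (hOF : representatives_mod_sign (@orbitF K) OF) :
  universal_sagbi_basis (@G36 K) (fun p => @minors3 K p \/ OF p) /\
  (forall le : rel 'X_{1..3 * 6}, monomial_order le ->
     sagbi_basis le (@G36 K) (@minors3 K) \/
     exists H, OF H /\
       sagbi_basis le (@G36 K) (fun p => @minors3 K p \/ p = H)).
Proof.
have main (le : rel 'X_{1..3 * 6}) : monomial_order le ->
     sagbi_basis le (@G36 K) (@minors3 K) \/
     exists H, OF H /\ sagbi_basis le (@G36 K) (fun p => @minors3 K p \/ p = H).
  move=> ole.
  have [s [W [s_perm W_cone low_sW]]] := classification ole (low_gen_init ole).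
  have relW := cone_relations_hold ole s_perm W_cone low_sW.
  have [k k7 Wk] := nthP [::] W_cone.
  (* Position 0 of [cone_weights] is the orbit of size 15. There the representative [H] in [OF] may
     be the negative of the relabelled exchange polynomial, which has the same initial monomial. *)
  case: k k7 Wk => [|k] k7 Wk.
    have [H [[OH HE] _]] := hOF.2 _ (gen20_orbitF K s_perm).
    by right; exists H; split => //; apply: (bipyramid_sagbi ole s_perm _ HE); rewrite -Wk in relW.
  left; have [c check] := @cone_certificates_check k k7; rewrite Wk in check.
  have TG f : minors3 f -> @G36 K f by apply: subalg_gen_mem.
  apply: (sagbi_of_certificate (T := @minors3 K) ole s_perm _ check (mH := 0%MM)) => //.
  - by move=> e; apply: gens_init_relations.
  - by move=> i i20; rewrite gens_init_lt //; apply: gen_is_init.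
  move=> i i20; have [a [b [d [u -> _]]]] := @gen_bracket K le s s_perm i i20.
  exact: bracket_minor.
split => // le ole.
have OG f : minors3 f \/ OF f -> @G36 K f.
  case=> [|/hOF.1]; [exact: subalg_gen_mem|exact: orbitF_G36].
(* A Sagbi basis stays one when elements of the algebra are added, so the refined statement implies
   the universal one. *)
case: (main le ole) => [h|[H [OH h]]]; apply: (sagbi_basis_mono ole h) => // f; first by left.
by case=> [|->]; [left|right].
Qed.
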